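(* (In simplicial type theory.) Let $A$ be a type. Then $A$ is a pre-$\infty$-category (Segal type) if and only if, for every $a:A$, the type family $\hom_A(a,-) : A \to \mathcal{U}$, $x \mapsto \hom_A(a,x)$, is covariant.
   Context: **Ambient theory.** The theorem is a statement inside simplicial type theory (Riehl–Shulman), an extension of intensional Martin-Löf type theory with $\Sigma$-, $\Pi$- (judgmental $\beta,\eta$) and identity types $x =_A y$. Type families are written $C : A \to \mathcal{U}$. Univalence is not assumed. Contractibility: $\mathsf{isContr}(X) :\equiv \sum_{x:X}\prod_{y:X}(x=y)$. **Cubes, topes, shapes.** There is a cube $\mathbf{2}$ (directed interval) with points $0,1:\mathbf 2$ and a relation (tope) $x\le y$ which is a total order on $\mathbf 2$ with distinct bottom $0$ and top $1$; cubes are the finite powers $\mathbf 2^n$. Topes are formulas of a finitary intuitionistic logic over cube variables (built from $\top,\bot,\wedge,\vee,\equiv,\le$). A shape is $\{t:I\mid\varphi\}$ for a cube $I$ and tope $\varphi$. In particular $\Delta^1 :\equiv\{t:\mathbf 2\mid\top\}$, $\partial\Delta^1:\equiv\{t:\mathbf 2\mid (t\equiv 0)\vee(t\equiv 1)\}$, $\Delta^2:\equiv\{(t,s):\mathbf 2^2\mid s\le t\}$, $\partial\Delta^2:\equiv\{(t,s):\mathbf 2^2\mid (s\equiv 0)\vee(s\equiv t)\vee(t\equiv 1)\}$. Types and terms may depend on cube variables and tope assumptions. **Extension types.** For a shape inclusion $\Phi\subseteq\Psi$, a family $A$ over $\Psi$, and a partial section $a:\prod_{t:\Phi}A(t)$,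 the extension type $\left\langle \prod_{t:\Psi}A(t)\,\middle|^{\Phi}_{a}\right\rangle$ consists of sections $b$ of $A$ over $\Psi$ that agree judgmentally with $a$ on $\Phi$; it is written $\langle\Psi\to A|^\Phi_a\rangle$ when $A$ is constant. **Standing axioms.** Function extensionality: for $f,g:\prod_{x:X}A(x)$ the canonical map $(f=g)\to\prod_{x:X}(f x=g x)$ is an equivalence. Extension extensionality: for $f,g:\left\langle \prod_{t:\Psi}A(t)\,\middle|^{\Phi}_{a}\right\rangle$ the canonical map $(f=g)\to\left\langle\prod_{t:\Psi}(f(t)=g(t))\,\middle|^{\Phi}_{\mathrm{refl}}\right\rangle$ is an equivalence. **Hom types.** For $a,b:A$, $\hom_A(a,b):\equiv\langle\Delta^1\to A|^{\partial\Delta^1}_{[a,b]}\rangle$, where $[a,b](0)\equiv a$, $[a,b](1)\equiv b$. For $f:\hom_A(x,y)$, $g:\hom_A(y,z)$, $h:\hom_A(x,z)$, $\hom_A^2(f,g;h):\equiv\langle\Delta^2\to A|^{\partial\Delta^2}_{[f,g;h]}\rangle$, the type of $2$-simplices whose boundary is $f$ on $s\equiv0$ (value $f(t)$), $g$ on $t\equiv1$ (value $g(s)$), and $h$ on $s\equiv t$ (value $h(t)$). **Pre-$\infty$-category (Segal type).** A type $A$ such that for all $x,y,z:A$, $f:\hom_A(x,y)$, $g:\hom_A(y,z)$, the type $\sum_{h:\hom_A(x,z)}\hom_A^2(f,g;h)$ is contractible. **Covariant family.** For $C:A\to\mathcal U$, $f:\hom_A(x,y)$, $u:C(x)$, $v:C(y)$,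 let $\mathrm{dhom}_{C(f)}(u,v):\equiv\left\langle\prod_{t:\Delta^1}C(f(t))\,\middle|^{\partial\Delta^1}_{[u,v]}\right\rangle$. The family $C$ is covariant if for all $x,y:A$, $f:\hom_A(x,y)$, $u:C(x)$, the type $\sum_{v:C(y)}\mathrm{dhom}_{C(f)}(u,v)$ is contractible. *)

(* Defs.v *)
(* Simplicial type theory of Riehl and Shulman, as a deductive system: raw
   syntax, tope entailment, and the judgments [has_type] (typing) and [eq_tm]
   (typed judgmental equality).  "A theorem of simplicial type theory" is then
   a type inhabited by a derivable closed term. *)
From Stdlib Require Import List Arith.
Import ListNotations.

(** * Cubes, topes, shapes *)

(* The cubes are the powers 2^n, so a cube context is a number n of variables
   ranging over 2, and a point of 2^k is a list of k points of 2. *)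
Inductive point : Type :=
| PVar (i : nat)
| P0
| P1.

Inductive tope : Type :=
| TTop
| TBot
| TAnd (phi psi : tope)
| TOr (phi psi : tope)
| TEq (s t : point)
| TLe (s t : point).

Definition point_scoped (n : nat) (p : point) : Prop :=
  match p with PVar i => i < n | P0 | P1 => True end.

Fixpoint tope_scoped (n : nat) (phi : tope) : Prop :=
  match phi with
  | TTop | TBot => True
  | TAnd a b | TOr a b => tope_scoped n a /\ tope_scoped n b
  | TEq s t | TLe s t => point_scoped n s /\ point_scoped n t
  end.

Definition point_subst (rho : nat -> point) (p : point) : point :=
  match p with PVar i => rho i | P0 => P0 | P1 => P1 end.

Fixpoint tope_subst (rho : nat -> point) (phi : tope) : tope :=
  match phi with
  | TTop => TTop
  | TBot => TBot
  | TAnd a b => TAnd (tope_subst rho a) (tope_subst rho b)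
  | TOr a b => TOr (tope_subst rho a) (tope_subst rho b)
  | TEq s t => TEq (point_subst rho s) (point_subst rho t)
  | TLe s t => TLe (point_subst rho s) (point_subst rho t)
  end.

(* A binder over 2^k binds k cube variables at once: inside it, [PVar i] with
   i < k is the i-th coordinate (so in {(t,s) : 2^2 | ...}, t is [PVar 0] and
   s is [PVar 1]), and the outer variables are shifted by k. *)
Definition pshift (k : nat) : nat -> point := fun i => PVar (k + i).

Definition pinst (ts : list point) : nat -> point :=
  fun i => nth i ts (PVar (i - length ts)).

Definition pup (k : nat) (rho : nat -> point) : nat -> point :=
  fun i => if i <? k then PVar i else point_subst (pshift k) (rho (i - k)).

(* Intuitionistic natural deduction for topes, with the axioms making 2 a
   total order with distinct bottom 0 and top 1. *)
Inductive entails (Phi : list tope) : tope -> Prop :=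
| ent_hyp phi : In phi Phi -> entails Phi phi
| ent_top : entails Phi TTop
| ent_bot phi : entails Phi TBot -> entails Phi phi
| ent_and phi psi : entails Phi phi -> entails Phi psi -> entails Phi (TAnd phi psi)
| ent_and_l phi psi : entails Phi (TAnd phi psi) -> entails Phi phi
| ent_and_r phi psi : entails Phi (TAnd phi psi) -> entails Phi psi
| ent_or_l phi psi : entails Phi phi -> entails Phi (TOr phi psi)
| ent_or_r phi psi : entails Phi psi -> entails Phi (TOr phi psi)
| ent_or_elim phi psi chi :
    entails Phi (TOr phi psi) ->
    entails (phi :: Phi) chi -> entails (psi :: Phi) chi ->
    entails Phi chi
| ent_eq_refl s : entails Phi (TEq s s)
| ent_eq_subst s t phi :
    entails Phi (TEq s t) ->
    entails Phi (tope_subst (pinst [s]) phi) ->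
    entails Phi (tope_subst (pinst [t]) phi)
| ent_le_refl s : entails Phi (TLe s s)
| ent_le_trans r s t : entails Phi (TLe r s) -> entails Phi (TLe s t) -> entails Phi (TLe r t)
| ent_le_antisym s t : entails Phi (TLe s t) -> entails Phi (TLe t s) -> entails Phi (TEq s t)
| ent_le_total s t : entails Phi (TOr (TLe s t) (TLe t s))
| ent_le_0 s : entails Phi (TLe P0 s)
| ent_le_1 s : entails Phi (TLe s P1)
| ent_01 : entails Phi (TEq P0 P1) -> entails Phi TBot.

(** * Terms *)

(* Types are terms of a universe.  Term variables and cube variables are two
   separate families of de Bruijn indices. *)
Inductive tm : Type :=
| Var (i : nat)
| Univ (l : nat)
| Pi (A B : tm)                       (* B binds a term variable *)
| Lam (b : tm)                        (* b binds a term variable *)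
| App (f a : tm)
| Sig (A B : tm)                      (* B binds a term variable *)
| Pair (a b : tm)
| Fst (p : tm)
| Snd (p : tm)
| Id (A a b : tm)
| Refl (a : tm)
| J (P d p : tm)                      (* P binds an endpoint ([Var 1]) and a path ([Var 0]) *)
| Ext (k : nat) (psi phi : tope) (A a : tm)
    (* <prod_{t : 2^k | psi} A(t) |^{phi}_{a}>; A and a bind k cube variables;
       psi and phi have no cube variables other than these k *)
| ExtLam (k : nat) (b : tm)           (* b binds k cube variables *)
| ExtApp (f : tm) (ts : list point)
| RecOr (phi psi : tope) (a b : tm)   (* the term equal to a on phi and to b on psi *)
| RecBot                              (* the unique term under an inconsistent tope *)
| FunExt (f g : tm)
| ExtExt (f g : tm).

Definition rup (xi : nat -> nat) : nat -> nat :=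
  fun i => match i with 0 => 0 | S i => S (xi i) end.

(* Substitutes points for cube variables and renames term variables. *)
Fixpoint ren (rho : nat -> point) (xi : nat -> nat) (t : tm) : tm :=
  match t with
  | Var i => Var (xi i)
  | Univ l => Univ l
  | Pi A B => Pi (ren rho xi A) (ren rho (rup xi) B)
  | Lam b => Lam (ren rho (rup xi) b)
  | App f a => App (ren rho xi f) (ren rho xi a)
  | Sig A B => Sig (ren rho xi A) (ren rho (rup xi) B)
  | Pair a b => Pair (ren rho xi a) (ren rho xi b)
  | Fst p => Fst (ren rho xi p)
  | Snd p => Snd (ren rho xi p)
  | Id A a b => Id (ren rho xi A) (ren rho xi a) (ren rho xi b)
  | Refl a => Refl (ren rho xi a)
  | J P d p => J (ren rho (rup (rup xi)) P) (ren rho xi d) (ren rho xi p)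
  | Ext k psi phi A a => Ext k psi phi (ren (pup k rho) xi A) (ren (pup k rho) xi a)
  | ExtLam k b => ExtLam k (ren (pup k rho) xi b)
  | ExtApp f ts => ExtApp (ren rho xi f) (map (point_subst rho) ts)
  | RecOr phi psi a b =>
      RecOr (tope_subst rho phi) (tope_subst rho psi) (ren rho xi a) (ren rho xi b)
  | RecBot => RecBot
  | FunExt f g => FunExt (ren rho xi f) (ren rho xi g)
  | ExtExt f g => ExtExt (ren rho xi f) (ren rho xi g)
  end.

Definition wk (m : nat) : tm -> tm := ren PVar (Nat.add m).
(* Weakening by m variables situated just below the innermost one. *)
Definition wk_under (m : nat) : tm -> tm := ren PVar (rup (Nat.add m)).
Definition cwk (k : nat) : tm -> tm := ren (pshift k) (fun i => i).
Definition cinst (ts : list point) : tm -> tm := ren (pinst ts) (fun i => i).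

Definition sup (sigma : nat -> tm) : nat -> tm :=
  fun i => match i with 0 => Var 0 | S i => wk 1 (sigma i) end.
Definition csup (k : nat) (sigma : nat -> tm) : nat -> tm :=
  fun i => cwk k (sigma i).

Fixpoint subst (sigma : nat -> tm) (t : tm) : tm :=
  match t with
  | Var i => sigma i
  | Univ l => Univ l
  | Pi A B => Pi (subst sigma A) (subst (sup sigma) B)
  | Lam b => Lam (subst (sup sigma) b)
  | App f a => App (subst sigma f) (subst sigma a)
  | Sig A B => Sig (subst sigma A) (subst (sup sigma) B)
  | Pair a b => Pair (subst sigma a) (subst sigma b)
  | Fst p => Fst (subst sigma p)
  | Snd p => Snd (subst sigma p)
  | Id A a b => Id (subst sigma A) (subst sigma a) (subst sigma b)
  | Refl a => Refl (subst sigma a)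
  | J P d p => J (subst (sup (sup sigma)) P) (subst sigma d) (subst sigma p)
  | Ext k psi phi A a => Ext k psi phi (subst (csup k sigma) A) (subst (csup k sigma) a)
  | ExtLam k b => ExtLam k (subst (csup k sigma) b)
  | ExtApp f ts => ExtApp (subst sigma f) ts
  | RecOr phi psi a b => RecOr phi psi (subst sigma a) (subst sigma b)
  | RecBot => RecBot
  | FunExt f g => FunExt (subst sigma f) (subst sigma g)
  | ExtExt f g => ExtExt (subst sigma f) (subst sigma g)
  end.

Definition inst1 (B a : tm) : tm :=
  subst (fun i => match i with 0 => a | S i => Var i end) B.
Definition inst2 (P b p : tm) : tm :=
  subst (fun i => match i with 0 => p | 1 => b | S (S i) => Var i end) P.

(** * Derived type formers needed by the extensionality axioms *)

Definition arrow (A B : tm) : tm := Pi A (wk 1 B).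
Definition times (A B : tm) : tm := Sig A (wk 1 B).

(* Bi-invertibility:
   (Sigma (g : Y -> X), Pi x, g (f x) = x) * (Sigma (h : Y -> X), Pi y, f (h y) = y). *)
Definition is_equiv (X Y f : tm) : tm :=
  times
    (Sig (arrow Y X)
       (Pi (wk 1 X) (Id (wk 2 X) (App (Var 1) (App (wk 2 f) (Var 0))) (Var 0))))
    (Sig (arrow Y X)
       (Pi (wk 1 Y) (Id (wk 2 Y) (App (wk 2 f) (App (Var 1) (Var 0))) (Var 0)))).

(* Pi (x : A), f x = g x, for f g : Pi (x : A), B x. *)
Definition pointwise (A B f g : tm) : tm :=
  Pi A (Id B (App (wk 1 f) (Var 0)) (App (wk 1 g) (Var 0))).

(* The canonical map (f = g) -> Pi (x : A), f x = g x, by path induction with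
   motive (h, q) |-> Pi (x : A), f x = h x. *)
Definition happly (A B f : tm) : tm :=
  Lam (J (Pi (wk 3 A) (Id (wk_under 3 B) (App (wk 4 f) (Var 0)) (App (Var 2) (Var 0))))
         (Lam (Refl (App (wk 2 f) (Var 0))))
         (Var 0)).

Definition cvars (k : nat) : list point := map PVar (seq 0 k).

(* <prod_{t : psi} f t = g t |^{phi}_{refl}>; on phi, f t and g t are both a t. *)
Definition ext_pointwise (k : nat) (psi phi : tope) (A a f g : tm) : tm :=
  Ext k psi phi (Id A (ExtApp (cwk k f) (cvars k)) (ExtApp (cwk k g) (cvars k))) (Refl a).

(* The canonical map (f = g) -> ext_pointwise, by path induction with motive
   (h, q) |-> <prod_{t : psi} f t = h t |^{phi}_{refl}>. *)
Definition ext_happly (k : nat) (psi phi : tope) (A a f : tm) : tm :=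
  Lam (J (ext_pointwise k psi phi (wk 3 A) (wk 3 a) (wk 3 f) (Var 1))
         (ExtLam k (Refl (ExtApp (cwk k (wk 1 f)) (cvars k))))
         (Var 0)).

(** * Judgments *)

(* Cube context, tope context, type context (innermost variable first). *)
Record ctx : Type := Ctx { cubes : nat; topes : list tope; types : list tm }.

Definition empty : ctx := Ctx 0 [] [].
Definition ext_type (G : ctx) (A : tm) : ctx :=
  Ctx (cubes G) (topes G) (A :: types G).
Definition ext_tope (G : ctx) (phi : tope) : ctx :=
  Ctx (cubes G) (phi :: topes G) (types G).
Definition ext_shape (G : ctx) (k : nat) (psi : tope) : ctx :=
  Ctx (k + cubes G) (psi :: map (tope_subst (pshift k)) (topes G)) (map (cwk k) (types G)).

(* [entails_at G psi ts]: the point ts of the ambient cube satisfies psi. *)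
Definition entails_at (G : ctx) (psi : tope) (ts : list point) : Prop :=
  entails (topes G) (tope_subst (pinst ts) psi).

(* Both judgments presuppose a well-formed context; a rule whose premises
   extend the context checks the type or tope by which it is extended, so every
   context reached from [empty] is well formed. *)
Inductive has_type : ctx -> tm -> tm -> Prop :=
| ty_var G i A :
    nth_error (types G) i = Some A ->
    has_type G (Var i) (wk (S i) A)
| ty_conv G t A B l :
    has_type G t A -> eq_tm G A B (Univ l) ->
    has_type G t B
| ty_univ G l :
    has_type G (Univ l) (Univ (S l))

| ty_pi G A B i j :
    has_type G A (Univ i) -> has_type (ext_type G A) B (Univ j) ->
    has_type G (Pi A B) (Univ (Nat.max i j))
| ty_lam G A B b i :
    has_type G A (Univ i) -> has_type (ext_type G A) b B ->
    has_type G (Lam b) (Pi A B)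
| ty_app G A B f a :
    has_type G f (Pi A B) -> has_type G a A ->
    has_type G (App f a) (inst1 B a)

| ty_sig G A B i j :
    has_type G A (Univ i) -> has_type (ext_type G A) B (Univ j) ->
    has_type G (Sig A B) (Univ (Nat.max i j))
| ty_pair G A B a b i j :
    has_type G A (Univ i) -> has_type (ext_type G A) B (Univ j) ->
    has_type G a A -> has_type G b (inst1 B a) ->
    has_type G (Pair a b) (Sig A B)
| ty_fst G A B p :
    has_type G p (Sig A B) ->
    has_type G (Fst p) A
| ty_snd G A B p :
    has_type G p (Sig A B) ->
    has_type G (Snd p) (inst1 B (Fst p))

| ty_id G A a b i :
    has_type G A (Univ i) -> has_type G a A -> has_type G b A ->
    has_type G (Id A a b) (Univ i)
| ty_refl G A a i :
    has_type G A (Univ i) -> has_type G a A ->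
    has_type G (Refl a) (Id A a a)
| ty_J G A a P d b p i j :
    has_type G A (Univ i) -> has_type G a A ->
    has_type (ext_type (ext_type G A) (Id (wk 1 A) (wk 1 a) (Var 0))) P (Univ j) ->
    has_type G d (inst2 P a (Refl a)) ->
    has_type G b A -> has_type G p (Id A a b) ->
    has_type G (J P d p) (inst2 P b p)

| ty_ext G k psi phi A a i :
    tope_scoped k psi -> tope_scoped k phi -> entails [phi] psi ->
    has_type (ext_shape G k psi) A (Univ i) ->
    has_type (ext_shape G k phi) a A ->
    has_type G (Ext k psi phi A a) (Univ i)
| ty_extlam G k psi phi A a b i :
    has_type G (Ext k psi phi A a) (Univ i) ->
    has_type (ext_shape G k psi) b A ->
    eq_tm (ext_shape G k phi) b a A ->
    has_type G (ExtLam k b) (Ext k psi phi A a)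
| ty_extapp G k psi phi A a f ts :
    has_type G f (Ext k psi phi A a) ->
    length ts = k -> Forall (point_scoped (cubes G)) ts -> entails_at G psi ts ->
    has_type G (ExtApp f ts) (cinst ts A)

| ty_recor G phi psi A a b i :
    tope_scoped (cubes G) phi -> tope_scoped (cubes G) psi ->
    entails (topes G) (TOr phi psi) ->
    has_type G A (Univ i) ->
    has_type (ext_tope G phi) a A -> has_type (ext_tope G psi) b A ->
    eq_tm (ext_tope G (TAnd phi psi)) a b A ->
    has_type G (RecOr phi psi a b) A
| ty_recbot G A i :
    entails (topes G) TBot -> has_type G A (Univ i) ->
    has_type G RecBot A

| ty_funext G A B f g i j :
    has_type G A (Univ i) -> has_type (ext_type G A) B (Univ j) ->
    has_type G f (Pi A B) -> has_type G g (Pi A B) ->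
    has_type G (FunExt f g) (is_equiv (Id (Pi A B) f g) (pointwise A B f g) (happly A B f))
| ty_extext G k psi phi A a f g i :
    has_type G (Ext k psi phi A a) (Univ i) ->
    has_type G f (Ext k psi phi A a) -> has_type G g (Ext k psi phi A a) ->
    has_type G (ExtExt f g)
      (is_equiv (Id (Ext k psi phi A a) f g) (ext_pointwise k psi phi A a f g)
                (ext_happly k psi phi A a f))

with eq_tm : ctx -> tm -> tm -> tm -> Prop :=
| deq_refl G t A :
    has_type G t A -> eq_tm G t t A
| deq_sym G t u A :
    eq_tm G t u A -> eq_tm G u t A
| deq_trans G t u v A :
    eq_tm G t u A -> eq_tm G u v A -> eq_tm G t v A
| deq_conv G t u A B l :
    eq_tm G t u A -> eq_tm G A B (Univ l) -> eq_tm G t u B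

| deq_pi G A A' B B' i j :
    has_type G A (Univ i) ->
    eq_tm G A A' (Univ i) -> eq_tm (ext_type G A) B B' (Univ j) ->
    eq_tm G (Pi A B) (Pi A' B') (Univ (Nat.max i j))
| deq_lam G A B b b' i :
    has_type G A (Univ i) -> eq_tm (ext_type G A) b b' B ->
    eq_tm G (Lam b) (Lam b') (Pi A B)
| deq_app G A B f f' a a' :
    eq_tm G f f' (Pi A B) -> eq_tm G a a' A ->
    eq_tm G (App f a) (App f' a') (inst1 B a)
| deq_pi_beta G A B b a i :
    has_type G A (Univ i) -> has_type (ext_type G A) b B -> has_type G a A ->
    eq_tm G (App (Lam b) a) (inst1 b a) (inst1 B a)
| deq_pi_eta G A B f :
    has_type G f (Pi A B) ->
    eq_tm G f (Lam (App (wk 1 f) (Var 0))) (Pi A B)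

| deq_sig G A A' B B' i j :
    has_type G A (Univ i) ->
    eq_tm G A A' (Univ i) -> eq_tm (ext_type G A) B B' (Univ j) ->
    eq_tm G (Sig A B) (Sig A' B') (Univ (Nat.max i j))
| deq_pair G A B a a' b b' i j :
    has_type G A (Univ i) -> has_type (ext_type G A) B (Univ j) ->
    eq_tm G a a' A -> eq_tm G b b' (inst1 B a) ->
    eq_tm G (Pair a b) (Pair a' b') (Sig A B)
| deq_fst G A B p p' :
    eq_tm G p p' (Sig A B) ->
    eq_tm G (Fst p) (Fst p') A
| deq_snd G A B p p' :
    eq_tm G p p' (Sig A B) ->
    eq_tm G (Snd p) (Snd p') (inst1 B (Fst p))
| deq_fst_beta G A B a b i j :
    has_type G A (Univ i) -> has_type (ext_type G A) B (Univ j) ->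
    has_type G a A -> has_type G b (inst1 B a) ->
    eq_tm G (Fst (Pair a b)) a A
| deq_snd_beta G A B a b i j :
    has_type G A (Univ i) -> has_type (ext_type G A) B (Univ j) ->
    has_type G a A -> has_type G b (inst1 B a) ->
    eq_tm G (Snd (Pair a b)) b (inst1 B a)
| deq_sig_eta G A B p :
    has_type G p (Sig A B) ->
    eq_tm G p (Pair (Fst p) (Snd p)) (Sig A B)

| deq_id G A A' a a' b b' i :
    eq_tm G A A' (Univ i) -> eq_tm G a a' A -> eq_tm G b b' A ->
    eq_tm G (Id A a b) (Id A' a' b') (Univ i)
| deq_reflc G A a a' i :
    has_type G A (Univ i) -> eq_tm G a a' A ->
    eq_tm G (Refl a) (Refl a') (Id A a a)
| deq_J G A a P P' d d' b p p' i j :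
    has_type G A (Univ i) -> has_type G a A ->
    eq_tm (ext_type (ext_type G A) (Id (wk 1 A) (wk 1 a) (Var 0))) P P' (Univ j) ->
    eq_tm G d d' (inst2 P a (Refl a)) ->
    has_type G b A -> eq_tm G p p' (Id A a b) ->
    eq_tm G (J P d p) (J P' d' p') (inst2 P b p)
| deq_J_beta G A a P d i j :
    has_type G A (Univ i) -> has_type G a A ->
    has_type (ext_type (ext_type G A) (Id (wk 1 A) (wk 1 a) (Var 0))) P (Univ j) ->
    has_type G d (inst2 P a (Refl a)) ->
    eq_tm G (J P d (Refl a)) d (inst2 P a (Refl a))

| deq_ext G k psi phi A A' a a' i :
    tope_scoped k psi -> tope_scoped k phi -> entails [phi] psi ->
    eq_tm (ext_shape G k psi) A A' (Univ i) ->
    eq_tm (ext_shape G k phi) a a' A ->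
    eq_tm G (Ext k psi phi A a) (Ext k psi phi A' a') (Univ i)
| deq_extlam G k psi phi A a b b' i :
    has_type G (Ext k psi phi A a) (Univ i) ->
    eq_tm (ext_shape G k psi) b b' A ->
    eq_tm (ext_shape G k phi) b a A ->
    eq_tm G (ExtLam k b) (ExtLam k b') (Ext k psi phi A a)
| deq_extapp G k psi phi A a f f' ts ts' :
    eq_tm G f f' (Ext k psi phi A a) ->
    length ts = k ->
    Forall (point_scoped (cubes G)) ts -> Forall (point_scoped (cubes G)) ts' ->
    Forall2 (fun s t => entails (topes G) (TEq s t)) ts ts' ->
    entails_at G psi ts ->
    eq_tm G (ExtApp f ts) (ExtApp f' ts') (cinst ts A)
| deq_ext_beta G k psi phi A a b ts i :
    has_type G (Ext k psi phi A a) (Univ i) ->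
    has_type (ext_shape G k psi) b A ->
    eq_tm (ext_shape G k phi) b a A ->
    length ts = k -> Forall (point_scoped (cubes G)) ts -> entails_at G psi ts ->
    eq_tm G (ExtApp (ExtLam k b) ts) (cinst ts b) (cinst ts A)
| deq_ext_eta G k psi phi A a f :
    has_type G f (Ext k psi phi A a) ->
    eq_tm G f (ExtLam k (ExtApp (cwk k f) (cvars k))) (Ext k psi phi A a)
| deq_ext_boundary G k psi phi A a f ts :
    has_type G f (Ext k psi phi A a) ->
    length ts = k -> Forall (point_scoped (cubes G)) ts -> entails_at G phi ts ->
    eq_tm G (ExtApp f ts) (cinst ts a) (cinst ts A)

| deq_recor G phi psi A a a' b b' i :
    tope_scoped (cubes G) phi -> tope_scoped (cubes G) psi ->
    entails (topes G) (TOr phi psi) ->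
    has_type G A (Univ i) ->
    eq_tm (ext_tope G phi) a a' A -> eq_tm (ext_tope G psi) b b' A ->
    eq_tm (ext_tope G (TAnd phi psi)) a b A ->
    eq_tm G (RecOr phi psi a b) (RecOr phi psi a' b') A
| deq_recor_l G phi psi A a b :
    has_type G (RecOr phi psi a b) A -> has_type G a A ->
    entails (topes G) phi ->
    eq_tm G (RecOr phi psi a b) a A
| deq_recor_r G phi psi A a b :
    has_type G (RecOr phi psi a b) A -> has_type G b A ->
    entails (topes G) psi ->
    eq_tm G (RecOr phi psi a b) b A
| deq_recor_eta G phi psi A a :
    tope_scoped (cubes G) phi -> tope_scoped (cubes G) psi ->
    entails (topes G) (TOr phi psi) ->
    has_type G a A ->
    eq_tm G a (RecOr phi psi a a) A
| deq_recbot_eta G A a :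
    entails (topes G) TBot -> has_type G a A ->
    eq_tm G a RecBot A

| deq_funext G A B f f' g g' i j :
    has_type G A (Univ i) -> has_type (ext_type G A) B (Univ j) ->
    eq_tm G f f' (Pi A B) -> eq_tm G g g' (Pi A B) ->
    eq_tm G (FunExt f g) (FunExt f' g')
      (is_equiv (Id (Pi A B) f g) (pointwise A B f g) (happly A B f))
| deq_extext G k psi phi A a f f' g g' i :
    has_type G (Ext k psi phi A a) (Univ i) ->
    eq_tm G f f' (Ext k psi phi A a) -> eq_tm G g g' (Ext k psi phi A a) ->
    eq_tm G (ExtExt f g) (ExtExt f' g')
      (is_equiv (Id (Ext k psi phi A a) f g) (ext_pointwise k psi phi A a f g)
                (ext_happly k psi phi A a f)).

(** * Segal types and covariant families *)

Definition iff_type (P Q : tm) : tm := times (arrow P Q) (arrow Q P).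

(* Sigma (x : X), Pi (y : X), x = y. *)
Definition is_contr (X : tm) : tm :=
  Sig X (Pi (wk 1 X) (Id (wk 2 X) (Var 1) (Var 0))).

(* The shapes below are in the coordinate t, resp. (t, s). *)
Definition Delta1 : tope := TTop.
Definition bdDelta1 : tope := TOr (TEq (PVar 0) P0) (TEq (PVar 0) P1).
Definition Delta2 : tope := TLe (PVar 1) (PVar 0).
Definition bdDelta2 : tope :=
  TOr (TEq (PVar 1) P0) (TOr (TEq (PVar 1) (PVar 0)) (TEq (PVar 0) P1)).

(* The partial section [a, b] over the boundary of Delta^1. *)
Definition endpoints (a b : tm) : tm :=
  RecOr (TEq (PVar 0) P0) (TEq (PVar 0) P1) (cwk 1 a) (cwk 1 b).

Definition hom (A a b : tm) : tm :=
  Ext 1 Delta1 bdDelta1 (cwk 1 A) (endpoints a b).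

(* The partial section [f, g; h] over the boundary of Delta^2. *)
Definition triangle_boundary (f g h : tm) : tm :=
  RecOr (TEq (PVar 1) P0) (TOr (TEq (PVar 1) (PVar 0)) (TEq (PVar 0) P1))
    (ExtApp (cwk 2 f) [PVar 0])
    (RecOr (TEq (PVar 1) (PVar 0)) (TEq (PVar 0) P1)
       (ExtApp (cwk 2 h) [PVar 0])
       (ExtApp (cwk 2 g) [PVar 1])).

Definition hom2 (A f g h : tm) : tm :=
  Ext 2 Delta2 bdDelta2 (cwk 2 A) (triangle_boundary f g h).

(* Pi (x y z : A) (f : hom x y) (g : hom y z),
     is_contr (Sigma (h : hom x z), hom2 f g h). *)
Definition is_segal (A : tm) : tm :=
  Pi A (Pi (wk 1 A) (Pi (wk 2 A)
    (Pi (hom (wk 3 A) (Var 2) (Var 1))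
    (Pi (hom (wk 4 A) (Var 2) (Var 1))
      (is_contr
        (Sig (hom (wk 5 A) (Var 4) (Var 2))
             (hom2 (wk 6 A) (Var 2) (Var 1) (Var 0)))))))).

(* <prod_{t : Delta^1} C (f t) | [u, v]>, for a term C : A -> U. *)
Definition dhom (C f u v : tm) : tm :=
  Ext 1 Delta1 bdDelta1 (App (cwk 1 C) (ExtApp (cwk 1 f) [PVar 0])) (endpoints u v).

(* Pi (x y : A) (f : hom x y) (u : C x), is_contr (Sigma (v : C y), dhom C f u v). *)
Definition is_covariant (A C : tm) : tm :=
  Pi A (Pi (wk 1 A)
    (Pi (hom (wk 2 A) (Var 1) (Var 0))
    (Pi (App (wk 3 C) (Var 2))
      (is_contr
        (Sig (App (wk 4 C) (Var 2))
             (dhom (wk 5 C) (Var 2) (Var 1) (Var 0))))))).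

(* hom_A(a, -) : A -> U, x |-> hom_A(a, x). *)
Definition hom_from (A a : tm) : tm := Lam (hom (wk 1 A) (wk 1 a) (Var 0)).

(* Main.v *)
From Stdlib Require Import List Arith Lia.
Import ListNotations.
Require Import Defs.

(* Cutting the square [Delta^1 x Delta^1] along its diagonal, a lift of [u] along [f] in
   [hom_A(a, -)], i.e. a square [(t, s) |-> A] constant at [a] on [s = 0] and equal to [f] on
   [s = 1] and to [u] on [t = 0], is a 2-simplex in [hom2 u f d] glued along the diagonal [d]
   to one in [hom2 id_a v d], where [v] is the side [t = 1].

   Sending [(d, al)] to the square made of [al] and the degenerate simplex on [d] embeds
   [Sigma d, hom2 u f d] as a judgmental retract of the type of lifts, so that covariance
   implies Segal.  Conversely, if [A] is Segal, [Sigma d, hom2 id_a v d] is contractible for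
   each [v]; transporting along the path in it from the degenerate simplex on [v] to the lower
   half of a given square shows that every lift is in the image of [Sigma d, hom2 u f d]. *)


(** * Renaming and substitution *)

(** An upper half fits only a lower half with the same diagonal, while a path between lower halves
    moves the diagonal. This forces the form of the transported statement: it quantifies over all
    upper halves [al] that fit the current diagonal ([lift_motive]). Over the degenerate lower half,
    the square on [al] is [to_lift] of a composite, and the claim is the image under [to_lift] of a
    contraction path; at the far end the resulting function is applied to the upper half of the
    given square.

    Since the retraction law and the gluing of the two halves of a square hold judgmentally,
    transport is the only operation on paths that occurs.

    On the syntactic side, judgments are shown stable under renaming only: points for cube variables
    and variables for term variables. Each construction is therefore typed directly in the context
    where it lives, and the instances under [inst1] of the types involved are computed by syntactic
    equations such as [inst1_comp_fiber]. The family [hom_from A a] is handled in beta-reduced form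
    throughout and restored by one conversion at the very end. *)

Lemma point_subst_ext rho rho' p :
  (forall i, rho i = rho' i) -> point_subst rho p = point_subst rho' p.
Proof. intros H; destruct p; cbn; auto. Qed.

Lemma point_subst_comp rho rho' p :
  point_subst rho (point_subst rho' p) = point_subst (fun i => point_subst rho (rho' i)) p.
Proof. destruct p; reflexivity. Qed.

Lemma point_subst_id rho p : (forall i, rho i = PVar i) -> point_subst rho p = p.
Proof. intros H; destruct p; cbn; auto. Qed.

Lemma tope_subst_ext rho rho' phi :
  (forall i, rho i = rho' i) -> tope_subst rho phi = tope_subst rho' phi.
Proof.
  intros H; induction phi; cbn; f_equal; auto using point_subst_ext.
Qed.

Lemma tope_subst_comp rho rho' phi :
  tope_subst rho (tope_subst rho' phi) = tope_subst (fun i => point_subst rho (rho' i)) phi.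
Proof.
  induction phi; cbn; f_equal; auto using point_subst_comp.
Qed.

Lemma tope_subst_id rho phi : (forall i, rho i = PVar i) -> tope_subst rho phi = phi.
Proof. intros H; induction phi; cbn; f_equal; auto using point_subst_id. Qed.

Lemma point_subst_scoped_ext n rho rho' p :
  point_scoped n p -> (forall i, i < n -> rho i = rho' i) ->
  point_subst rho p = point_subst rho' p.
Proof. intros Hp H; destruct p; cbn in *; auto. Qed.

Lemma tope_subst_scoped_ext n rho rho' phi :
  tope_scoped n phi -> (forall i, i < n -> rho i = rho' i) ->
  tope_subst rho phi = tope_subst rho' phi.
Proof.
  intros Hp H; induction phi; cbn in *; f_equal; intuition eauto using point_subst_scoped_ext.
Qed.

Lemma point_scoped_subst n m rho p :
  point_scoped n p -> (forall i, i < n -> point_scoped m (rho i)) ->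
  point_scoped m (point_subst rho p).
Proof. destruct p; cbn; auto. Qed.

Lemma tope_scoped_subst n m rho phi :
  tope_scoped n phi -> (forall i, i < n -> point_scoped m (rho i)) ->
  tope_scoped m (tope_subst rho phi).
Proof.
  intros Hp H; induction phi; cbn in *; intuition eauto using point_scoped_subst.
Qed.

Lemma pup_lt k rho i : i < k -> pup k rho i = PVar i.
Proof. intros H; unfold pup; apply Nat.ltb_lt in H as ->; reflexivity. Qed.

Lemma pup_add k rho i : pup k rho (k + i) = point_subst (pshift k) (rho i).
Proof.
  unfold pup; destruct (Nat.ltb_spec (k + i) k); [lia|].
  now replace (k + i - k) with i by lia.
Qed.

Lemma pinst_lt ts i d : i < length ts -> pinst ts i = nth i ts d.
Proof. intros H; apply nth_indep, H. Qed.

Lemma pinst_add ts k i : length ts = k -> pinst ts (k + i) = PVar i.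
Proof.
  intros <-; unfold pinst; rewrite nth_overflow by lia; f_equal; lia.
Qed.

(** The case analysis behind all facts on [pup] and [pinst]: a cube variable is either one of the
    [k] bound coordinates or a shifted outer variable. *)
Lemma pup_cases k (P : nat -> Prop) :
  (forall i, i < k -> P i) -> (forall i, P (k + i)) -> forall i, P i.
Proof.
  intros H1 H2 i; destruct (Nat.lt_ge_cases i k) as [H | H]; auto.
  replace i with (k + (i - k)) by lia; auto.
Qed.

Lemma pup_ext k rho rho' i : (forall j, rho j = rho' j) -> pup k rho i = pup k rho' i.
Proof. intros H; unfold pup; now rewrite H. Qed.

Lemma pup_id k rho i : (forall j, rho j = PVar j) -> pup k rho i = PVar i.
Proof.
  intros H; revert i; apply (pup_cases k); intros i.
  - apply pup_lt.
  - rewrite pup_add, H; reflexivity.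
Qed.

Lemma pup_comp k rho rho' i :
  point_subst (pup k rho) (pup k rho' i) = pup k (fun j => point_subst rho (rho' j)) i.
Proof.
  revert i; apply (pup_cases k); intros i.
  - intros H; now rewrite !pup_lt; cbn; rewrite ?pup_lt.
  - rewrite !pup_add, !point_subst_comp; apply point_subst_ext; intros; cbn; apply pup_add.
Qed.

Lemma rup_ext xi xi' i : (forall j, xi j = xi' j) -> rup xi i = rup xi' i.
Proof. intros H; destruct i; cbn; auto. Qed.

Lemma rup_comp xi xi' i : rup xi (rup xi' i) = rup (fun j => xi (xi' j)) i.
Proof. destruct i; reflexivity. Qed.

Lemma rup_id xi i : (forall j, xi j = j) -> rup xi i = i.
Proof. intros H; destruct i; cbn; auto. Qed.

Lemma ren_ext t : forall rho rho' xi xi',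
  (forall i, rho i = rho' i) -> (forall i, xi i = xi' i) -> ren rho xi t = ren rho' xi' t.
Proof.
  induction t; intros rho rho' xi xi' Hr Hx; cbn; f_equal;
    auto using rup_ext, pup_ext, tope_subst_ext.
  apply map_ext; auto using point_subst_ext.
Qed.

Lemma ren_ren t : forall rho rho' xi xi',
  ren rho xi (ren rho' xi' t) =
  ren (fun i => point_subst rho (rho' i)) (fun i => xi (xi' i)) t.
Proof.
  induction t; intros rho rho' xi xi'; cbn; f_equal; auto using tope_subst_comp.
  all: try (rewrite map_map; apply map_ext; auto using point_subst_comp; fail).
  all: first [rewrite IHt | rewrite IHt1 | rewrite IHt2];
       apply ren_ext; auto using rup_comp, pup_comp.
  intros; rewrite !rup_comp; apply rup_ext, rup_comp.
Qed.

Lemma ren_id t : forall rho xi,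
  (forall i, rho i = PVar i) -> (forall i, xi i = i) -> ren rho xi t = t.
Proof.
  induction t; intros rho xi Hr Hx; cbn; f_equal;
    auto 7 using rup_id, pup_id, tope_subst_id.
  rewrite <- map_id; apply map_ext; auto using point_subst_id.
Qed.

Lemma sup_id sigma i : (forall j, sigma j = Var j) -> sup sigma i = Var i.
Proof. intros H; destruct i; cbn; now rewrite ?H. Qed.

Lemma csup_id k sigma i : (forall j, sigma j = Var j) -> csup k sigma i = Var i.
Proof. intros H; unfold csup; now rewrite H. Qed.

Lemma subst_id t : forall sigma, (forall i, sigma i = Var i) -> subst sigma t = t.
Proof.
  induction t; intros sigma H; cbn; f_equal; auto 7 using sup_id, csup_id.
Qed.

(** [xi'] acts on the domain of the substitution and [xi] on its codomain. They differ because an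
    instantiation removes a variable; with both free, the one statement covers [inst1], [inst2],
    [wk] and [cwk]. *)
Lemma ren_subst t : forall rho xi xi' sigma tau,
  (forall i, ren rho xi (sigma i) = tau (xi' i)) ->
  ren rho xi (subst sigma t) = subst tau (ren rho xi' t).
Proof.
  assert (Hsup : forall rho xi xi' sigma tau,
    (forall i, ren rho xi (sigma i) = tau (xi' i)) ->
    forall i, ren rho (rup xi) (sup sigma i) = sup tau (rup xi' i)).
  { intros rho xi xi' sigma tau H [|i]; cbn; auto.
    rewrite <- H; unfold wk; rewrite !ren_ren; apply ren_ext; auto.
    intros; cbn; now rewrite point_subst_id. }
  assert (Hcsup : forall k rho xi xi' sigma tau,
    (forall i, ren rho xi (sigma i) = tau (xi' i)) ->
    forall i, ren (pup k rho) xi (csup k sigma i) = csup k tau (xi' i)).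
  { intros k rho xi xi' sigma tau H i; unfold csup, cwk.
    rewrite <- H, !ren_ren; apply ren_ext; auto.
    intros; cbn; apply pup_add. }
  induction t; intros rho xi xi' sigma tau H; cbn; f_equal; eauto 7.
Qed.

Lemma subst_ren t rho xi sigma tau :
  (forall i, ren rho (fun j => j) (sigma i) = tau (xi i)) ->
  subst tau (ren rho xi t) = ren rho (fun j => j) (subst sigma t).
Proof. intros H; symmetry; now apply ren_subst. Qed.

Lemma subst_ren_cancel t xi sigma :
  (forall i, sigma (xi i) = Var i) -> subst sigma (ren PVar xi t) = t.
Proof.
  intros H; rewrite (subst_ren t PVar xi Var); auto.
  rewrite subst_id, ren_id; auto.
Qed.

Lemma ren_inst1 rho xi B a :
  ren rho xi (inst1 B a) = inst1 (ren rho (rup xi) B) (ren rho xi a).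
Proof. unfold inst1; apply ren_subst; intros [|i]; reflexivity. Qed.

Lemma ren_inst2 rho xi P b p :
  ren rho xi (inst2 P b p) = inst2 (ren rho (rup (rup xi)) P) (ren rho xi b) (ren rho xi p).
Proof. unfold inst2; apply ren_subst; intros [|[|i]]; reflexivity. Qed.

Lemma point_subst_pinst rho ts k i :
  length ts = k ->
  point_subst rho (pinst ts i) = point_subst (pinst (map (point_subst rho) ts)) (pup k rho i).
Proof.
  intros <-; revert i; apply (pup_cases (length ts)); intros i.
  - intros H; rewrite pup_lt by auto; cbn.
    rewrite (pinst_lt ts i P0) by auto.
    rewrite (pinst_lt _ i (point_subst rho P0)) by now rewrite length_map.
    now rewrite map_nth.
  - rewrite pup_add, pinst_add by auto; cbn.
    rewrite point_subst_comp; symmetry; apply point_subst_id.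
    intros; cbn; apply pinst_add, length_map.
Qed.

Lemma ren_cinst rho xi ts k A :
  length ts = k ->
  ren rho xi (cinst ts A) = cinst (map (point_subst rho) ts) (ren (pup k rho) xi A).
Proof.
  intros H; unfold cinst; rewrite !ren_ren; apply ren_ext; auto.
  intros; now apply point_subst_pinst.
Qed.

(* Scoping matters: [pinst ts] also moves the variables beyond [length ts]. *)
Lemma tope_subst_pinst rho ts phi :
  tope_scoped (length ts) phi ->
  tope_subst rho (tope_subst (pinst ts) phi) = tope_subst (pinst (map (point_subst rho) ts)) phi.
Proof.
  intros H; rewrite tope_subst_comp; apply (tope_subst_scoped_ext _ _ _ _ H).
  intros i Hi; rewrite (point_subst_pinst rho ts _ i eq_refl), pup_lt by auto; reflexivity.
Qed.

Lemma ren_wk1 rho xi t : ren rho (rup xi) (wk 1 t) = wk 1 (ren rho xi t).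
Proof.
  unfold wk; rewrite !ren_ren; apply ren_ext; auto.
  intros; symmetry; now apply point_subst_id.
Qed.

Lemma ren_cwk k rho xi t : ren (pup k rho) xi (cwk k t) = cwk k (ren rho xi t).
Proof. unfold cwk; rewrite !ren_ren; apply ren_ext; auto; intros; cbn; apply pup_add. Qed.

Lemma wk_S m t : wk (S m) t = wk 1 (wk m t).
Proof. unfold wk; rewrite ren_ren; now apply ren_ext. Qed.

Lemma ren_cvars k rho : map (point_subst (pup k rho)) (cvars k) = cvars k.
Proof.
  unfold cvars; rewrite map_map; apply map_ext_in.
  intros i Hi; apply in_seq in Hi; cbn; apply pup_lt; lia.
Qed.

Lemma nth_cvars k i d : i < k -> nth i (cvars k) d = PVar i.
Proof.
  intros H; unfold cvars; rewrite (nth_indep _ d (PVar 0)) by now rewrite length_map, length_seq.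
  rewrite map_nth, seq_nth; auto.
Qed.

Lemma length_cvars k : length (cvars k) = k.
Proof. unfold cvars; now rewrite length_map, length_seq. Qed.

Lemma ren_is_equiv rho xi X Y f :
  ren rho xi (is_equiv X Y f) = is_equiv (ren rho xi X) (ren rho xi Y) (ren rho xi f).
Proof.
  unfold is_equiv, times, arrow; cbn -[wk].
  now rewrite !(wk_S 1), ?ren_wk1; cbn -[wk]; rewrite ?ren_wk1.
Qed.

Lemma ren_pointwise rho xi A B f g :
  ren rho xi (pointwise A B f g) =
  pointwise (ren rho xi A) (ren rho (rup xi) B) (ren rho xi f) (ren rho xi g).
Proof. unfold pointwise; cbn -[wk]; now rewrite !ren_wk1. Qed.

Lemma ren_happly rho xi A B f :
  ren rho xi (happly A B f) = happly (ren rho xi A) (ren rho (rup xi) B) (ren rho xi f).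
Proof.
  unfold happly; cbn -[wk wk_under].
  rewrite !(wk_S 3), !(wk_S 2), !(wk_S 1), !ren_wk1; repeat f_equal.
  unfold wk_under; rewrite !ren_ren; apply ren_ext.
  - intros; symmetry; now apply point_subst_id.
  - intros [|i]; reflexivity.
Qed.

Lemma ren_ext_pointwise rho xi k psi phi A a f g :
  ren rho xi (ext_pointwise k psi phi A a f g) =
  ext_pointwise k psi phi (ren (pup k rho) xi A) (ren (pup k rho) xi a)
    (ren rho xi f) (ren rho xi g).
Proof. unfold ext_pointwise; cbn; now rewrite !ren_cwk, !ren_cvars. Qed.

Lemma ren_ext_happly rho xi k psi phi A a f :
  ren rho xi (ext_happly k psi phi A a f) =
  ext_happly k psi phi (ren (pup k rho) xi A) (ren (pup k rho) xi a) (ren rho xi f).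
Proof.
  unfold ext_happly; cbn -[wk ext_pointwise].
  rewrite ren_ext_pointwise, !(wk_S 2), !(wk_S 1), !ren_wk1, ren_cwk, ren_cvars, ren_wk1.
  reflexivity.
Qed.

(** * Weakening and substitution for tope entailment *)

Lemma entails_incl Phi Psi phi : entails Phi phi -> incl Phi Psi -> entails Psi phi.
Proof.
  intros H; revert Psi; induction H; intros Psi HI.
  - apply ent_hyp; auto.
  - apply ent_top.
  - apply ent_bot; auto.
  - apply ent_and; auto.
  - eapply ent_and_l; eauto.
  - eapply ent_and_r; eauto.
  - apply ent_or_l; auto.
  - apply ent_or_r; auto.
  - apply (ent_or_elim _ phi psi); auto.
    + apply IHentails2, incl_cons; auto using in_eq, incl_tl.
    + apply IHentails3, incl_cons; auto using in_eq, incl_tl.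
  - apply ent_eq_refl.
  - eapply ent_eq_subst; eauto.
  - apply ent_le_refl.
  - eapply ent_le_trans; eauto.
  - apply ent_le_antisym; auto.
  - apply ent_le_total.
  - apply ent_le_0.
  - apply ent_le_1.
  - apply ent_01; auto.
Qed.

Lemma tope_subst_pinst1 rho s phi :
  tope_subst rho (tope_subst (pinst [s]) phi) =
  tope_subst (pinst [point_subst rho s]) (tope_subst (pup 1 rho) phi).
Proof.
  rewrite !tope_subst_comp; apply tope_subst_ext; intros.
  now apply (point_subst_pinst rho [s]).
Qed.

(** The images of the hypotheses have to be entailed by [Psi], not to be members of it, so that cut
    is included. This is what later allows restriction to any smaller shape. *)
Lemma entails_subst rho Phi phi :
  entails Phi phi -> forall Psi,
  (forall chi, In chi Phi -> entails Psi (tope_subst rho chi)) ->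
  entails Psi (tope_subst rho phi).
Proof.
  assert (Hlift : forall phi Phi Psi,
    (forall chi, In chi Phi -> entails Psi (tope_subst rho chi)) ->
    forall chi, In chi (phi :: Phi) ->
    entails (tope_subst rho phi :: Psi) (tope_subst rho chi)).
  { intros psi Phi' Psi H chi [<- | Hc]; [apply ent_hyp, in_eq|].
    eapply entails_incl; [apply H, Hc | apply incl_tl, incl_refl]. }
  induction 1; intros Psi HI.
  - auto.
  - apply ent_top.
  - exact (ent_bot _ _ (IHentails Psi HI)).
  - apply ent_and; auto.
  - exact (ent_and_l _ _ _ (IHentails Psi HI)).
  - exact (ent_and_r _ _ _ (IHentails Psi HI)).
  - apply ent_or_l; auto.
  - apply ent_or_r; auto.
  - apply (ent_or_elim _ (tope_subst rho phi) (tope_subst rho psi)).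
    + apply (IHentails1 Psi HI).
    + apply IHentails2, Hlift, HI.
    + apply IHentails3, Hlift, HI.
  - apply ent_eq_refl.
  - rewrite tope_subst_pinst1; eapply ent_eq_subst; [apply (IHentails1 Psi HI)|].
    rewrite <- tope_subst_pinst1; auto.
  - apply ent_le_refl.
  - eapply ent_le_trans; [apply (IHentails1 Psi HI) | apply (IHentails2 Psi HI)].
  - apply ent_le_antisym; [apply (IHentails1 Psi HI) | apply (IHentails2 Psi HI)].
  - apply ent_le_total.
  - apply ent_le_0.
  - apply ent_le_1.
  - exact (ent_01 _ (IHentails Psi HI)).
Qed.

(* The elimination rules for [Ext] do not record that its shapes are scoped, and substitution
   in shapes commutes with instantiation only when they are ([tope_subst_pinst]). *)
Fixpoint shapes_scoped (t : tm) : Prop :=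
  match t with
  | Var _ | Univ _ | RecBot => True
  | Pi A B | Sig A B => shapes_scoped A /\ shapes_scoped B
  | Lam b | Fst b | Snd b | Refl b | ExtLam _ b | ExtApp b _ => shapes_scoped b
  | App a b | Pair a b | RecOr _ _ a b | FunExt a b | ExtExt a b =>
      shapes_scoped a /\ shapes_scoped b
  | Id a b c | J a b c => shapes_scoped a /\ shapes_scoped b /\ shapes_scoped c
  | Ext k psi phi A a =>
      tope_scoped k psi /\ tope_scoped k phi /\ shapes_scoped A /\ shapes_scoped a
  end.

Lemma shapes_scoped_ren t : forall rho xi, shapes_scoped t -> shapes_scoped (ren rho xi t).
Proof. induction t; cbn; intuition. Qed.

Lemma shapes_scoped_subst t : forall sigma,
  (forall i, shapes_scoped (sigma i)) -> shapes_scoped t -> shapes_scoped (subst sigma t).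
Proof.
  assert (Hs : forall sigma, (forall i, shapes_scoped (sigma i)) ->
                 forall i, shapes_scoped (sup sigma i))
    by (intros sigma H [|i]; cbn; auto; apply shapes_scoped_ren, H).
  assert (Hc : forall k sigma, (forall i, shapes_scoped (sigma i)) ->
                 forall i, shapes_scoped (csup k sigma i))
    by (intros; apply shapes_scoped_ren; auto).
  induction t; cbn; intuition.
Qed.

Lemma shapes_scoped_inst1 B a :
  shapes_scoped B -> shapes_scoped a -> shapes_scoped (inst1 B a).
Proof. intros; apply shapes_scoped_subst; auto; intros [|i]; cbn; auto. Qed.

Lemma shapes_scoped_inst2 P b p :
  shapes_scoped P -> shapes_scoped b -> shapes_scoped p -> shapes_scoped (inst2 P b p).
Proof. intros; apply shapes_scoped_subst; auto; intros [|[|i]]; cbn; auto. Qed.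

Scheme has_type_mind := Minimality for has_type Sort Prop
  with eq_tm_mind := Minimality for eq_tm Sort Prop.
Combined Scheme judgment_mind from has_type_mind, eq_tm_mind.

Lemma Forall_map_ren rho xi L :
  Forall shapes_scoped L -> Forall shapes_scoped (map (ren rho xi) L).
Proof. induction 1; cbn; auto using shapes_scoped_ren. Qed.

(** The rules that form [Ext] check the scoping of its shapes, and the eliminators inherit it from
    the type of the term they eliminate; the hypothesis on the context serves the variable rule. *)
Lemma judgment_shapes_scoped :
  (forall G t A, has_type G t A ->
     Forall shapes_scoped (types G) -> shapes_scoped t /\ shapes_scoped A) /\
  (forall G t u A, eq_tm G t u A ->
     Forall shapes_scoped (types G) ->
     shapes_scoped t /\ shapes_scoped u /\ shapes_scoped A).
Proof.
  assert (Hn : forall L i A, nth_error L i = Some A ->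
                Forall shapes_scoped L -> shapes_scoped A)
    by (intros L i A H HF; eapply Forall_forall; eauto using nth_error_In).
  apply judgment_mind; cbn [types ext_type ext_tope ext_shape]; intros.
  (* Forward saturation: each induction hypothesis receives its hypothesis on the context, and what
     it yields is taken apart. *)
  all: repeat match goal with
    | H : Forall shapes_scoped ?L -> _, H' : Forall shapes_scoped ?L |- _ =>
        specialize (H H')
    | H : Forall shapes_scoped (map _ _) -> _ |- _ =>
        specialize (H (Forall_map_ren _ _ _ ltac:(eassumption)))
    | H : _ /\ _ |- _ => destruct H
    | H : Forall shapes_scoped (_ :: _) -> _ |- _ =>
        specialize (H ltac:(repeat constructor; try apply shapes_scoped_ren; assumption))
    | H : shapes_scoped ?t |- _ =>
        match t with
        | Pi _ _ => cbn in H | Sig _ _ => cbn in H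
        | Id _ _ _ => cbn in H | Ext _ _ _ _ _ => cbn in H | RecOr _ _ _ _ => cbn in H end
    end.
  all: repeat split; cbn;
    eauto 8 using shapes_scoped_inst1, shapes_scoped_inst2, shapes_scoped_ren.
  all: repeat split; eauto 8 using shapes_scoped_inst1, shapes_scoped_inst2, shapes_scoped_ren.
Qed.

(** * Stability of the judgments under renaming *)

(** An entry of a context is a type over the tail behind it, and [xi] need not restrict to tails.
    Types are therefore compared after weakening to the whole context. *)
Record is_ren (rho : nat -> point) (xi : nat -> nat) (G D : ctx) : Prop := {
  ren_points : forall i, i < cubes G -> point_scoped (cubes D) (rho i);
  ren_topes : forall phi, In phi (topes G) -> entails (topes D) (tope_subst rho phi);
  ren_types : forall i A, nth_error (types G) i = Some A ->
    exists A', nth_error (types D) (xi i) = Some A' /\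
               wk (S (xi i)) A' = ren rho xi (wk (S i) A) }.

Lemma is_ren_ext_type rho xi G D A :
  is_ren rho xi G D -> is_ren rho (rup xi) (ext_type G A) (ext_type D (ren rho xi A)).
Proof.
  intros [Hp Ht Hv]; split; auto.
  intros [|i] B HB; cbn in HB.
  - injection HB as <-; exists (ren rho xi A); split; auto.
    symmetry; apply ren_wk1.
  - destruct (Hv i B HB) as (B' & HB' & E); exists B'; split; auto.
    change (rup xi (S i)) with (S (xi i)).
    now rewrite (wk_S (S _)), E, (wk_S (S i)), ren_wk1.
Qed.

Lemma is_ren_ext_tope rho xi G D phi :
  is_ren rho xi G D -> is_ren rho xi (ext_tope G phi) (ext_tope D (tope_subst rho phi)).
Proof.
  intros [Hp Ht Hv]; split; auto.
  intros psi [<- | H]; [apply ent_hyp, in_eq|].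
  eapply entails_incl; [apply Ht, H | apply incl_tl, incl_refl].
Qed.

Lemma is_ren_ext_shape rho xi G D k psi :
  tope_scoped k psi ->
  is_ren rho xi G D -> is_ren (pup k rho) xi (ext_shape G k psi) (ext_shape D k psi).
Proof.
  intros Hs [Hp Ht Hv]; split; cbn.
  - apply (pup_cases k (fun i => i < k + cubes G ->
      point_scoped (k + cubes D) (pup k rho i))); intros i.
    + intros Hi _; rewrite pup_lt; cbn; lia.
    + intros Hi; rewrite pup_add; apply (point_scoped_subst (cubes D)); cbn; intros;
        try apply Hp; lia.
  - intros phi [<- | H].
    + rewrite (tope_subst_scoped_ext k _ PVar) by auto using pup_lt.
      rewrite tope_subst_id by auto; apply ent_hyp, in_eq.
    + apply in_map_iff in H as (chi & <- & H).
      rewrite tope_subst_comp.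
      rewrite (tope_subst_ext _ (fun i => point_subst (pshift k) (rho i)))
        by (intros; cbn; apply pup_add).
      rewrite <- tope_subst_comp.
      apply (entails_subst _ (topes D)); auto.
      intros; apply ent_hyp; right; now apply in_map.
  - intros i A H; rewrite nth_error_map in H.
    destruct (nth_error (types G) i) as [B|] eqn:E; [|discriminate].
    injection H as <-.
    destruct (Hv i B E) as (B' & HB' & EB); exists (cwk k B'); split.
    + now rewrite nth_error_map, HB'.
    + transitivity (cwk k (wk (S (xi i)) B')).
      * unfold wk, cwk; rewrite !ren_ren; now apply ren_ext.
      * rewrite EB, <- ren_cwk; f_equal.
        unfold wk, cwk; rewrite !ren_ren; now apply ren_ext.
Qed.

Lemma is_ren_point rho xi G D p :
  is_ren rho xi G D -> point_scoped (cubes G) p -> point_scoped (cubes D) (point_subst rho p).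
Proof. intros H Hp; eapply point_scoped_subst; eauto; apply H. Qed.

Lemma is_ren_points rho xi G D ts :
  is_ren rho xi G D -> Forall (point_scoped (cubes G)) ts ->
  Forall (point_scoped (cubes D)) (map (point_subst rho) ts).
Proof. intros H; induction 1; cbn; eauto using is_ren_point. Qed.

Lemma is_ren_tope rho xi G D phi :
  is_ren rho xi G D -> tope_scoped (cubes G) phi -> tope_scoped (cubes D) (tope_subst rho phi).
Proof. intros H Hp; eapply tope_scoped_subst; eauto; apply H. Qed.

Lemma is_ren_entails rho xi G D phi :
  is_ren rho xi G D -> entails (topes G) phi -> entails (topes D) (tope_subst rho phi).
Proof. intros H Hp; eapply entails_subst; eauto; apply H. Qed.

Lemma is_ren_entails_at rho xi G D k phi ts :
  is_ren rho xi G D -> length ts = k -> tope_scoped k phi ->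
  entails_at G phi ts -> entails_at D phi (map (point_subst rho) ts).
Proof.
  intros H <- Hs He; unfold entails_at; rewrite <- tope_subst_pinst by auto.
  eapply is_ren_entails; eauto.
Qed.

Lemma is_ren_points_eq rho xi G D ts ts' :
  is_ren rho xi G D ->
  Forall2 (fun s t => entails (topes G) (TEq s t)) ts ts' ->
  Forall2 (fun s t => entails (topes D) (TEq s t))
    (map (point_subst rho) ts) (map (point_subst rho) ts').
Proof.
  intros H; induction 1; cbn; constructor; auto.
  now apply (is_ren_entails rho xi G D (TEq x y)).
Qed.

(** Proved by induction on the derivation with [T] arbitrary, in order to pass through [ty_conv]. *)
Lemma has_type_Ext_scoped G k psi phi A a T :
  has_type G (Ext k psi phi A a) T -> tope_scoped k psi /\ tope_scoped k phi.
Proof.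
  intros H; remember (Ext k psi phi A a) as t; induction H; try discriminate; auto.
  injection Heqt as -> -> -> -> ->; auto.
Qed.

(* The hypothesis on [types G] replaces the presupposition that G is well formed. *)
Theorem judgment_ren :
  (forall G t A, has_type G t A -> Forall shapes_scoped (types G) ->
     forall D rho xi, is_ren rho xi G D -> has_type D (ren rho xi t) (ren rho xi A)) /\
  (forall G t u A, eq_tm G t u A -> Forall shapes_scoped (types G) ->
     forall D rho xi, is_ren rho xi G D -> eq_tm D (ren rho xi t) (ren rho xi u) (ren rho xi A)).
Proof.
  pose proof judgment_shapes_scoped as [Hs1 Hs2].
  assert (Hmap : forall k L, Forall shapes_scoped L -> Forall shapes_scoped (map (cwk k) L))
    by (intros; apply Forall_map_ren; auto).
  assert (Hcons : forall L A, Forall shapes_scoped L -> shapes_scoped A ->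
            Forall shapes_scoped (A :: L)) by auto.
  assert (HJ : forall L A a, Forall shapes_scoped L -> shapes_scoped A -> shapes_scoped a ->
            Forall shapes_scoped (Id (wk 1 A) (wk 1 a) (Var 0) :: A :: L))
    by (intros; repeat constructor; try apply shapes_scoped_ren; auto).
  apply judgment_mind; intros; cbn [ren];
    rewrite ?ren_inst1, ?ren_inst2, ?ren_is_equiv, ?ren_pointwise, ?ren_happly,
      ?ren_ext_pointwise, ?ren_ext_happly.
  (* Recovers the scoping of every shape in the premises, which [is_ren_ext_shape] and
     [is_ren_entails_at] ask for. *)
  all: repeat match goal with
    | H : has_type ?G (Ext ?k ?psi ?phi ?A ?a) (Univ _) |- _ =>
        lazymatch goal with
        | _ : tope_scoped k psi |- _ => fail
        | _ => destruct (has_type_Ext_scoped _ _ _ _ _ _ _ H) end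
    | Hg : Forall shapes_scoped (types ?G), H : has_type ?G ?t ?T |- _ =>
        lazymatch goal with
        | _ : shapes_scoped t, _ : shapes_scoped T |- _ => fail
        | _ => destruct (Hs1 _ _ _ H Hg) end
    | Hg : Forall shapes_scoped (types ?G), H : eq_tm ?G ?t ?u ?T |- _ =>
        lazymatch goal with
        | _ : shapes_scoped t, _ : shapes_scoped u, _ : shapes_scoped T |- _ => fail
        | _ => destruct (Hs2 _ _ _ _ H Hg) as (? & ? & ?) end
    end.
  all: repeat match goal with
    | H : shapes_scoped (Ext _ _ _ _ _) |- _ => destruct H as (? & ? & ? & ?)
    end.
  all: repeat match goal with
    | H : Forall _ (types (ext_type (ext_type ?G ?A) (Id _ (wk 1 ?a) _))) -> _ |- _ =>
        specialize (H (HJ (types G) A a ltac:(assumption) ltac:(assumption) ltac:(assumption)))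
    | H : Forall _ (types (ext_type ?G ?A)) -> _ |- _ =>
        specialize (H (Hcons (types G) A ltac:(assumption) ltac:(assumption)))
    | H : Forall _ (types (ext_tope ?G _)) -> _ |- _ => specialize (H ltac:(assumption))
    | H : Forall _ (types (ext_shape ?G ?k _)) -> _ |- _ =>
        specialize (H (Hmap k _ ltac:(eassumption)))
    | H : Forall _ (types _) -> _ |- _ => specialize (H ltac:(eassumption))
    end.
  (* Each induction hypothesis is taken at the target context with the corresponding extension,
     under the lifted renaming. *)
  all: repeat match goal with
    | HR : is_ren ?rho ?xi ?G ?D, IH : forall D rho xi, is_ren rho xi ?G D -> _ |- _ =>
        specialize (IH D rho xi HR)
    | HR : is_ren ?rho ?xi ?G ?D,
      IH : forall D rho xi, is_ren rho xi (ext_type (ext_type ?G ?A) ?B) D -> _ |- _ =>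
        specialize (IH _ _ _ (is_ren_ext_type _ _ _ _ B (is_ren_ext_type _ _ _ _ A HR)))
    | HR : is_ren ?rho ?xi ?G ?D,
      IH : forall D rho xi, is_ren rho xi (ext_type ?G ?A) D -> _ |- _ =>
        specialize (IH _ _ _ (is_ren_ext_type _ _ _ _ A HR))
    | HR : is_ren ?rho ?xi ?G ?D,
      IH : forall D rho xi, is_ren rho xi (ext_tope ?G ?A) D -> _ |- _ =>
        specialize (IH _ _ _ (is_ren_ext_tope _ _ _ _ A HR))
    | HR : is_ren ?rho ?xi ?G ?D,
      IH : forall D rho xi, is_ren rho xi (ext_shape ?G ?k ?psi) D -> _ |- _ =>
        specialize (IH _ _ _ (is_ren_ext_shape _ _ _ _ k psi ltac:(assumption) HR))
    end; cbn [ren rup tope_subst] in *.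
  all: rewrite ?ren_inst1, ?ren_inst2, ?ren_wk1 in *; cbn [ren rup] in *.
  1: { destruct (ren_types _ _ _ _ H1 _ _ H) as (A' & HA & <-); now constructor. }
  all: try match goal with
    | H : length ?ts = ?k |- context [ren _ _ (cinst ?ts _)] =>
        rewrite !(ren_cinst _ _ ts k) by assumption
    end.
  all: rewrite ?ren_cwk, ?ren_cvars.
  all: try (econstructor;
    first [eassumption | eapply is_ren_tope; eassumption
          | match goal with
            | HR : is_ren _ _ ?G _, He : entails (topes ?G) ?phi |- _ =>
                exact (is_ren_entails _ _ _ _ phi HR He)
            end
          | eapply is_ren_points; eassumption | eapply is_ren_points_eq; eassumption
          | eapply is_ren_entails_at; eassumption
          | rewrite length_map; assumption ]).
  (* The conclusions of [ty_J] and [deq_J] mention neither the type nor the left endpoint of the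
     path, so these are supplied. *)
  - eapply (ty_J _ (ren rho xi A) (ren rho xi a)); eassumption.
  - eapply (deq_J _ (ren rho xi A) (ren rho xi a)); eassumption.
Qed.

(** Not full well-formedness, but the part of it on which [judgment_ren] depends. *)
Definition wf (G : ctx) : Prop := Forall shapes_scoped (types G).

Lemma wf_ext_shape G k psi : wf G -> wf (ext_shape G k psi).
Proof. apply Forall_map_ren. Qed.

Lemma wf_ext_type G A i : wf G -> has_type G A (Univ i) -> wf (ext_type G A).
Proof. intros H HA; constructor; [apply (proj1 judgment_shapes_scoped _ _ _ HA H) | exact H]. Qed.

Lemma is_ren_wk G B : is_ren PVar (Nat.add 1) G (ext_type G B).
Proof.
  split; cbn; auto.
  - intros; rewrite tope_subst_id by auto; now apply ent_hyp.
  - intros i A H; exists A; split; auto; apply wk_S.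
Qed.

Lemma is_ren_cwk G k psi : is_ren (pshift k) (fun i => i) G (ext_shape G k psi).
Proof.
  split; cbn.
  - intros; lia.
  - intros; apply ent_hyp; right; now apply in_map.
  - intros i A H; exists (cwk k A); split.
    + now rewrite nth_error_map, H.
    + unfold wk, cwk; rewrite !ren_ren; now apply ren_ext.
Qed.

(** [D] is [G] under stronger tope assumptions, so judgments pass from [G] to [D]. Adding a tope and
    restricting to a subshape are both of this kind. *)
Definition ctx_le (G D : ctx) : Prop :=
  cubes G = cubes D /\ types G = types D /\
  forall phi, In phi (topes G) -> entails (topes D) phi.

Lemma is_ren_ctx_le G D : ctx_le G D -> is_ren PVar (fun i => i) G D.
Proof.
  intros (Hc & Ht & H); split.
  - rewrite Hc; auto.
  - intros; rewrite tope_subst_id; auto.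
  - rewrite Ht; intros i A HA; exists A; split; auto.
    symmetry; now apply ren_id.
Qed.

Lemma ctx_le_ext_tope G phi : ctx_le G (ext_tope G phi).
Proof. repeat split; intros; apply ent_hyp; now right. Qed.

Lemma ctx_le_ext_tope_mono G phi psi :
  entails [psi] phi -> ctx_le (ext_tope G phi) (ext_tope G psi).
Proof.
  intros He; repeat split; intros chi [<- | H].
  - eapply entails_incl; [exact He | intros ? [<- | []]; apply in_eq].
  - apply ent_hyp; now right.
Qed.

Lemma ctx_le_ext_shape G k phi psi :
  entails [psi] phi -> ctx_le (ext_shape G k phi) (ext_shape G k psi).
Proof.
  intros He; repeat split; intros chi [<- | H].
  - eapply entails_incl; [exact He | intros ? [<- | []]; apply in_eq].
  - apply ent_hyp; now right.
Qed.

Lemma ctx_le_ext_tope_shape G k phi psi :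
  ctx_le (ext_shape G k phi) (ext_tope (ext_shape G k psi) phi).
Proof. repeat split; intros chi [<- | H]; apply ent_hyp; cbn; auto. Qed.

Lemma has_type_le G D t A : wf G -> ctx_le G D -> has_type G t A -> has_type D t A.
Proof.
  intros Hw H Ht.
  rewrite <- (ren_id t PVar (fun i => i)), <- (ren_id A PVar (fun i => i)) by auto.
  apply (proj1 judgment_ren G); auto using is_ren_ctx_le.
Qed.

Lemma eq_tm_le G D t u A : wf G -> ctx_le G D -> eq_tm G t u A -> eq_tm D t u A.
Proof.
  intros Hw H Ht.
  rewrite <- (ren_id t PVar (fun i => i)), <- (ren_id u PVar (fun i => i)),
    <- (ren_id A PVar (fun i => i)) by auto.
  apply (proj2 judgment_ren G); auto using is_ren_ctx_le.
Qed.

Lemma has_type_ext_tope G phi t A : wf G -> has_type G t A -> has_type (ext_tope G phi) t A.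
Proof. intros; eapply has_type_le; eauto using ctx_le_ext_tope. Qed.

Lemma eq_tm_ext_tope G phi t u A : wf G -> eq_tm G t u A -> eq_tm (ext_tope G phi) t u A.
Proof. intros; eapply eq_tm_le; eauto using ctx_le_ext_tope. Qed.

Lemma has_type_cwk G k psi t A :
  wf G -> has_type G t A -> has_type (ext_shape G k psi) (cwk k t) (cwk k A).
Proof. intros Hw H; apply (proj1 judgment_ren G); auto using is_ren_cwk. Qed.

Lemma eq_tm_cwk G k psi t u A :
  wf G -> eq_tm G t u A -> eq_tm (ext_shape G k psi) (cwk k t) (cwk k u) (cwk k A).
Proof. intros Hw H; apply (proj2 judgment_ren G); auto using is_ren_cwk. Qed.

Lemma has_type_wk G B t A : wf G -> has_type G t A -> has_type (ext_type G B) (wk 1 t) (wk 1 A).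
Proof. intros Hw H; apply (proj1 judgment_ren G); auto using is_ren_wk. Qed.

Lemma eq_tm_wk G B t u A :
  wf G -> eq_tm G t u A -> eq_tm (ext_type G B) (wk 1 t) (wk 1 u) (wk 1 A).
Proof. intros Hw H; apply (proj2 judgment_ren G); auto using is_ren_wk. Qed.

Create HintDb stt.
#[global] Hint Resolve wf_ext_shape wf_ext_type has_type_ext_tope eq_tm_ext_tope
  has_type_cwk eq_tm_cwk has_type_wk eq_tm_wk deq_refl : stt.

Lemma has_type_cwk_univ G k psi A i :
  wf G -> has_type G A (Univ i) -> has_type (ext_shape G k psi) (cwk k A) (Univ i).
Proof. apply has_type_cwk. Qed.
#[global] Hint Resolve has_type_cwk_univ : stt.

(** * Derived rules for equality and order of points *)

Lemma point_subst_pinst_shift ts k p :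
  length ts = k -> point_subst (pinst ts) (point_subst (pshift k) p) = p.
Proof.
  intros H; rewrite point_subst_comp; apply point_subst_id.
  intros; now apply pinst_add.
Qed.

Lemma ent_eq_sym Phi s t : entails Phi (TEq s t) -> entails Phi (TEq t s).
Proof.
  intros H.
  (* Only [PVar 0] is to be replaced, but [pinst] also lowers the other variables; the shift of the
     fixed side compensates for this. *)
  pose proof (ent_eq_subst Phi s t (TEq (PVar 0) (point_subst (pshift 1) s)) H) as E.
  cbn in E; rewrite !point_subst_pinst_shift in E by reflexivity.
  apply E, ent_eq_refl.
Qed.

Lemma ent_eq_le Phi s t : entails Phi (TEq s t) -> entails Phi (TLe s t).
Proof.
  intros H.
  pose proof (ent_eq_subst Phi s t (TLe (point_subst (pshift 1) s) (PVar 0)) H) as E.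
  cbn in E; rewrite !point_subst_pinst_shift in E by reflexivity.
  apply E, ent_le_refl.
Qed.

Lemma ent_eq_trans Phi r s t :
  entails Phi (TEq r s) -> entails Phi (TEq s t) -> entails Phi (TEq r t).
Proof.
  intros H1 H2; apply ent_le_antisym.
  - eapply ent_le_trans; apply ent_eq_le; eauto.
  - eapply ent_le_trans; apply ent_eq_le, ent_eq_sym; eauto.
Qed.

Lemma ent_0_eq_1 Phi s : entails Phi (TEq s P0) -> entails Phi (TEq s P1) -> entails Phi TBot.
Proof. intros H0 H1; eapply ent_01, ent_eq_trans; eauto using ent_eq_sym. Qed.

(** * Extension types and [hom] *)

Lemma eq_tm_absurd G A a b :
  entails (topes G) TBot -> has_type G a A -> has_type G b A -> eq_tm G a b A.
Proof.
  intros; eapply deq_trans; [|apply deq_sym]; apply deq_recbot_eta; auto.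
Qed.

(** By [deq_recor_eta] each side is the [RecOr] of its own restrictions, and [RecOr] is congruent in
    its branches. All later proofs by cases on a point rest on this. *)
Lemma eq_tm_cases G phi psi A a b i :
  wf G -> tope_scoped (cubes G) phi -> tope_scoped (cubes G) psi ->
  entails (topes G) (TOr phi psi) ->
  has_type G A (Univ i) -> has_type G a A -> has_type G b A ->
  eq_tm (ext_tope G phi) a b A -> eq_tm (ext_tope G psi) a b A -> eq_tm G a b A.
Proof.
  intros.
  eapply deq_trans; [apply (deq_recor_eta G phi psi); auto|].
  eapply deq_trans; [|apply deq_sym, (deq_recor_eta G phi psi); auto].
  eapply deq_recor; eauto with stt.
Qed.

Lemma cinst_cwk ts k t : length ts = k -> cinst ts (cwk k t) = t.
Proof.
  intros H; unfold cinst, cwk; rewrite ren_ren; apply ren_id; auto.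
  intros; now apply pinst_add.
Qed.

(** A weakened extension type carries its own bound copy of the [k] coordinates next to the ambient
    one; evaluation at the generic point identifies the two. *)
Lemma cinst_cvars_pup k t : cinst (cvars k) (ren (pup k (pshift k)) (fun i => i) t) = t.
Proof.
  unfold cinst; rewrite ren_ren; apply ren_id; auto.
  apply (pup_cases k); intros i.
  - intros H; rewrite pup_lt by auto; cbn.
    rewrite (pinst_lt _ i P0) by now rewrite length_cvars.
    now apply nth_cvars.
  - rewrite pup_add; apply point_subst_pinst_shift, length_cvars.
Qed.

Lemma cvars_scoped k n : Forall (point_scoped (k + n)) (cvars k).
Proof.
  apply Forall_forall; intros p H; apply in_map_iff in H as (i & <- & H).
  apply in_seq in H; cbn; lia.
Qed.

Lemma entails_at_cvars G k phi : tope_scoped k phi -> entails_at (ext_shape G k phi) phi (cvars k).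
Proof.
  intros H; unfold entails_at.
  rewrite (tope_subst_scoped_ext k _ PVar phi H).
  - rewrite tope_subst_id by auto; apply ent_hyp, in_eq.
  - intros i Hi; rewrite (pinst_lt _ i P0) by now rewrite length_cvars.
    now apply nth_cvars.
Qed.

Lemma ext_eq G k psi phi A a f g i :
  wf G -> has_type G (Ext k psi phi A a) (Univ i) ->
  has_type G f (Ext k psi phi A a) -> has_type G g (Ext k psi phi A a) ->
  eq_tm (ext_shape G k psi) (ExtApp (cwk k f) (cvars k)) (ExtApp (cwk k g) (cvars k)) A ->
  eq_tm G f g (Ext k psi phi A a).
Proof.
  intros Hw HE Hf Hg H.
  destruct (has_type_Ext_scoped _ _ _ _ _ _ _ HE) as [Hpsi Hphi].
  eapply deq_trans; [apply deq_ext_eta, Hf|].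
  eapply deq_trans; [|apply deq_sym, deq_ext_eta, Hg].
  apply (deq_extlam _ _ _ _ _ _ _ _ i); auto.
  (* [deq_extlam] also wants the eta-expansion of [f] to equal [a] on [phi], which is the boundary
     rule at the generic point. *)
  pose proof (has_type_cwk G k phi _ _ Hw Hf) as Hf'.
  pose proof (deq_ext_boundary _ _ _ _ _ _ _ (cvars k) Hf' (length_cvars k)
    (cvars_scoped _ _) (entails_at_cvars G k phi Hphi)) as E.
  now rewrite !cinst_cvars_pup in E.
Qed.

(** On the overlap [t] equals both 0 and 1, which is inconsistent; hence the two branches are
    compatible for free, each being typed on its own side. *)
Lemma ty_ends G t A a b i :
  wf G -> point_scoped (cubes G) t ->
  entails (topes G) (TOr (TEq t P0) (TEq t P1)) ->
  has_type G A (Univ i) ->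
  has_type (ext_tope G (TEq t P0)) a A -> has_type (ext_tope G (TEq t P1)) b A ->
  has_type G (RecOr (TEq t P0) (TEq t P1) a b) A.
Proof.
  intros; eapply ty_recor; cbn; eauto.
  apply eq_tm_absurd.
  - eapply (ent_0_eq_1 _ t); [eapply ent_and_l | eapply ent_and_r]; apply ent_hyp, in_eq.
  - eapply has_type_le; [| apply ctx_le_ext_tope_mono |]; eauto with stt.
    eapply ent_and_l; apply ent_hyp, in_eq.
  - eapply has_type_le; [| apply ctx_le_ext_tope_mono |]; eauto with stt.
    eapply ent_and_r; apply ent_hyp, in_eq.
Qed.

(** Here [A] is a type over the interval, with one cube variable more than [a] and [b]. Both [hom]
    and [dhom] are instances, so the rules for endpoints are shown once. *)
Definition dpath (A a b : tm) : tm := Ext 1 Delta1 bdDelta1 A (endpoints a b).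

Lemma entails_Delta1 phi : entails [phi] Delta1.
Proof. apply ent_top. Qed.

Lemma ty_endpoints G A a b i :
  wf G -> has_type (ext_shape G 1 Delta1) A (Univ i) ->
  has_type (ext_shape G 1 (TEq (PVar 0) P0)) (cwk 1 a) A ->
  has_type (ext_shape G 1 (TEq (PVar 0) P1)) (cwk 1 b) A ->
  has_type (ext_shape G 1 bdDelta1) (endpoints a b) A.
Proof.
  intros Hw HA Ha Hb; eapply ty_ends; cbn; auto with stt.
  - lia.
  - apply ent_hyp, in_eq.
  - eapply has_type_le; [|apply ctx_le_ext_shape, entails_Delta1|]; eauto with stt.
  - eapply has_type_le; [|apply ctx_le_ext_tope_shape|]; auto with stt.
  - eapply has_type_le; [|apply ctx_le_ext_tope_shape|]; auto with stt.
Qed.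

Lemma ty_dpath G A a b i :
  wf G -> has_type (ext_shape G 1 Delta1) A (Univ i) ->
  has_type (ext_shape G 1 (TEq (PVar 0) P0)) (cwk 1 a) A ->
  has_type (ext_shape G 1 (TEq (PVar 0) P1)) (cwk 1 b) A ->
  has_type G (dpath A a b) (Univ i).
Proof.
  intros; eapply ty_ext; eauto using ty_endpoints, entails_Delta1; cbn; auto.
Qed.

(** The premises for abstracting [t] to an element of [dpath A a b], with the boundary condition
    split at the two ends. The ends are typed in the generic fibre under a tope assumption instead
    of in the fibres at [P0] and [P1], which need not be syntactically related to it. *)
Record dpath_body (G : ctx) (i : nat) (A a b t : tm) : Prop := {
  db_wf : wf G;
  db_type : has_type (ext_shape G 1 Delta1) A (Univ i);
  db_src : has_type (ext_shape G 1 (TEq (PVar 0) P0)) (cwk 1 a) A;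
  db_tgt : has_type (ext_shape G 1 (TEq (PVar 0) P1)) (cwk 1 b) A;
  db_body : has_type (ext_shape G 1 Delta1) t A;
  db_src_eq : eq_tm (ext_shape G 1 (TEq (PVar 0) P0)) t (cwk 1 a) A;
  db_tgt_eq : eq_tm (ext_shape G 1 (TEq (PVar 0) P1)) t (cwk 1 b) A }.

Lemma dpath_body_boundary G i A a b t :
  dpath_body G i A a b t -> eq_tm (ext_shape G 1 bdDelta1) t (endpoints a b) A.
Proof.
  intros [Hw HA Ha Hb Ht H0 H1].
  assert (HE : has_type (ext_shape G 1 bdDelta1) (endpoints a b) A)
    by (eapply ty_endpoints; eauto).
  assert (HA' : has_type (ext_shape G 1 bdDelta1) A (Univ i))
    by (eapply has_type_le; [|apply ctx_le_ext_shape, entails_Delta1|]; eauto with stt).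
  eapply (eq_tm_cases _ (TEq (PVar 0) P0) (TEq (PVar 0) P1)); cbn; eauto with stt.
  all: try lia.
  - apply ent_hyp, in_eq.
  - eapply has_type_le; [|apply ctx_le_ext_shape, entails_Delta1|]; eauto with stt.
  - eapply deq_trans.
    + eapply eq_tm_le; [|apply ctx_le_ext_tope_shape|]; eauto with stt.
    + apply deq_sym, deq_recor_l; auto with stt; [|apply ent_hyp, in_eq].
      eapply has_type_le; [|apply ctx_le_ext_tope_shape|]; eauto with stt.
  - eapply deq_trans.
    + eapply eq_tm_le; [|apply ctx_le_ext_tope_shape|]; eauto with stt.
    + apply deq_sym, deq_recor_r; auto with stt; [|apply ent_hyp, in_eq].
      eapply has_type_le; [|apply ctx_le_ext_tope_shape|]; eauto with stt.
Qed.

Lemma dpath_intro G i A a b t :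
  dpath_body G i A a b t -> has_type G (ExtLam 1 t) (dpath A a b).
Proof.
  intros H; apply (ty_extlam _ _ _ _ _ _ _ i);
    [| apply H | exact (dpath_body_boundary _ _ _ _ _ _ H)].
  apply ty_dpath; apply H.
Qed.

Lemma dpath_beta G i A a b t p :
  dpath_body G i A a b t -> point_scoped (cubes G) p ->
  eq_tm G (ExtApp (ExtLam 1 t) [p]) (cinst [p] t) (cinst [p] A).
Proof.
  intros H Hp; apply (deq_ext_beta _ _ Delta1 bdDelta1 A (endpoints a b) t [p] i); auto.
  - apply ty_dpath; apply H.
  - apply H.
  - eapply dpath_body_boundary, H.
  - apply ent_top.
Qed.

Lemma dpath_app G A a b f t :
  has_type G f (dpath A a b) -> point_scoped (cubes G) t ->
  has_type G (ExtApp f [t]) (cinst [t] A).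
Proof. intros; eapply ty_extapp; eauto using Forall; apply ent_top. Qed.

Lemma eq_dpath_app G A a b f f' t t' :
  eq_tm G f f' (dpath A a b) -> point_scoped (cubes G) t -> point_scoped (cubes G) t' ->
  entails (topes G) (TEq t t') ->
  eq_tm G (ExtApp f [t]) (ExtApp f' [t']) (cinst [t] A).
Proof. intros; eapply deq_extapp; eauto using Forall, Forall2; apply ent_top. Qed.

Lemma cinst_endpoints t a b :
  cinst [t] (endpoints a b) = RecOr (TEq t P0) (TEq t P1) a b.
Proof. unfold endpoints; change (cinst [t] (RecOr ?p ?q (cwk 1 a) (cwk 1 b))) with
  (RecOr (TEq t P0) (TEq t P1) (cinst [t] (cwk 1 a)) (cinst [t] (cwk 1 b))).
  now rewrite !cinst_cwk.
Qed.

(* [B] is the type of the opposite endpoint, which need not make sense over [t]. *)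
Lemma dpath_app_0 G A B a b f t i :
  wf G -> has_type G f (dpath A a b) -> point_scoped (cubes G) t ->
  entails (topes G) (TEq t P0) ->
  has_type G (cinst [t] A) (Univ i) -> has_type G a (cinst [t] A) ->
  has_type G B (Univ i) -> has_type G b B ->
  eq_tm G (ExtApp f [t]) a (cinst [t] A).
Proof.
  intros Hw Hf Ht H0 HA Ha HB Hb.
  eapply deq_trans; [eapply deq_ext_boundary|]; eauto using Forall.
  - apply ent_or_l, H0.
  - rewrite cinst_endpoints; apply deq_recor_l; auto.
    eapply ty_ends; eauto using ent_or_l with stt.
    (* Under the further assumption [t = 1] the topes are inconsistent, so [B] is judgmentally equal
       to the fibre over [t]. *)
    eapply ty_conv; eauto with stt.
    apply eq_tm_absurd; eauto with stt.
    apply (ent_0_eq_1 _ t); [|apply ent_hyp, in_eq].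
    eapply entails_incl; [exact H0 | apply incl_tl, incl_refl].
Qed.

Lemma dpath_app_1 G A B a b f t i :
  wf G -> has_type G f (dpath A a b) -> point_scoped (cubes G) t ->
  entails (topes G) (TEq t P1) ->
  has_type G (cinst [t] A) (Univ i) -> has_type G b (cinst [t] A) ->
  has_type G B (Univ i) -> has_type G a B ->
  eq_tm G (ExtApp f [t]) b (cinst [t] A).
Proof.
  intros Hw Hf Ht H1 HA Hb HB Ha.
  eapply deq_trans; [eapply deq_ext_boundary|]; eauto using Forall.
  - apply ent_or_r, H1.
  - rewrite cinst_endpoints; apply deq_recor_r; auto.
    eapply ty_ends; eauto using ent_or_r with stt.
    eapply ty_conv; eauto with stt.
    apply eq_tm_absurd; eauto with stt.
    apply (ent_0_eq_1 _ t); [apply ent_hyp, in_eq|].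
    eapply entails_incl; [exact H1 | apply incl_tl, incl_refl].
Qed.

Lemma ren_dpath rho xi A a b :
  ren rho xi (dpath A a b) = dpath (ren (pup 1 rho) xi A) (ren rho xi a) (ren rho xi b).
Proof. unfold dpath, endpoints; cbn -[cwk]; now rewrite !ren_cwk. Qed.

Lemma hom_dpath A a b : hom A a b = dpath (cwk 1 A) a b.
Proof. reflexivity. Qed.

Lemma ren_hom rho xi A a b :
  ren rho xi (hom A a b) = hom (ren rho xi A) (ren rho xi a) (ren rho xi b).
Proof. now rewrite !hom_dpath, ren_dpath, ren_cwk. Qed.

Lemma ty_hom G A a b i :
  wf G -> has_type G A (Univ i) -> has_type G a A -> has_type G b A ->
  has_type G (hom A a b) (Univ i).
Proof. intros; apply ty_dpath; auto with stt. Qed.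

Lemma hom_body G i A a b t :
  wf G -> has_type G A (Univ i) -> has_type G a A -> has_type G b A ->
  has_type (ext_shape G 1 Delta1) t (cwk 1 A) ->
  eq_tm (ext_shape G 1 (TEq (PVar 0) P0)) t (cwk 1 a) (cwk 1 A) ->
  eq_tm (ext_shape G 1 (TEq (PVar 0) P1)) t (cwk 1 b) (cwk 1 A) ->
  dpath_body G i (cwk 1 A) a b t.
Proof. intros; split; auto with stt. Qed.

Lemma hom_beta G i A a b t p :
  dpath_body G i (cwk 1 A) a b t -> point_scoped (cubes G) p ->
  eq_tm G (ExtApp (ExtLam 1 t) [p]) (cinst [p] t) A.
Proof.
  intros H Hp; pose proof (dpath_beta _ _ _ _ _ _ _ H Hp) as E.
  now rewrite cinst_cwk in E.
Qed.

Lemma hom_app G A a b f t :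
  has_type G f (hom A a b) -> point_scoped (cubes G) t -> has_type G (ExtApp f [t]) A.
Proof.
  intros Hf Ht; pose proof (dpath_app _ _ _ _ _ _ Hf Ht) as H.
  now rewrite cinst_cwk in H.
Qed.

Lemma eq_hom_app G A a b f f' t t' :
  eq_tm G f f' (hom A a b) -> point_scoped (cubes G) t -> point_scoped (cubes G) t' ->
  entails (topes G) (TEq t t') ->
  eq_tm G (ExtApp f [t]) (ExtApp f' [t']) A.
Proof.
  intros Hf Ht Ht' He; pose proof (eq_dpath_app _ _ _ _ _ _ _ _ Hf Ht Ht' He) as H.
  now rewrite cinst_cwk in H.
Qed.

Lemma hom_app_0 G A a b f t i :
  has_type G f (hom A a b) -> wf G -> has_type G A (Univ i) -> has_type G a A ->
  has_type G b A -> point_scoped (cubes G) t -> entails (topes G) (TEq t P0) ->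
  eq_tm G (ExtApp f [t]) a A.
Proof.
  intros Hf Hw HA Ha Hb Ht H0.
  pose proof (dpath_app_0 G (cwk 1 A) A a b f t i Hw Hf Ht H0) as H.
  rewrite cinst_cwk in H by reflexivity; auto.
Qed.

Lemma hom_app_1 G A a b f t i :
  has_type G f (hom A a b) -> wf G -> has_type G A (Univ i) -> has_type G a A ->
  has_type G b A -> point_scoped (cubes G) t -> entails (topes G) (TEq t P1) ->
  eq_tm G (ExtApp f [t]) b A.
Proof.
  intros Hf Hw HA Ha Hb Ht H1.
  pose proof (dpath_app_1 G (cwk 1 A) A a b f t i Hw Hf Ht H1) as H.
  rewrite cinst_cwk in H by reflexivity; auto.
Qed.

Lemma has_type_cwk_hom G k psi A a b f :
  wf G -> has_type G f (hom A a b) ->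
  has_type (ext_shape G k psi) (cwk k f) (hom (cwk k A) (cwk k a) (cwk k b)).
Proof.
  intros Hw H; pose proof (has_type_cwk G k psi _ _ Hw H) as H'.
  unfold cwk at 2 in H'; now rewrite ren_hom in H'.
Qed.

Lemma eq_tm_cwk_hom G k psi A a b f g :
  wf G -> eq_tm G f g (hom A a b) ->
  eq_tm (ext_shape G k psi) (cwk k f) (cwk k g) (hom (cwk k A) (cwk k a) (cwk k b)).
Proof.
  intros Hw H; pose proof (eq_tm_cwk G k psi _ _ _ Hw H) as H'.
  unfold cwk at 3 in H'; now rewrite ren_hom in H'.
Qed.
#[global] Hint Resolve has_type_cwk_hom eq_tm_cwk_hom hom_app ty_hom : stt.

(** Congruence in the target serves to identify [hom A a x] and [hom A a y] with the fibres over the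
    two ends of an arrow from [x] to [y]. *)
Lemma eq_hom G A a b b' i :
  wf G -> has_type G A (Univ i) -> has_type G a A -> has_type G b A -> has_type G b' A ->
  eq_tm G b b' A -> eq_tm G (hom A a b) (hom A a b') (Univ i).
Proof.
  intros Hw HA Ha Hb Hb' H.
  apply deq_ext; cbn; auto using entails_Delta1 with stt.
  unfold endpoints; eapply deq_recor; cbn; eauto with stt.
  all: try lia.
  - apply ent_hyp, in_eq.
  - apply eq_tm_absurd; auto with stt.
    eapply (ent_0_eq_1 _ (PVar 0)); [eapply ent_and_l | eapply ent_and_r]; apply ent_hyp, in_eq.
Qed.

Lemma hom_eq G A a b f g i :
  wf G -> has_type G A (Univ i) -> has_type G a A -> has_type G b A ->
  has_type G f (hom A a b) -> has_type G g (hom A a b) ->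
  eq_tm (ext_shape G 1 Delta1) (ExtApp (cwk 1 f) [PVar 0]) (ExtApp (cwk 1 g) [PVar 0]) (cwk 1 A) ->
  eq_tm G f g (hom A a b).
Proof. intros; eapply ext_eq; eauto with stt; now apply ty_hom. Qed.

(** * Triangles *)

Record triangle_data (G : ctx) (i : nat) (A x y z f g h : tm) : Prop := {
  td_wf : wf G;
  td_A : has_type G A (Univ i);
  td_x : has_type G x A;
  td_y : has_type G y A;
  td_z : has_type G z A;
  td_f : has_type G f (hom A x y);
  td_g : has_type G g (hom A y z);
  td_h : has_type G h (hom A x z) }.
#[global] Hint Resolve td_wf td_A td_x td_y td_z td_f td_g td_h : stt.

Lemma triangle_data_ext_tope G i A x y z f g h phi :
  triangle_data G i A x y z f g h -> triangle_data (ext_tope G phi) i A x y z f g h.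
Proof. intros []; split; auto with stt. Qed.

Lemma triangle_data_cwk G i A x y z f g h k psi :
  triangle_data G i A x y z f g h ->
  triangle_data (ext_shape G k psi) i (cwk k A) (cwk k x) (cwk k y) (cwk k z)
    (cwk k f) (cwk k g) (cwk k h).
Proof. intros []; split; auto with stt. Qed.
#[global] Hint Resolve triangle_data_ext_tope triangle_data_cwk : stt.

(** [triangle_boundary] evaluated at an arbitrary point [(p, q)]. The generic boundary and all its
    instances thus share one formula. *)
Definition triangle (p q : point) (f g h : tm) : tm :=
  RecOr (TEq q P0) (TOr (TEq q p) (TEq p P1)) (ExtApp f [p])
    (RecOr (TEq q p) (TEq p P1) (ExtApp h [p]) (ExtApp g [q])).

Definition on_triangle (p q : point) : tope :=
  TOr (TEq q P0) (TOr (TEq q p) (TEq p P1)).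

Ltac in_hyps := apply ent_hyp; cbn; tauto.

Lemma ent_ext_tope G phi psi : entails (topes G) phi -> entails (topes (ext_tope G psi)) phi.
Proof. intros H; eapply entails_incl; [exact H | apply incl_tl, incl_refl]. Qed.

Lemma ent_ext_tope_hyp G phi : entails (topes (ext_tope G phi)) phi.
Proof. in_hyps. Qed.

Lemma ent_ext_shape_hyp G k phi : entails (topes (ext_shape G k phi)) phi.
Proof. in_hyps. Qed.
#[global] Hint Resolve ent_ext_tope ent_ext_tope_hyp ent_ext_shape_hyp : stt.

(** The branches overlap in the vertex [(1, 1)], where both equal [z]. *)
Lemma ty_triangle_inner G i A x y z f g h p q :
  triangle_data G i A x y z f g h ->
  point_scoped (cubes G) p -> point_scoped (cubes G) q ->
  entails (topes G) (TOr (TEq q p) (TEq p P1)) ->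
  has_type G (RecOr (TEq q p) (TEq p P1) (ExtApp h [p]) (ExtApp g [q])) A.
Proof.
  intros T Hp Hq He; pose proof T as [Hw HA Hx Hy Hz Hf Hg Hh].
  eapply ty_recor; cbn; eauto with stt.
  set (G' := ext_tope G _).
  assert (H1 : entails (topes G') (TEq p P1)) by (eapply ent_and_r; in_hyps).
  assert (H2 : entails (topes G') (TEq q p)) by (eapply ent_and_l; in_hyps).
  eapply deq_trans; [|apply deq_sym].
  - apply (hom_app_1 _ A x z h p i); auto; apply has_type_ext_tope; auto.
  - apply (hom_app_1 _ A y z g q i); eauto using ent_eq_trans; apply has_type_ext_tope; auto.
Qed.

(** The side [f] meets the other two in the vertices [(0, 0)] and [(1, 0)], where the values are [x]
    and [y] respectively. *)
Lemma ty_triangle G i A x y z f g h p q :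
  triangle_data G i A x y z f g h ->
  point_scoped (cubes G) p -> point_scoped (cubes G) q ->
  entails (topes G) (on_triangle p q) ->
  has_type G (triangle p q f g h) A.
Proof.
  intros T Hp Hq He; pose proof T as [Hw HA Hx Hy Hz Hf Hg Hh].
  eapply ty_recor; cbn; eauto with stt.
  - eapply ty_triangle_inner; eauto with stt; in_hyps.
  - set (G' := ext_tope G _).
    assert (T' : triangle_data G' i A x y z f g h) by (apply triangle_data_ext_tope, T).
    assert (H0 : entails (topes G') (TEq q P0)) by (eapply ent_and_l; in_hyps).
    assert (H1 : entails (topes G') (TOr (TEq q p) (TEq p P1))) by (eapply ent_and_r; in_hyps).
    pose proof (ty_triangle_inner G' i A x y z f g h p q T' Hp Hq H1) as HR.
    apply (eq_tm_cases _ (TEq q p) (TEq p P1) _ _ _ i); cbn; eauto with stt.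
    + eapply deq_trans; [|apply deq_sym, deq_recor_l; eauto with stt; in_hyps].
      assert (Hp0 : entails (topes (ext_tope G' (TEq q p))) (TEq p P0)).
      { eapply ent_eq_trans; [apply ent_eq_sym; in_hyps | apply ent_ext_tope, H0]. }
      eapply deq_trans; [|apply deq_sym].
      * eapply (hom_app_0 _ A x y); eauto with stt.
      * eapply (hom_app_0 _ A x z); eauto with stt.
    + eapply deq_trans; [|apply deq_sym, deq_recor_r; eauto with stt; in_hyps].
      eapply deq_trans; [|apply deq_sym].
      * eapply (hom_app_1 _ A x y); eauto with stt; in_hyps.
      * eapply (hom_app_0 _ A y z); eauto with stt.
Qed.

Lemma triangle_f G i A x y z f g h p q :
  triangle_data G i A x y z f g h ->
  point_scoped (cubes G) p -> point_scoped (cubes G) q ->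
  entails (topes G) (TEq q P0) ->
  eq_tm G (triangle p q f g h) (ExtApp f [p]) A.
Proof.
  intros; apply deq_recor_l; eauto with stt.
  eapply ty_triangle; eauto; now apply ent_or_l.
Qed.

Lemma triangle_h G i A x y z f g h p q :
  triangle_data G i A x y z f g h ->
  point_scoped (cubes G) p -> point_scoped (cubes G) q ->
  entails (topes G) (TEq q p) ->
  eq_tm G (triangle p q f g h) (ExtApp h [p]) A.
Proof.
  intros T Hp Hq He.
  assert (HR : has_type G (RecOr (TEq q p) (TEq p P1) (ExtApp h [p]) (ExtApp g [q])) A)
    by (eapply ty_triangle_inner; eauto using ent_or_l).
  eapply deq_trans; [apply deq_recor_r | apply deq_recor_l]; eauto using ent_or_l with stt.
  eapply ty_triangle; eauto; now apply ent_or_r, ent_or_l.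
Qed.

Lemma triangle_g G i A x y z f g h p q :
  triangle_data G i A x y z f g h ->
  point_scoped (cubes G) p -> point_scoped (cubes G) q ->
  entails (topes G) (TEq p P1) ->
  eq_tm G (triangle p q f g h) (ExtApp g [q]) A.
Proof.
  intros T Hp Hq He.
  assert (HR : has_type G (RecOr (TEq q p) (TEq p P1) (ExtApp h [p]) (ExtApp g [q])) A)
    by (eapply ty_triangle_inner; eauto using ent_or_r).
  eapply deq_trans; [apply deq_recor_r | apply deq_recor_r]; eauto using ent_or_r with stt.
  eapply ty_triangle; eauto; now apply ent_or_r, ent_or_r.
Qed.

Lemma triangle_boundary_eq f g h :
  triangle_boundary f g h = triangle (PVar 0) (PVar 1) (cwk 2 f) (cwk 2 g) (cwk 2 h).
Proof. reflexivity. Qed.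

Lemma eq_tm_triangle_cases G i A p q a b :
  wf G -> has_type G A (Univ i) ->
  point_scoped (cubes G) p -> point_scoped (cubes G) q ->
  entails (topes G) (on_triangle p q) ->
  has_type G a A -> has_type G b A ->
  eq_tm (ext_tope G (TEq q P0)) a b A ->
  eq_tm (ext_tope G (TEq q p)) a b A ->
  eq_tm (ext_tope G (TEq p P1)) a b A ->
  eq_tm G a b A.
Proof.
  intros Hw HA Hp Hq He Ha Hb Hf Hh Hg.
  eapply eq_tm_cases; [| | | exact He | | | | |]; cbn; eauto with stt.
  apply (eq_tm_cases _ (TEq q p) (TEq p P1) _ _ _ i); cbn; auto with stt; [in_hyps| |].
  - eapply eq_tm_le; [| |exact Hh]; auto with stt.
    repeat split; intros phi [<-|]; apply ent_hyp; cbn; auto.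
  - eapply eq_tm_le; [| |exact Hg]; auto with stt.
    repeat split; intros phi [<-|]; apply ent_hyp; cbn; auto.
Qed.

Lemma entails_bdDelta2 : entails [bdDelta2] Delta2.
Proof.
  eapply ent_or_elim; [in_hyps | |eapply ent_or_elim; [in_hyps | |]]; unfold Delta2.
  - eapply ent_le_trans; [apply ent_eq_le; in_hyps | apply ent_le_0].
  - apply ent_eq_le; in_hyps.
  - eapply ent_le_trans; [apply ent_le_1 | apply ent_eq_le, ent_eq_sym; in_hyps].
Qed.

Lemma ty_triangle_boundary G i A x y z f g h :
  triangle_data G i A x y z f g h ->
  has_type (ext_shape G 2 bdDelta2) (triangle_boundary f g h) (cwk 2 A).
Proof.
  intros T; rewrite triangle_boundary_eq; eapply ty_triangle; eauto with stt; cbn; lia.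
Qed.

Lemma ty_hom2 G i A x y z f g h :
  triangle_data G i A x y z f g h -> has_type G (hom2 A f g h) (Univ i).
Proof.
  intros T; apply ty_ext; cbn; eauto using ty_triangle_boundary, entails_bdDelta2 with stt.
  all: lia.
Qed.

Lemma Forall_pair {X} (P : X -> Prop) a b : P a -> P b -> Forall P [a; b].
Proof. auto. Qed.

Record hom2_body (G : ctx) (A f g h t : tm) : Prop := {
  hb_body : has_type (ext_shape G 2 Delta2) t (cwk 2 A);
  hb_f : eq_tm (ext_shape G 2 (TEq (PVar 1) P0)) t (ExtApp (cwk 2 f) [PVar 0]) (cwk 2 A);
  hb_h : eq_tm (ext_shape G 2 (TEq (PVar 1) (PVar 0))) t (ExtApp (cwk 2 h) [PVar 0]) (cwk 2 A);
  hb_g : eq_tm (ext_shape G 2 (TEq (PVar 0) P1)) t (ExtApp (cwk 2 g) [PVar 1]) (cwk 2 A) }.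

Lemma hom2_body_boundary G i A x y z f g h t :
  triangle_data G i A x y z f g h -> hom2_body G A f g h t ->
  eq_tm (ext_shape G 2 bdDelta2) t (triangle_boundary f g h) (cwk 2 A).
Proof.
  intros T [Ht Hf Hh Hg].
  eapply (eq_tm_triangle_cases _ i _ (PVar 0) (PVar 1)); cbn;
    eauto using ty_triangle_boundary with stt.
  all: try lia.
  all: try in_hyps.
  - eapply has_type_le; [| |exact Ht]; eauto using ctx_le_ext_shape, entails_bdDelta2 with stt.
  - eapply deq_trans; [eapply eq_tm_le; [| |exact Hf]|];
      eauto using ctx_le_ext_tope_shape with stt.
    apply deq_sym; eapply triangle_f; eauto with stt; cbn; try lia; in_hyps.
  - eapply deq_trans; [eapply eq_tm_le; [| |exact Hh]|];
      eauto using ctx_le_ext_tope_shape with stt.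
    apply deq_sym; eapply triangle_h; eauto with stt; cbn; try lia; in_hyps.
  - eapply deq_trans; [eapply eq_tm_le; [| |exact Hg]|];
      eauto using ctx_le_ext_tope_shape with stt.
    apply deq_sym; eapply triangle_g; eauto with stt; cbn; try lia; in_hyps.
Qed.

Lemma hom2_intro G i A x y z f g h t :
  triangle_data G i A x y z f g h -> hom2_body G A f g h t ->
  has_type G (ExtLam 2 t) (hom2 A f g h).
Proof.
  intros T H; eapply ty_extlam; [eapply ty_hom2; eauto | apply H |].
  eapply hom2_body_boundary; eauto.
Qed.

Lemma hom2_beta G i A x y z f g h t p q :
  triangle_data G i A x y z f g h -> hom2_body G A f g h t ->
  point_scoped (cubes G) p -> point_scoped (cubes G) q -> entails (topes G) (TLe q p) ->
  eq_tm G (ExtApp (ExtLam 2 t) [p; q]) (cinst [p; q] t) A.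
Proof.
  intros T H Hp Hq He.
  pose proof (deq_ext_beta G 2 Delta2 bdDelta2 (cwk 2 A) (triangle_boundary f g h) t [p; q] i
    (ty_hom2 _ _ _ _ _ _ _ _ _ T) (hb_body _ _ _ _ _ _ H)
    (hom2_body_boundary _ _ _ _ _ _ _ _ _ _ T H) eq_refl (Forall_pair _ _ _ Hp Hq) He) as E.
  now rewrite cinst_cwk in E.
Qed.

Lemma hom2_app G A f g h t p q :
  has_type G t (hom2 A f g h) ->
  point_scoped (cubes G) p -> point_scoped (cubes G) q -> entails (topes G) (TLe q p) ->
  has_type G (ExtApp t [p; q]) A.
Proof.
  intros Ht Hp Hq He.
  pose proof (ty_extapp G _ _ _ _ _ _ [p; q] Ht eq_refl (Forall_pair _ _ _ Hp Hq) He) as H.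
  now rewrite cinst_cwk in H.
Qed.

Lemma eq_hom2_app G A f g h t t' p q :
  eq_tm G t t' (hom2 A f g h) ->
  point_scoped (cubes G) p -> point_scoped (cubes G) q -> entails (topes G) (TLe q p) ->
  eq_tm G (ExtApp t [p; q]) (ExtApp t' [p; q]) A.
Proof.
  intros Ht Hp Hq He.
  assert (HF : Forall2 (fun s t => entails (topes G) (TEq s t)) [p; q] [p; q])
    by auto using Forall2, ent_eq_refl.
  pose proof (deq_extapp G _ _ _ _ _ _ _ [p; q] [p; q] Ht eq_refl
    (Forall_pair _ _ _ Hp Hq) (Forall_pair _ _ _ Hp Hq) HF He) as H.
  now rewrite cinst_cwk in H.
Qed.

Lemma hom2_app_boundary G A f g h t p q :
  has_type G t (hom2 A f g h) ->
  point_scoped (cubes G) p -> point_scoped (cubes G) q -> entails (topes G) (on_triangle p q) ->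
  eq_tm G (ExtApp t [p; q]) (triangle p q f g h) A.
Proof.
  intros Ht Hp Hq He.
  pose proof (deq_ext_boundary G _ _ _ _ _ _ [p; q] Ht eq_refl (Forall_pair _ _ _ Hp Hq) He) as H.
  rewrite cinst_cwk in H by reflexivity.
  change (cinst [p; q] (triangle_boundary f g h)) with
    (triangle p q (cinst [p; q] (cwk 2 f)) (cinst [p; q] (cwk 2 g)) (cinst [p; q] (cwk 2 h))) in H.
  now rewrite !cinst_cwk in H.
Qed.

Lemma hom2_app_f G i A x y z f g h t p q :
  triangle_data G i A x y z f g h -> has_type G t (hom2 A f g h) ->
  point_scoped (cubes G) p -> point_scoped (cubes G) q ->
  entails (topes G) (TEq q P0) ->
  eq_tm G (ExtApp t [p; q]) (ExtApp f [p]) A.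
Proof.
  intros; eapply deq_trans; [eapply hom2_app_boundary | eapply triangle_f]; eauto.
  now apply ent_or_l.
Qed.

Lemma hom2_app_h G i A x y z f g h t p q :
  triangle_data G i A x y z f g h -> has_type G t (hom2 A f g h) ->
  point_scoped (cubes G) p -> point_scoped (cubes G) q ->
  entails (topes G) (TEq q p) ->
  eq_tm G (ExtApp t [p; q]) (ExtApp h [p]) A.
Proof.
  intros; eapply deq_trans; [eapply hom2_app_boundary | eapply triangle_h]; eauto.
  now apply ent_or_r, ent_or_l.
Qed.

Lemma hom2_app_g G i A x y z f g h t p q :
  triangle_data G i A x y z f g h -> has_type G t (hom2 A f g h) ->
  point_scoped (cubes G) p -> point_scoped (cubes G) q ->
  entails (topes G) (TEq p P1) ->
  eq_tm G (ExtApp t [p; q]) (ExtApp g [q]) A.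
Proof.
  intros; eapply deq_trans; [eapply hom2_app_boundary | eapply triangle_g]; eauto.
  now apply ent_or_r, ent_or_r.
Qed.

Lemma ren_hom2 rho xi A f g h :
  ren rho xi (hom2 A f g h) = hom2 (ren rho xi A) (ren rho xi f) (ren rho xi g) (ren rho xi h).
Proof. unfold hom2, triangle_boundary; cbn -[cwk]; now rewrite !ren_cwk. Qed.

Lemma has_type_cwk_hom2 G k psi A f g h t :
  wf G -> has_type G t (hom2 A f g h) ->
  has_type (ext_shape G k psi) (cwk k t) (hom2 (cwk k A) (cwk k f) (cwk k g) (cwk k h)).
Proof.
  intros Hw H; pose proof (has_type_cwk G k psi _ _ Hw H) as H'.
  unfold cwk at 2 in H'; now rewrite ren_hom2 in H'.
Qed.
#[global] Hint Resolve ty_hom2 has_type_cwk_hom2 hom2_app : stt.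

Lemma hom2_eq G i A x y z f g h s t :
  triangle_data G i A x y z f g h ->
  has_type G s (hom2 A f g h) -> has_type G t (hom2 A f g h) ->
  eq_tm (ext_shape G 2 Delta2) (ExtApp (cwk 2 s) [PVar 0; PVar 1])
    (ExtApp (cwk 2 t) [PVar 0; PVar 1]) (cwk 2 A) ->
  eq_tm G s t (hom2 A f g h).
Proof. intros; eapply ext_eq; eauto with stt; eapply ty_hom2; eauto. Qed.

Lemma eq_hom2 G i A x y z f g h g' h' :
  triangle_data G i A x y z f g h -> triangle_data G i A x y z f g' h' ->
  eq_tm G g g' (hom A y z) -> eq_tm G h h' (hom A x z) ->
  eq_tm G (hom2 A f g h) (hom2 A f g' h') (Univ i).
Proof.
  intros T T' Hg Hh.
  apply deq_ext; cbn; eauto using entails_bdDelta2 with stt; try lia.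
  assert (Hg2 : forall phi, eq_tm (ext_shape G 2 phi) (cwk 2 g) (cwk 2 g')
            (hom (cwk 2 A) (cwk 2 y) (cwk 2 z)))
    by eauto with stt.
  assert (Hh2 : forall phi, eq_tm (ext_shape G 2 phi) (cwk 2 h) (cwk 2 h')
            (hom (cwk 2 A) (cwk 2 x) (cwk 2 z)))
    by eauto with stt.
  eapply (eq_tm_triangle_cases _ i _ (PVar 0) (PVar 1)); cbn;
    eauto using ty_triangle_boundary with stt; try lia; rewrite ?triangle_boundary_eq.
  all: try in_hyps.
  - eapply deq_trans; [|apply deq_sym]; eapply triangle_f; eauto with stt; cbn; try lia; in_hyps.
  - eapply deq_trans; [eapply triangle_h; eauto with stt; cbn; try lia; in_hyps|].
    eapply deq_trans; [|apply deq_sym; eapply triangle_h; eauto with stt; cbn; try lia; in_hyps].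
    eapply eq_hom_app; eauto with stt; cbn; try lia; apply ent_eq_refl.
  - eapply deq_trans; [eapply triangle_g; eauto with stt; cbn; try lia; in_hyps|].
    eapply deq_trans; [|apply deq_sym; eapply triangle_g; eauto with stt; cbn; try lia; in_hyps].
    eapply eq_hom_app; eauto with stt; cbn; try lia; apply ent_eq_refl.
Qed.

#[global] Hint Extern 1 (point_scoped _ _) => cbn; lia : stt.

Lemma point_scoped_shift G k psi p :
  point_scoped (cubes G) p ->
  point_scoped (cubes (ext_shape G k psi)) (point_subst (pshift k) p).
Proof. destruct p; cbn; auto; lia. Qed.

Lemma ent_eq_shift G k psi s t :
  entails (topes G) (TEq s t) ->
  entails (topes (ext_shape G k psi)) (TEq (point_subst (pshift k) s) (point_subst (pshift k) t)).
Proof. apply (is_ren_entails _ _ _ _ (TEq s t) (is_ren_cwk G k psi)). Qed.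

Lemma ent_eq_0_shift G k psi s :
  entails (topes G) (TEq s P0) ->
  entails (topes (ext_shape G k psi)) (TEq (point_subst (pshift k) s) P0).
Proof. apply (ent_eq_shift G k psi s P0). Qed.

Lemma ent_eq_1_shift G k psi s :
  entails (topes G) (TEq s P1) ->
  entails (topes (ext_shape G k psi)) (TEq (point_subst (pshift k) s) P1).
Proof. apply (ent_eq_shift G k psi s P1). Qed.

Lemma ent_0_le Phi s t : entails Phi (TEq s P0) -> entails Phi (TLe s t).
Proof. intros; eapply ent_le_trans; [apply ent_eq_le; eassumption | apply ent_le_0]. Qed.

Lemma ent_le_1_eq Phi s t : entails Phi (TEq t P1) -> entails Phi (TLe s t).
Proof.
  intros; eapply ent_le_trans; [apply ent_le_1 | apply ent_eq_le, ent_eq_sym; eassumption].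
Qed.
#[global] Hint Resolve point_scoped_shift ent_eq_0_shift ent_eq_1_shift ent_0_le ent_le_1_eq
  ent_eq_refl ent_le_refl : stt.

(** * Identity arrows *)

Definition id_hom (a : tm) : tm := ExtLam 1 (cwk 1 a).

Lemma ren_id_hom rho xi a : ren rho xi (id_hom a) = id_hom (ren rho xi a).
Proof. unfold id_hom; cbn; now rewrite ren_cwk. Qed.

Lemma cwk_id_hom k a : cwk k (id_hom a) = id_hom (cwk k a).
Proof. apply ren_id_hom. Qed.

Lemma id_hom_body G i A a :
  wf G -> has_type G A (Univ i) -> has_type G a A -> dpath_body G i (cwk 1 A) a a (cwk 1 a).
Proof. intros; apply hom_body; auto with stt. Qed.

Lemma ty_id_hom G i A a :
  wf G -> has_type G A (Univ i) -> has_type G a A -> has_type G (id_hom a) (hom A a a).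
Proof. intros; eapply dpath_intro, id_hom_body; eauto. Qed.

Lemma id_hom_app G i A a p :
  wf G -> has_type G A (Univ i) -> has_type G a A -> point_scoped (cubes G) p ->
  eq_tm G (ExtApp (id_hom a) [p]) a A.
Proof.
  intros Hw HA Ha Hp.
  pose proof (hom_beta _ _ _ _ _ _ p (id_hom_body G i A a Hw HA Ha) Hp) as E.
  now rewrite cinst_cwk in E.
Qed.
#[global] Hint Resolve ty_id_hom : stt.

(** * Squares *)

Record square_data (G : ctx) (i : nat) (A a x y f u v d : tm) : Prop := {
  sd_wf : wf G;
  sd_A : has_type G A (Univ i);
  sd_a : has_type G a A;
  sd_x : has_type G x A;
  sd_y : has_type G y A;
  sd_f : has_type G f (hom A x y);
  sd_u : has_type G u (hom A a x);
  sd_v : has_type G v (hom A a y);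
  sd_d : has_type G d (hom A a y) }.
#[global] Hint Resolve sd_wf sd_A sd_a sd_x sd_y sd_f sd_u sd_v sd_d : stt.

Lemma square_data_ext_tope G i A a x y f u v d phi :
  square_data G i A a x y f u v d -> square_data (ext_tope G phi) i A a x y f u v d.
Proof. intros []; split; auto with stt. Qed.

Lemma square_data_cwk G i A a x y f u v d k psi :
  square_data G i A a x y f u v d ->
  square_data (ext_shape G k psi) i (cwk k A) (cwk k a) (cwk k x) (cwk k y) (cwk k f)
    (cwk k u) (cwk k v) (cwk k d).
Proof. intros []; split; auto with stt. Qed.
#[global] Hint Resolve square_data_ext_tope square_data_cwk : stt.

Lemma upper_triangle G i A a x y f u v d :
  square_data G i A a x y f u v d -> triangle_data G i A a x y u f d.
Proof. intros []; split; auto. Qed.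

Lemma lower_triangle G i A a x y f u v d :
  square_data G i A a x y f u v d -> triangle_data G i A a a y (id_hom a) v d.
Proof. intros []; split; eauto with stt. Qed.

(** The left unit triangle. It depends on the second coordinate [s] alone, hence is constant on the
    side [s = 0] and equals [d] on the other two sides. *)
Definition degen (d : tm) : tm := ExtLam 2 (ExtApp (cwk 2 d) [PVar 1]).

Lemma degen_triangle G i A a y d :
  wf G -> has_type G A (Univ i) -> has_type G a A -> has_type G y A -> has_type G d (hom A a y) ->
  triangle_data G i A a a y (id_hom a) d d.
Proof. intros; split; eauto with stt. Qed.

Lemma degen_body G i A a y d :
  wf G -> has_type G A (Univ i) -> has_type G a A -> has_type G y A -> has_type G d (hom A a y) ->
  hom2_body G A (id_hom a) d d (ExtApp (cwk 2 d) [PVar 1]).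
Proof.
  intros Hw HA Ha Hy Hd.
  assert (H : forall phi, eq_tm (ext_shape G 2 phi) (cwk 2 d) (cwk 2 d)
            (hom (cwk 2 A) (cwk 2 a) (cwk 2 y))) by auto with stt.
  split.
  - eauto with stt.
  - eapply deq_trans; [eapply hom_app_0; eauto with stt|].
    rewrite cwk_id_hom.
    apply deq_sym; eapply id_hom_app; eauto with stt.
  - eapply eq_hom_app; eauto with stt.
  - eapply eq_hom_app; eauto with stt.
Qed.

Lemma ty_degen G i A a y d :
  wf G -> has_type G A (Univ i) -> has_type G a A -> has_type G y A -> has_type G d (hom A a y) ->
  has_type G (degen d) (hom2 A (id_hom a) d d).
Proof. intros; eapply hom2_intro; eauto using degen_triangle, degen_body. Qed.

Lemma eq_degen G i A a y d d' :
  wf G -> has_type G A (Univ i) -> has_type G a A -> has_type G y A ->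
  has_type G d (hom A a y) -> eq_tm G d d' (hom A a y) ->
  eq_tm G (degen d) (degen d') (hom2 A (id_hom a) d d).
Proof.
  intros Hw HA Ha Hy Hd H.
  pose proof (degen_triangle G i A a y d Hw HA Ha Hy Hd) as T.
  eapply deq_extlam; [eapply ty_hom2, T | |].
  - eapply eq_hom_app; eauto with stt.
  - eapply hom2_body_boundary, degen_body; eauto.
Qed.

Lemma has_type_cwk_hom2_id G k psi A a g h t :
  wf G -> has_type G t (hom2 A (id_hom a) g h) ->
  has_type (ext_shape G k psi) (cwk k t) (hom2 (cwk k A) (id_hom (cwk k a)) (cwk k g) (cwk k h)).
Proof. intros; rewrite <- cwk_id_hom; auto with stt. Qed.

Lemma eq_tm_cwk_hom2 G k psi A f g h s t :
  wf G -> eq_tm G s t (hom2 A f g h) ->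
  eq_tm (ext_shape G k psi) (cwk k s) (cwk k t) (hom2 (cwk k A) (cwk k f) (cwk k g) (cwk k h)).
Proof.
  intros Hw H; pose proof (eq_tm_cwk G k psi _ _ _ Hw H) as H'.
  unfold cwk at 3 in H'; now rewrite ren_hom2 in H'.
Qed.

Lemma eq_tm_cwk_hom2_id G k psi A a g h s t :
  wf G -> eq_tm G s t (hom2 A (id_hom a) g h) ->
  eq_tm (ext_shape G k psi) (cwk k s) (cwk k t)
    (hom2 (cwk k A) (id_hom (cwk k a)) (cwk k g) (cwk k h)).
Proof. intros; rewrite <- cwk_id_hom; auto using eq_tm_cwk_hom2. Qed.
#[global] Hint Resolve has_type_cwk_hom2_id eq_tm_cwk_hom2 eq_tm_cwk_hom2_id : stt.

(* The square over the point [(t, s)]: [al] lies over [t <= s] and [be] over [s <= t]. *)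
Definition glue (al be : tm) (t s : point) : tm :=
  RecOr (TLe t s) (TLe s t) (ExtApp al [s; t]) (ExtApp be [t; s]).

(** On the diagonal [t = s] both halves restrict to their third side, the common arrow [d]. *)
Lemma glue_overlap G i A a x y f u v d al be t s :
  square_data G i A a x y f u v d ->
  has_type G al (hom2 A u f d) -> has_type G be (hom2 A (id_hom a) v d) ->
  point_scoped (cubes G) t -> point_scoped (cubes G) s ->
  eq_tm (ext_tope G (TAnd (TLe t s) (TLe s t))) (ExtApp al [s; t]) (ExtApp be [t; s]) A.
Proof.
  intros S Hal Hbe Ht Hs.
  set (G' := ext_tope G _).
  assert (He : entails (topes G') (TEq t s)).
  { apply ent_le_antisym; [eapply ent_and_l | eapply ent_and_r]; in_hyps. }
  assert (S' : square_data G' i A a x y f u v d) by (apply square_data_ext_tope, S).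
  eapply deq_trans.
  { eapply hom2_app_h; [eapply upper_triangle, S' | | | |];
      try apply has_type_ext_tope; eauto with stt. }
  apply deq_sym; eapply deq_trans.
  { eapply hom2_app_h; [eapply lower_triangle, S' | | | |];
      try apply has_type_ext_tope; eauto using ent_eq_sym with stt. }
  eapply eq_hom_app; eauto with stt.
Qed.

Lemma ty_glue G i A a x y f u v d al be t s :
  square_data G i A a x y f u v d ->
  has_type G al (hom2 A u f d) -> has_type G be (hom2 A (id_hom a) v d) ->
  point_scoped (cubes G) t -> point_scoped (cubes G) s ->
  has_type G (glue al be t s) A.
Proof.
  intros S Hal Hbe Ht Hs.
  eapply ty_recor; cbn; eauto using ent_le_total, glue_overlap with stt.
Qed.

Lemma eq_glue G i A a x y f u v d al be al' be' t s :
  square_data G i A a x y f u v d ->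
  has_type G al (hom2 A u f d) -> has_type G be (hom2 A (id_hom a) v d) ->
  eq_tm G al al' (hom2 A u f d) -> eq_tm G be be' (hom2 A (id_hom a) v d) ->
  point_scoped (cubes G) t -> point_scoped (cubes G) s ->
  eq_tm G (glue al be t s) (glue al' be' t s) A.
Proof.
  intros S Hal Hbe Ea Eb Ht Hs.
  eapply deq_recor; cbn; eauto using ent_le_total, glue_overlap with stt.
  - eapply eq_hom2_app; [apply eq_tm_ext_tope, Ea| | |]; eauto with stt.
  - eapply eq_hom2_app; [apply eq_tm_ext_tope, Eb| | |]; eauto with stt.
Qed.

Lemma glue_le G i A a x y f u v d al be t s :
  square_data G i A a x y f u v d ->
  has_type G al (hom2 A u f d) -> has_type G be (hom2 A (id_hom a) v d) ->
  point_scoped (cubes G) t -> point_scoped (cubes G) s -> entails (topes G) (TLe t s) ->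
  eq_tm G (glue al be t s) (ExtApp al [s; t]) A.
Proof. intros; apply deq_recor_l; eauto using ty_glue with stt. Qed.

Lemma glue_ge G i A a x y f u v d al be t s :
  square_data G i A a x y f u v d ->
  has_type G al (hom2 A u f d) -> has_type G be (hom2 A (id_hom a) v d) ->
  point_scoped (cubes G) t -> point_scoped (cubes G) s -> entails (topes G) (TLe s t) ->
  eq_tm G (glue al be t s) (ExtApp be [t; s]) A.
Proof. intros; apply deq_recor_r; eauto using ty_glue with stt. Qed.

(** The edge of the glued square over a fixed [t], with [s] as bound coordinate. It starts on the
    side [id_hom a] of [be], hence at [a], and ends on the side [f] of [al], hence at [f t]. *)
Definition row (al be : tm) (t : point) : tm :=
  ExtLam 1 (glue (cwk 1 al) (cwk 1 be) (point_subst (pshift 1) t) (PVar 0)).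

Lemma row_body G i A a x y f u v d al be t :
  square_data G i A a x y f u v d ->
  has_type G al (hom2 A u f d) -> has_type G be (hom2 A (id_hom a) v d) ->
  point_scoped (cubes G) t ->
  dpath_body G i (cwk 1 A) a (ExtApp f [t])
    (glue (cwk 1 al) (cwk 1 be) (point_subst (pshift 1) t) (PVar 0)).
Proof.
  intros S Hal Hbe Ht.
  assert (S' : forall phi, square_data (ext_shape G 1 phi) i (cwk 1 A) (cwk 1 a) (cwk 1 x)
    (cwk 1 y) (cwk 1 f) (cwk 1 u) (cwk 1 v) (cwk 1 d)) by auto with stt.
  assert (Hal' : forall phi, has_type (ext_shape G 1 phi) (cwk 1 al)
    (hom2 (cwk 1 A) (cwk 1 u) (cwk 1 f) (cwk 1 d))) by eauto with stt.
  assert (Hbe' : forall phi, has_type (ext_shape G 1 phi) (cwk 1 be)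
    (hom2 (cwk 1 A) (id_hom (cwk 1 a)) (cwk 1 v) (cwk 1 d))).
  { intros; rewrite <- cwk_id_hom; eauto with stt. }
  apply hom_body; eauto with stt.
  - eapply ty_glue; eauto with stt.
  - eapply deq_trans; [eapply glue_ge; eauto with stt|].
    eapply deq_trans; [eapply hom2_app_f; [eapply lower_triangle, S'| | | |]; eauto with stt|].
    eapply id_hom_app; eauto with stt.
  - eapply deq_trans; [eapply glue_le; eauto with stt|].
    eapply hom2_app_g; [eapply upper_triangle, S'| | | |]; eauto with stt.
Qed.

Lemma ty_row G i A a x y f u v d al be t :
  square_data G i A a x y f u v d ->
  has_type G al (hom2 A u f d) -> has_type G be (hom2 A (id_hom a) v d) ->
  point_scoped (cubes G) t ->
  has_type G (row al be t) (hom A a (ExtApp f [t])).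
Proof. intros; eapply dpath_intro, row_body; eauto. Qed.

Lemma eq_row G i A a x y f u v d al be al' be' t :
  square_data G i A a x y f u v d ->
  has_type G al (hom2 A u f d) -> has_type G be (hom2 A (id_hom a) v d) ->
  eq_tm G al al' (hom2 A u f d) -> eq_tm G be be' (hom2 A (id_hom a) v d) ->
  point_scoped (cubes G) t ->
  eq_tm G (row al be t) (row al' be' t) (hom A a (ExtApp f [t])).
Proof.
  intros S Hal Hbe Ea Eb Ht; eapply deq_extlam.
  - eapply ty_hom; eauto with stt.
  - eapply eq_glue; eauto with stt.
  - eapply dpath_body_boundary, row_body; eauto.
Qed.

Lemma row_app G i A a x y f u v d al be t s :
  square_data G i A a x y f u v d ->
  has_type G al (hom2 A u f d) -> has_type G be (hom2 A (id_hom a) v d) ->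
  point_scoped (cubes G) t -> point_scoped (cubes G) s ->
  eq_tm G (ExtApp (row al be t) [s]) (glue al be t s) A.
Proof.
  intros S Hal Hbe Ht Hs.
  pose proof (hom_beta _ _ _ _ _ _ s (row_body _ _ _ _ _ _ _ _ _ _ _ _ _ S Hal Hbe Ht) Hs) as E.
  change (cinst [s] (glue (cwk 1 al) (cwk 1 be) (point_subst (pshift 1) t) (PVar 0)))
    with (glue (cinst [s] (cwk 1 al)) (cinst [s] (cwk 1 be))
      (point_subst (pinst [s]) (point_subst (pshift 1) t)) s) in E.
  now rewrite !cinst_cwk, point_subst_pinst_shift in E.
Qed.

(** Where [t = 0], the point [f t] is judgmentally [x], so that [u] lies in the fibre over [t]. *)
Lemma ty_square_end_0 G i A a x y f u v d t :
  square_data G i A a x y f u v d -> point_scoped (cubes G) t -> entails (topes G) (TEq t P0) ->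
  has_type G u (hom A a (ExtApp f [t])).
Proof.
  intros S Ht H0; eapply ty_conv; [eapply sd_u, S|].
  apply deq_sym; eapply eq_hom; eauto with stt.
  eapply hom_app_0; eauto with stt.
Qed.

Lemma ty_square_end_1 G i A a x y f u v d t :
  square_data G i A a x y f u v d -> point_scoped (cubes G) t -> entails (topes G) (TEq t P1) ->
  has_type G v (hom A a (ExtApp f [t])).
Proof.
  intros S Ht H1; eapply ty_conv; [eapply sd_v, S|].
  apply deq_sym; eapply eq_hom; eauto with stt.
  eapply hom_app_1; eauto with stt.
Qed.

(** This is [dhom (hom_from A a) f u v] with the applications of [hom_from A a] beta-reduced; see
    [eq_square_dhom]. *)
Definition square_type (A a f u v : tm) : tm :=
  dpath (hom (cwk 1 A) (cwk 1 a) (ExtApp (cwk 1 f) [PVar 0])) u v.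

Lemma cinst_square_fiber t A a f :
  cinst [t] (hom (cwk 1 A) (cwk 1 a) (ExtApp (cwk 1 f) [PVar 0])) = hom A a (ExtApp f [t]).
Proof.
  unfold cinst; rewrite ren_hom; fold (cinst [t] (cwk 1 A)); fold (cinst [t] (cwk 1 a)).
  cbn [ren]; fold (cinst [t] (cwk 1 f)); now rewrite !cinst_cwk.
Qed.

Lemma ren_square_type rho xi A a f u v :
  ren rho xi (square_type A a f u v) =
  square_type (ren rho xi A) (ren rho xi a) (ren rho xi f) (ren rho xi u) (ren rho xi v).
Proof.
  unfold square_type; rewrite ren_dpath, ren_hom; cbn [ren]; now rewrite !ren_cwk.
Qed.

Lemma has_type_cwk_square G k psi A a f u v s :
  wf G -> has_type G s (square_type A a f u v) ->
  has_type (ext_shape G k psi) (cwk k s)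
    (square_type (cwk k A) (cwk k a) (cwk k f) (cwk k u) (cwk k v)).
Proof.
  intros Hw H; pose proof (has_type_cwk G k psi _ _ Hw H) as H'.
  unfold cwk at 2 in H'; now rewrite ren_square_type in H'.
Qed.

#[global] Hint Resolve has_type_cwk_square : stt.

Lemma square_fiber_typed G i A a x y f u v d :
  square_data G i A a x y f u v d ->
  has_type (ext_shape G 1 Delta1) (hom (cwk 1 A) (cwk 1 a) (ExtApp (cwk 1 f) [PVar 0])) (Univ i).
Proof. intros; apply ty_hom; eauto with stt. Qed.

Lemma square_src_typed G i A a x y f u v d :
  square_data G i A a x y f u v d ->
  has_type (ext_shape G 1 (TEq (PVar 0) P0)) (cwk 1 u)
    (hom (cwk 1 A) (cwk 1 a) (ExtApp (cwk 1 f) [PVar 0])).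
Proof. intros; eapply ty_square_end_0; eauto with stt. Qed.

Lemma square_tgt_typed G i A a x y f u v d :
  square_data G i A a x y f u v d ->
  has_type (ext_shape G 1 (TEq (PVar 0) P1)) (cwk 1 v)
    (hom (cwk 1 A) (cwk 1 a) (ExtApp (cwk 1 f) [PVar 0])).
Proof. intros; eapply ty_square_end_1; eauto with stt. Qed.

Lemma ty_square_type G i A a x y f u v d :
  square_data G i A a x y f u v d -> has_type G (square_type A a f u v) (Univ i).
Proof.
  intros; apply ty_dpath;
    eauto using square_fiber_typed, square_src_typed, square_tgt_typed with stt.
Qed.

Lemma square_app G A a f u v s t :
  has_type G s (square_type A a f u v) -> point_scoped (cubes G) t ->
  has_type G (ExtApp s [t]) (hom A a (ExtApp f [t])).
Proof. intros Hs Ht; rewrite <- cinst_square_fiber; eapply dpath_app; eauto. Qed.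

Lemma eq_square_app G A a f u v s s' t t' :
  eq_tm G s s' (square_type A a f u v) ->
  point_scoped (cubes G) t -> point_scoped (cubes G) t' -> entails (topes G) (TEq t t') ->
  eq_tm G (ExtApp s [t]) (ExtApp s' [t']) (hom A a (ExtApp f [t])).
Proof. intros Hs Ht Ht' He; rewrite <- cinst_square_fiber; eapply eq_dpath_app; eauto. Qed.

Lemma square_app_0 G i A a x y f u v d s t :
  square_data G i A a x y f u v d -> has_type G s (square_type A a f u v) ->
  point_scoped (cubes G) t -> entails (topes G) (TEq t P0) ->
  eq_tm G (ExtApp s [t]) u (hom A a (ExtApp f [t])).
Proof.
  intros S Hs Ht H0; rewrite <- cinst_square_fiber.
  apply (dpath_app_0 _ _ (hom A a y) u v _ _ i); eauto with stt; rewrite ?cinst_square_fiber;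
    eauto 7 using ty_square_end_0 with stt.
Qed.

Lemma square_app_1 G i A a x y f u v d s t :
  square_data G i A a x y f u v d -> has_type G s (square_type A a f u v) ->
  point_scoped (cubes G) t -> entails (topes G) (TEq t P1) ->
  eq_tm G (ExtApp s [t]) v (hom A a (ExtApp f [t])).
Proof.
  intros S Hs Ht H1; rewrite <- cinst_square_fiber.
  apply (dpath_app_1 _ _ (hom A a x) u v _ _ i); eauto with stt; rewrite ?cinst_square_fiber;
    eauto 7 using ty_square_end_1 with stt.
Qed.

Lemma square_eq G i A a x y f u v d s s' :
  square_data G i A a x y f u v d ->
  has_type G s (square_type A a f u v) -> has_type G s' (square_type A a f u v) ->
  eq_tm (ext_shape G 1 Delta1) (ExtApp (cwk 1 s) [PVar 0]) (ExtApp (cwk 1 s') [PVar 0])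
    (hom (cwk 1 A) (cwk 1 a) (ExtApp (cwk 1 f) [PVar 0])) ->
  eq_tm G s s' (square_type A a f u v).
Proof. intros; eapply ext_eq; eauto with stt; eapply ty_square_type; eauto. Qed.

Definition square (al be : tm) : tm := ExtLam 1 (row (cwk 1 al) (cwk 1 be) (PVar 0)).

Lemma point_subst_pup_shift k rho p :
  point_subst (pup k rho) (point_subst (pshift k) p) = point_subst (pshift k) (point_subst rho p).
Proof. rewrite !point_subst_comp; apply point_subst_ext; intros; cbn; apply pup_add. Qed.

Lemma ren_row rho xi al be t :
  ren rho xi (row al be t) = row (ren rho xi al) (ren rho xi be) (point_subst rho t).
Proof.
  unfold row, glue; cbn [ren map tope_subst].
  now rewrite !ren_cwk, !point_subst_pup_shift.
Qed.

Lemma row_eq G i A a x y f u v d al be t s :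
  square_data G i A a x y f u v d ->
  has_type G al (hom2 A u f d) -> has_type G be (hom2 A (id_hom a) v d) ->
  point_scoped (cubes G) t -> has_type G s (hom A a (ExtApp f [t])) ->
  eq_tm (ext_shape G 1 Delta1)
    (glue (cwk 1 al) (cwk 1 be) (point_subst (pshift 1) t) (PVar 0))
    (ExtApp (cwk 1 s) [PVar 0]) (cwk 1 A) ->
  eq_tm G (row al be t) s (hom A a (ExtApp f [t])).
Proof.
  intros S Hal Hbe Ht Hs H.
  eapply hom_eq; eauto using ty_row with stt.
  eapply deq_trans; [|exact H].
  unfold cwk at 1; rewrite ren_row; eapply row_app; eauto with stt.
Qed.

(** The row over [t = 0] lies in [al], along its side [u]; dually, the row over [t = 1] lies in
    [be], along its side [v]. *)
Lemma row_0 G i A a x y f u v d al be t :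
  square_data G i A a x y f u v d ->
  has_type G al (hom2 A u f d) -> has_type G be (hom2 A (id_hom a) v d) ->
  point_scoped (cubes G) t -> entails (topes G) (TEq t P0) ->
  eq_tm G (row al be t) u (hom A a (ExtApp f [t])).
Proof.
  intros S Hal Hbe Ht H0.
  eapply row_eq; eauto using ty_square_end_0 with stt.
  eapply deq_trans; [eapply glue_le; eauto with stt|].
  eapply hom2_app_f; [eapply upper_triangle| | | |]; eauto with stt.
Qed.

Lemma row_1 G i A a x y f u v d al be t :
  square_data G i A a x y f u v d ->
  has_type G al (hom2 A u f d) -> has_type G be (hom2 A (id_hom a) v d) ->
  point_scoped (cubes G) t -> entails (topes G) (TEq t P1) ->
  eq_tm G (row al be t) v (hom A a (ExtApp f [t])).
Proof.
  intros S Hal Hbe Ht H1.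
  eapply row_eq; eauto using ty_square_end_1 with stt.
  eapply deq_trans; [eapply glue_ge; eauto with stt|].
  eapply hom2_app_g; [eapply lower_triangle| | | |]; eauto with stt.
Qed.

Lemma square_body G i A a x y f u v d al be :
  square_data G i A a x y f u v d ->
  has_type G al (hom2 A u f d) -> has_type G be (hom2 A (id_hom a) v d) ->
  dpath_body G i (hom (cwk 1 A) (cwk 1 a) (ExtApp (cwk 1 f) [PVar 0])) u v
    (row (cwk 1 al) (cwk 1 be) (PVar 0)).
Proof.
  intros S Hal Hbe; split;
    eauto using square_fiber_typed, square_src_typed, square_tgt_typed with stt.
  - eapply ty_row; eauto with stt.
  - eapply row_0; eauto with stt.
  - eapply row_1; eauto with stt.
Qed.

Lemma ty_square G i A a x y f u v d al be :
  square_data G i A a x y f u v d ->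
  has_type G al (hom2 A u f d) -> has_type G be (hom2 A (id_hom a) v d) ->
  has_type G (square al be) (square_type A a f u v).
Proof. intros; eapply dpath_intro, square_body; eauto. Qed.

Lemma eq_square G i A a x y f u v d al be al' be' :
  square_data G i A a x y f u v d ->
  has_type G al (hom2 A u f d) -> has_type G be (hom2 A (id_hom a) v d) ->
  eq_tm G al al' (hom2 A u f d) -> eq_tm G be be' (hom2 A (id_hom a) v d) ->
  eq_tm G (square al be) (square al' be') (square_type A a f u v).
Proof.
  intros S Hal Hbe Ea Eb; eapply deq_extlam.
  - eapply ty_square_type; eauto.
  - eapply eq_row; eauto with stt.
  - eapply dpath_body_boundary, square_body; eauto.
Qed.

Lemma square_beta G i A a x y f u v d al be t :
  square_data G i A a x y f u v d ->
  has_type G al (hom2 A u f d) -> has_type G be (hom2 A (id_hom a) v d) ->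
  point_scoped (cubes G) t ->
  eq_tm G (ExtApp (square al be) [t]) (row al be t) (hom A a (ExtApp f [t])).
Proof.
  intros S Hal Hbe Ht.
  pose proof (dpath_beta _ _ _ _ _ _ t (square_body _ _ _ _ _ _ _ _ _ _ _ _ S Hal Hbe) Ht) as E.
  rewrite cinst_square_fiber in E; unfold cinst in E; rewrite ren_row in E.
  fold (cinst [t] (cwk 1 al)) (cinst [t] (cwk 1 be)) in E.
  now rewrite !cinst_cwk in E.
Qed.

Lemma square_app2 G i A a x y f u v d al be t s :
  square_data G i A a x y f u v d ->
  has_type G al (hom2 A u f d) -> has_type G be (hom2 A (id_hom a) v d) ->
  point_scoped (cubes G) t -> point_scoped (cubes G) s ->
  eq_tm G (ExtApp (ExtApp (square al be) [t]) [s]) (glue al be t s) A.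
Proof.
  intros; eapply deq_trans; [|eapply row_app; eauto].
  eapply eq_hom_app; eauto using square_beta with stt.
Qed.

Lemma ren_square rho xi al be :
  ren rho xi (square al be) = square (ren rho xi al) (ren rho xi be).
Proof. unfold square; cbn [ren]; now rewrite ren_row, !ren_cwk. Qed.

(** Extensionality in each direction in turn. After the two successive extensions of the context,
    [t] is [PVar 1] and [s] is [PVar 0], the reverse of the convention for a shape in the
    coordinates [(t, s)]. *)
Lemma square_ext G i A a x y f u v d al be s :
  square_data G i A a x y f u v d ->
  has_type G al (hom2 A u f d) -> has_type G be (hom2 A (id_hom a) v d) ->
  has_type G s (square_type A a f u v) ->
  eq_tm (ext_shape (ext_shape G 1 Delta1) 1 Delta1)
    (glue (cwk 1 (cwk 1 al)) (cwk 1 (cwk 1 be)) (PVar 1) (PVar 0))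
    (ExtApp (ExtApp (cwk 1 (cwk 1 s)) [PVar 1]) [PVar 0]) (cwk 1 (cwk 1 A)) ->
  eq_tm G (square al be) s (square_type A a f u v).
Proof.
  intros S Hal Hbe Hs H.
  eapply square_eq; eauto using ty_square.
  unfold cwk at 1; rewrite ren_square.
  fold (cwk 1 al) (cwk 1 be).
  eapply deq_trans; [eapply square_beta; eauto with stt|].
  eapply row_eq; eauto with stt.
  eapply square_app; eauto with stt.
Qed.

Lemma cwk_square k al be : cwk k (square al be) = square (cwk k al) (cwk k be).
Proof. apply ren_square. Qed.

Lemma glue_eq G i A a x y f u v d al be t s w :
  square_data G i A a x y f u v d ->
  has_type G al (hom2 A u f d) -> has_type G be (hom2 A (id_hom a) v d) ->
  point_scoped (cubes G) t -> point_scoped (cubes G) s -> has_type G w A ->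
  eq_tm (ext_tope G (TLe t s)) (ExtApp al [s; t]) w A ->
  eq_tm (ext_tope G (TLe s t)) (ExtApp be [t; s]) w A ->
  eq_tm G (glue al be t s) w A.
Proof.
  intros S Hal Hbe Ht Hs Hw H1 H2.
  apply (eq_tm_cases _ (TLe t s) (TLe s t) _ _ _ i); cbn;
    eauto using ent_le_total, ty_glue with stt.
  - eapply deq_trans; [|exact H1]; eapply glue_le; eauto with stt.
  - eapply deq_trans; [|exact H2]; eapply glue_ge; eauto with stt.
Qed.

(** * Cutting a square along its diagonal *)

Definition diag (s : tm) : tm := ExtLam 1 (ExtApp (ExtApp (cwk 1 s) [PVar 0]) [PVar 0]).
(** The upper half is the part [t <= s], whereas in [Delta2] the second coordinate is the smaller
    one; so the coordinates are exchanged. *)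
Definition upper (s : tm) : tm := ExtLam 2 (ExtApp (ExtApp (cwk 2 s) [PVar 1]) [PVar 0]).
Definition lower (s : tm) : tm := ExtLam 2 (ExtApp (ExtApp (cwk 2 s) [PVar 0]) [PVar 1]).

Lemma cwk_diag k s : cwk k (diag s) = diag (cwk k s).
Proof. unfold diag, cwk at 1; cbn [ren]; now rewrite ren_cwk. Qed.

Lemma cwk_upper k s : cwk k (upper s) = upper (cwk k s).
Proof. unfold upper, cwk at 1; cbn [ren]; now rewrite ren_cwk. Qed.

Lemma cwk_lower k s : cwk k (lower s) = lower (cwk k s).
Proof. unfold lower, cwk at 1; cbn [ren]; now rewrite ren_cwk. Qed.

Lemma square_point G A a f u v s p q :
  has_type G s (square_type A a f u v) -> point_scoped (cubes G) p -> point_scoped (cubes G) q ->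
  has_type G (ExtApp (ExtApp s [p]) [q]) A.
Proof. intros; eapply hom_app, H1; eapply square_app; eauto. Qed.

Lemma eq_square_point G A a f u v s p q p' q' :
  has_type G s (square_type A a f u v) ->
  point_scoped (cubes G) p -> point_scoped (cubes G) q ->
  point_scoped (cubes G) p' -> point_scoped (cubes G) q' ->
  entails (topes G) (TEq p p') -> entails (topes G) (TEq q q') ->
  eq_tm G (ExtApp (ExtApp s [p]) [q]) (ExtApp (ExtApp s [p']) [q']) A.
Proof. intros; eapply eq_hom_app; eauto; eapply eq_square_app; eauto with stt. Qed.

Lemma diag_body G i A a x y f u v d s :
  square_data G i A a x y f u v d -> has_type G s (square_type A a f u v) ->
  dpath_body G i (cwk 1 A) a y (ExtApp (ExtApp (cwk 1 s) [PVar 0]) [PVar 0]).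
Proof.
  intros S Hs.
  assert (Hs' : forall phi, has_type (ext_shape G 1 phi) (ExtApp (cwk 1 s) [PVar 0])
            (hom (cwk 1 A) (cwk 1 a) (ExtApp (cwk 1 f) [PVar 0])))
    by (intros; eapply square_app; eauto with stt).
  apply hom_body; eauto with stt.
  - eapply hom_app_0; eauto with stt.
  - eapply deq_trans; [eapply hom_app_1; eauto with stt|].
    eapply hom_app_1; eauto with stt.
Qed.

Lemma ty_diag G i A a x y f u v d s :
  square_data G i A a x y f u v d -> has_type G s (square_type A a f u v) ->
  has_type G (diag s) (hom A a y).
Proof. intros; eapply dpath_intro, diag_body; eauto. Qed.

Lemma diag_app G i A a x y f u v d s t :
  square_data G i A a x y f u v d -> has_type G s (square_type A a f u v) ->
  point_scoped (cubes G) t ->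
  eq_tm G (ExtApp (diag s) [t]) (ExtApp (ExtApp s [t]) [t]) A.
Proof.
  intros S Hs Ht.
  pose proof (hom_beta _ _ _ _ _ _ t (diag_body _ _ _ _ _ _ _ _ _ _ _ S Hs) Ht) as E.
  change (cinst [t] (ExtApp (ExtApp (cwk 1 s) [PVar 0]) [PVar 0])) with
    (ExtApp (ExtApp (cinst [t] (cwk 1 s)) [t]) [t]) in E.
  now rewrite cinst_cwk in E.
Qed.

Lemma square_data_diag G i A a x y f u v d s :
  square_data G i A a x y f u v d -> has_type G s (square_type A a f u v) ->
  square_data G i A a x y f u v (diag s).
Proof. intros S Hs; pose proof (ty_diag _ _ _ _ _ _ _ _ _ _ _ S Hs); destruct S; split; auto. Qed.

Lemma upper_body G i A a x y f u v d s :
  square_data G i A a x y f u v d -> has_type G s (square_type A a f u v) ->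
  hom2_body G A u f (diag s) (ExtApp (ExtApp (cwk 2 s) [PVar 1]) [PVar 0]).
Proof.
  intros S Hs.
  assert (S' : forall phi, square_data (ext_shape G 2 phi) i (cwk 2 A) (cwk 2 a) (cwk 2 x)
    (cwk 2 y) (cwk 2 f) (cwk 2 u) (cwk 2 v) (cwk 2 d)) by auto with stt.
  assert (Hs' : forall phi, has_type (ext_shape G 2 phi) (cwk 2 s)
    (square_type (cwk 2 A) (cwk 2 a) (cwk 2 f) (cwk 2 u) (cwk 2 v))) by eauto with stt.
  split.
  - eapply square_point; eauto with stt.
  - eapply eq_hom_app; [eapply square_app_0| | |]; eauto with stt.
  - rewrite cwk_diag.
    eapply deq_trans; [|apply deq_sym; eapply diag_app; eauto with stt].
    eapply eq_square_point; eauto with stt.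
  - eapply hom_app_1; [eapply square_app| | | | | |]; eauto with stt.
Qed.

Lemma lower_body G i A a x y f u v d s :
  square_data G i A a x y f u v d -> has_type G s (square_type A a f u v) ->
  hom2_body G A (id_hom a) v (diag s) (ExtApp (ExtApp (cwk 2 s) [PVar 0]) [PVar 1]).
Proof.
  intros S Hs.
  assert (S' : forall phi, square_data (ext_shape G 2 phi) i (cwk 2 A) (cwk 2 a) (cwk 2 x)
    (cwk 2 y) (cwk 2 f) (cwk 2 u) (cwk 2 v) (cwk 2 d)) by auto with stt.
  assert (Hs' : forall phi, has_type (ext_shape G 2 phi) (cwk 2 s)
    (square_type (cwk 2 A) (cwk 2 a) (cwk 2 f) (cwk 2 u) (cwk 2 v))) by eauto with stt.
  split.
  - eapply square_point; eauto with stt.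
  - rewrite cwk_id_hom.
    eapply deq_trans; [|apply deq_sym; eapply id_hom_app; eauto with stt].
    eapply hom_app_0; [eapply square_app| | | | | |]; eauto with stt.
  - rewrite cwk_diag.
    eapply deq_trans; [|apply deq_sym; eapply diag_app; eauto with stt].
    eapply eq_square_point; eauto with stt.
  - eapply eq_hom_app; [eapply square_app_1| | |]; eauto with stt.
Qed.

Lemma ty_upper G i A a x y f u v d s :
  square_data G i A a x y f u v d -> has_type G s (square_type A a f u v) ->
  has_type G (upper s) (hom2 A u f (diag s)).
Proof.
  intros; eapply hom2_intro; [eapply upper_triangle, square_data_diag | eapply upper_body]; eauto.
Qed.

Lemma ty_lower G i A a x y f u v d s :
  square_data G i A a x y f u v d -> has_type G s (square_type A a f u v) ->
  has_type G (lower s) (hom2 A (id_hom a) v (diag s)).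
Proof.
  intros; eapply hom2_intro; [eapply lower_triangle, square_data_diag | eapply lower_body]; eauto.
Qed.

Lemma upper_app G i A a x y f u v d s p q :
  square_data G i A a x y f u v d -> has_type G s (square_type A a f u v) ->
  point_scoped (cubes G) p -> point_scoped (cubes G) q -> entails (topes G) (TLe q p) ->
  eq_tm G (ExtApp (upper s) [p; q]) (ExtApp (ExtApp s [q]) [p]) A.
Proof.
  intros S Hs Hp Hq He.
  pose proof (hom2_beta _ _ _ _ _ _ _ _ _ _ p q
    (upper_triangle _ _ _ _ _ _ _ _ _ _ (square_data_diag _ _ _ _ _ _ _ _ _ _ _ S Hs))
    (upper_body _ _ _ _ _ _ _ _ _ _ _ S Hs) Hp Hq He) as E.
  change (cinst [p; q] (ExtApp (ExtApp (cwk 2 s) [PVar 1]) [PVar 0])) with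
    (ExtApp (ExtApp (cinst [p; q] (cwk 2 s)) [q]) [p]) in E.
  now rewrite cinst_cwk in E.
Qed.

Lemma lower_app G i A a x y f u v d s p q :
  square_data G i A a x y f u v d -> has_type G s (square_type A a f u v) ->
  point_scoped (cubes G) p -> point_scoped (cubes G) q -> entails (topes G) (TLe q p) ->
  eq_tm G (ExtApp (lower s) [p; q]) (ExtApp (ExtApp s [p]) [q]) A.
Proof.
  intros S Hs Hp Hq He.
  pose proof (hom2_beta _ _ _ _ _ _ _ _ _ _ p q
    (lower_triangle _ _ _ _ _ _ _ _ _ _ (square_data_diag _ _ _ _ _ _ _ _ _ _ _ S Hs))
    (lower_body _ _ _ _ _ _ _ _ _ _ _ S Hs) Hp Hq He) as E.
  change (cinst [p; q] (ExtApp (ExtApp (cwk 2 s) [PVar 0]) [PVar 1])) with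
    (ExtApp (ExtApp (cinst [p; q] (cwk 2 s)) [p]) [q]) in E.
  now rewrite cinst_cwk in E.
Qed.

Lemma diag_square G i A a x y f u v d al be :
  square_data G i A a x y f u v d ->
  has_type G al (hom2 A u f d) -> has_type G be (hom2 A (id_hom a) v d) ->
  eq_tm G (diag (square al be)) d (hom A a y).
Proof.
  intros S Hal Hbe.
  pose proof (ty_square _ _ _ _ _ _ _ _ _ _ _ _ S Hal Hbe) as Hsq.
  pose proof (ty_diag _ _ _ _ _ _ _ _ _ _ _ S Hsq) as Hdg.
  eapply hom_eq; eauto with stt.
  rewrite cwk_diag.
  eapply deq_trans; [eapply diag_app; eauto with stt|rewrite cwk_square].
  eapply deq_trans; [eapply square_app2; eauto with stt|].
  eapply deq_trans; [eapply glue_le; eauto with stt|].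
  eapply hom2_app_h; [eapply upper_triangle| | | |]; eauto with stt.
Qed.

Lemma upper_square G i A a x y f u v d al be :
  square_data G i A a x y f u v d ->
  has_type G al (hom2 A u f d) -> has_type G be (hom2 A (id_hom a) v d) ->
  eq_tm G (upper (square al be)) al (hom2 A u f d).
Proof.
  intros S Hal Hbe.
  pose proof (ty_square _ _ _ _ _ _ _ _ _ _ _ _ S Hal Hbe) as Hsq.
  eapply hom2_eq; eauto using upper_triangle.
  (* The third side of [upper (square al be)] is [diag (square al be)], which [diag_square] turns
     into [d]. *)
  - eapply ty_conv; [eapply ty_upper; eauto|].
    eapply eq_hom2; eauto using upper_triangle, square_data_diag, diag_square with stt.
  - rewrite cwk_upper.
    eapply deq_trans; [eapply upper_app; eauto with stt|rewrite cwk_square].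
    eapply deq_trans; [eapply square_app2; eauto with stt|].
    eapply glue_le; eauto with stt.
Qed.

(** At a point with [t <= s] the glued square evaluates its upper half and elsewhere its lower half,
    and either one is a restriction of [s]; the case rule for topes then gives a judgmental
    equality. *)
Lemma square_upper_lower G i A a x y f u v d s :
  square_data G i A a x y f u v d -> has_type G s (square_type A a f u v) ->
  eq_tm G (square (upper s) (lower s)) s (square_type A a f u v).
Proof.
  intros S Hs.
  pose proof (square_data_diag _ _ _ _ _ _ _ _ _ _ _ S Hs) as S'.
  pose proof (ty_upper _ _ _ _ _ _ _ _ _ _ _ S Hs) as Hu.
  pose proof (ty_lower _ _ _ _ _ _ _ _ _ _ _ S Hs) as Hl.
  eapply square_ext; eauto.
  eapply glue_eq; eauto 9 using square_point with stt.
  - rewrite !cwk_upper; eapply upper_app; [|apply has_type_ext_tope|..]; eauto 9 with stt.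
  - rewrite !cwk_lower; eapply lower_app; [|apply has_type_ext_tope|..]; eauto 9 with stt.
Qed.

(** * Types of composites and of lifts *)

Lemma subst_wk1 sigma t : subst (sup sigma) (wk 1 t) = wk 1 (subst sigma t).
Proof. symmetry; apply ren_subst; reflexivity. Qed.

Lemma inst1_wk1 t a : inst1 (wk 1 t) a = t.
Proof. now apply subst_ren_cancel. Qed.

Lemma subst_inst_wk1 t a :
  subst (fun i => match i with 0 => a | S i => Var i end) (wk 1 t) = t.
Proof. apply inst1_wk1. Qed.

Lemma subst_cwk k sigma t : subst (csup k sigma) (cwk k t) = cwk k (subst sigma t).
Proof. symmetry; apply ren_subst; reflexivity. Qed.

(** For motives that ignore the path variable, which makes [J] a transport. *)
Lemma inst2_wk1 P b p : inst2 (wk 1 P) b p = inst1 P b.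
Proof.
  unfold inst2, inst1, wk.
  rewrite (subst_ren P PVar (Nat.add 1) (fun i => match i with 0 => b | S i => Var i end)).
  - now rewrite ren_id.
  - intros [|i]; [now apply ren_id | reflexivity].
Qed.

Lemma subst_hom sigma A a b :
  subst sigma (hom A a b) = hom (subst sigma A) (subst sigma a) (subst sigma b).
Proof. unfold hom, endpoints; cbn [subst]; now rewrite !subst_cwk. Qed.

Lemma subst_hom2 sigma A f g h :
  subst sigma (hom2 A f g h) = hom2 (subst sigma A) (subst sigma f) (subst sigma g) (subst sigma h).
Proof. unfold hom2, triangle_boundary; cbn [subst]; now rewrite !subst_cwk. Qed.

Lemma subst_square_type sigma A a f u v :
  subst sigma (square_type A a f u v) =
  square_type (subst sigma A) (subst sigma a) (subst sigma f) (subst sigma u) (subst sigma v).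
Proof.
  unfold square_type, dpath, endpoints; cbn [subst].
  now rewrite subst_hom; cbn [subst]; rewrite !subst_cwk.
Qed.

Lemma subst_degen sigma d : subst sigma (degen d) = degen (subst sigma d).
Proof. unfold degen; cbn [subst]; now rewrite subst_cwk. Qed.

Lemma subst_square sigma al be :
  subst sigma (square al be) = square (subst sigma al) (subst sigma be).
Proof. unfold square, row, glue; cbn [subst]; now rewrite !subst_cwk. Qed.

Lemma subst_diag sigma s : subst sigma (diag s) = diag (subst sigma s).
Proof. unfold diag; cbn [subst]; now rewrite subst_cwk. Qed.

Lemma subst_upper sigma s : subst sigma (upper s) = upper (subst sigma s).
Proof. unfold upper; cbn [subst]; now rewrite subst_cwk. Qed.

Lemma ren_degen rho xi d : ren rho xi (degen d) = degen (ren rho xi d).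
Proof. unfold degen; cbn [ren]; now rewrite ren_cwk. Qed.

Lemma ren_diag rho xi s : ren rho xi (diag s) = diag (ren rho xi s).
Proof. unfold diag; cbn [ren]; now rewrite ren_cwk. Qed.

Lemma ren_upper rho xi s : ren rho xi (upper s) = upper (ren rho xi s).
Proof. unfold upper; cbn [ren]; now rewrite ren_cwk. Qed.

Lemma ty_var_0 G A : has_type (ext_type G A) (Var 0) (wk 1 A).
Proof. now apply (ty_var (ext_type G A) 0). Qed.
#[global] Hint Resolve ty_var_0 : stt.

Lemma has_type_wk_univ G B A i :
  wf G -> has_type G A (Univ i) -> has_type (ext_type G B) (wk 1 A) (Univ i).
Proof. apply has_type_wk. Qed.
#[global] Hint Resolve has_type_wk_univ : stt.

Lemma wk_hom m A a b : wk m (hom A a b) = hom (wk m A) (wk m a) (wk m b).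
Proof. apply ren_hom. Qed.

Lemma wk_hom2 m A f g h : wk m (hom2 A f g h) = hom2 (wk m A) (wk m f) (wk m g) (wk m h).
Proof. apply ren_hom2. Qed.

Lemma wk_id_hom m a : wk m (id_hom a) = id_hom (wk m a).
Proof. apply ren_id_hom. Qed.

(** An inner horn, [u] followed by [f]. It asks both for a composite in [A] and for a lift of [u]
    along [f] in [hom_from A a]. *)
Record horn_data (G : ctx) (i : nat) (A a x y f u : tm) : Prop := {
  hd_wf : wf G;
  hd_A : has_type G A (Univ i);
  hd_a : has_type G a A;
  hd_x : has_type G x A;
  hd_y : has_type G y A;
  hd_f : has_type G f (hom A x y);
  hd_u : has_type G u (hom A a x) }.
#[global] Hint Resolve hd_wf hd_A hd_a hd_x hd_y hd_f hd_u : stt.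

Lemma has_type_wk_hom G B A a b f :
  wf G -> has_type G f (hom A a b) ->
  has_type (ext_type G B) (wk 1 f) (hom (wk 1 A) (wk 1 a) (wk 1 b)).
Proof. rewrite <- wk_hom; apply has_type_wk. Qed.
#[global] Hint Resolve has_type_wk_hom : stt.

Lemma horn_hom G i A a x y f u :
  horn_data G i A a x y f u -> has_type G (hom A a y) (Univ i).
Proof. intros []; now apply ty_hom. Qed.

Lemma horn_data_wk G i A a x y f u B j :
  has_type G B (Univ j) -> horn_data G i A a x y f u ->
  horn_data (ext_type G B) i (wk 1 A) (wk 1 a) (wk 1 x) (wk 1 y) (wk 1 f) (wk 1 u).
Proof. intros HB []; split; eauto with stt. Qed.

Lemma horn_square_data G i A a x y f u v d :
  horn_data G i A a x y f u -> has_type G v (hom A a y) -> has_type G d (hom A a y) ->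
  square_data G i A a x y f u v d.
Proof. intros []; split; auto. Qed.

Lemma horn_triangle G i A a x y f u d :
  horn_data G i A a x y f u -> has_type G d (hom A a y) -> triangle_data G i A a x y u f d.
Proof. intros []; split; auto. Qed.

(** The horn whose composites are the possible lower halves of a square with target side [v]. *)
Lemma horn_id G i A a x y f u v :
  horn_data G i A a x y f u -> has_type G v (hom A a y) ->
  horn_data G i A a a y v (id_hom a).
Proof. intros []; split; eauto with stt. Qed.

Definition comp_type (A a y u f : tm) : tm :=
  Sig (hom A a y) (hom2 (wk 1 A) (wk 1 u) (wk 1 f) (Var 0)).

(** The total type of lifts in [is_covariant] for [hom_from A a], beta-reduced. As there, [f] comes
    before [u], whereas [comp_type] keeps the order of composition. *)
Definition lift_type (A a y f u : tm) : tm :=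
  Sig (hom A a y) (square_type (wk 1 A) (wk 1 a) (wk 1 f) (wk 1 u) (Var 0)).

Lemma wk1_comp_type A a y u f :
  wk 1 (comp_type A a y u f) = comp_type (wk 1 A) (wk 1 a) (wk 1 y) (wk 1 u) (wk 1 f).
Proof.
  unfold comp_type, wk at 1; cbn [ren]; rewrite ren_hom, ren_hom2, !ren_wk1; reflexivity.
Qed.

Lemma wk1_lift_type A a y f u :
  wk 1 (lift_type A a y f u) = lift_type (wk 1 A) (wk 1 a) (wk 1 y) (wk 1 f) (wk 1 u).
Proof.
  unfold lift_type, wk at 1; cbn [ren]; rewrite ren_hom, ren_square_type, !ren_wk1; reflexivity.
Qed.

Lemma inst1_comp_fiber A u f d :
  inst1 (hom2 (wk 1 A) (wk 1 u) (wk 1 f) (Var 0)) d = hom2 A u f d.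
Proof.
  unfold inst1; now rewrite subst_hom2, !subst_inst_wk1.
Qed.

Lemma inst1_lift_fiber A a f u v :
  inst1 (square_type (wk 1 A) (wk 1 a) (wk 1 f) (wk 1 u) (Var 0)) v = square_type A a f u v.
Proof.
  unfold inst1; now rewrite subst_square_type, !subst_inst_wk1.
Qed.

Lemma ty_hom_var G A a b :
  has_type (ext_type G (hom A a b)) (Var 0) (hom (wk 1 A) (wk 1 a) (wk 1 b)).
Proof. rewrite <- wk_hom; apply ty_var_0. Qed.

Lemma ty_comp_fiber G i A a x y f u :
  horn_data G i A a x y f u ->
  has_type (ext_type G (hom A a y)) (hom2 (wk 1 A) (wk 1 u) (wk 1 f) (Var 0)) (Univ i).
Proof.
  intros H; eapply ty_hom2, horn_triangle;
    [eapply horn_data_wk; eauto using horn_hom | apply ty_hom_var].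
Qed.

Lemma ty_lift_fiber G i A a x y f u :
  horn_data G i A a x y f u ->
  has_type (ext_type G (hom A a y))
    (square_type (wk 1 A) (wk 1 a) (wk 1 f) (wk 1 u) (Var 0)) (Univ i).
Proof.
  intros H; eapply ty_square_type, horn_square_data;
    [eapply horn_data_wk; eauto using horn_hom | apply ty_hom_var | apply ty_hom_var].
Qed.

Lemma ty_comp_type G i A a x y f u :
  horn_data G i A a x y f u -> has_type G (comp_type A a y u f) (Univ (Nat.max i i)).
Proof. intros; apply ty_sig; [eauto using horn_hom | eapply ty_comp_fiber; eauto]. Qed.

Lemma ty_lift_type G i A a x y f u :
  horn_data G i A a x y f u -> has_type G (lift_type A a y f u) (Univ (Nat.max i i)).
Proof. intros; apply ty_sig; [eauto using horn_hom | eapply ty_lift_fiber; eauto]. Qed.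

Lemma comp_snd G A a y u f c :
  has_type G c (comp_type A a y u f) -> has_type G (Snd c) (hom2 A u f (Fst c)).
Proof. intros H; apply ty_snd in H; now rewrite inst1_comp_fiber in H. Qed.

Lemma lift_snd G A a y f u s :
  has_type G s (lift_type A a y f u) -> has_type G (Snd s) (square_type A a f u (Fst s)).
Proof. intros H; apply ty_snd in H; now rewrite inst1_lift_fiber in H. Qed.

Lemma ty_comp_pair G i A a x y f u d al :
  horn_data G i A a x y f u -> has_type G d (hom A a y) -> has_type G al (hom2 A u f d) ->
  has_type G (Pair d al) (comp_type A a y u f).
Proof.
  intros; eapply ty_pair; eauto using ty_comp_fiber, horn_hom; now rewrite inst1_comp_fiber.
Qed.

Lemma ty_lift_pair G i A a x y f u v s :
  horn_data G i A a x y f u -> has_type G v (hom A a y) -> has_type G s (square_type A a f u v) ->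
  has_type G (Pair v s) (lift_type A a y f u).
Proof.
  intros; eapply ty_pair; eauto using ty_lift_fiber, horn_hom; now rewrite inst1_lift_fiber.
Qed.

Lemma eq_comp_pair G i A a x y f u d d' al al' :
  horn_data G i A a x y f u -> eq_tm G d d' (hom A a y) -> eq_tm G al al' (hom2 A u f d) ->
  eq_tm G (Pair d al) (Pair d' al') (comp_type A a y u f).
Proof.
  intros; eapply deq_pair; eauto using ty_comp_fiber, horn_hom; now rewrite inst1_comp_fiber.
Qed.

Lemma eq_lift_pair G i A a x y f u v v' s s' :
  horn_data G i A a x y f u -> eq_tm G v v' (hom A a y) ->
  eq_tm G s s' (square_type A a f u v) ->
  eq_tm G (Pair v s) (Pair v' s') (lift_type A a y f u).
Proof.
  intros; eapply deq_pair; eauto using ty_lift_fiber, horn_hom; now rewrite inst1_lift_fiber.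
Qed.

Lemma comp_fst_beta G i A a x y f u d al :
  horn_data G i A a x y f u -> has_type G d (hom A a y) -> has_type G al (hom2 A u f d) ->
  eq_tm G (Fst (Pair d al)) d (hom A a y).
Proof.
  intros; eapply deq_fst_beta; eauto using ty_comp_fiber, horn_hom; now rewrite inst1_comp_fiber.
Qed.

Lemma comp_snd_beta G i A a x y f u d al :
  horn_data G i A a x y f u -> has_type G d (hom A a y) -> has_type G al (hom2 A u f d) ->
  eq_tm G (Snd (Pair d al)) al (hom2 A u f d).
Proof.
  intros; rewrite <- (inst1_comp_fiber A u f d).
  eapply deq_snd_beta; eauto using ty_comp_fiber, horn_hom; now rewrite inst1_comp_fiber.
Qed.

Lemma lift_snd_beta G i A a x y f u v s :
  horn_data G i A a x y f u -> has_type G v (hom A a y) -> has_type G s (square_type A a f u v) ->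
  eq_tm G (Snd (Pair v s)) s (square_type A a f u v).
Proof.
  intros; rewrite <- (inst1_lift_fiber A a f u v).
  eapply deq_snd_beta; eauto using ty_lift_fiber, horn_hom; now rewrite inst1_lift_fiber.
Qed.

Lemma eq_comp_type_triangle G i A a x y f u d d' :
  horn_data G i A a x y f u -> has_type G d (hom A a y) -> has_type G d' (hom A a y) ->
  eq_tm G d d' (hom A a y) -> eq_tm G (hom2 A u f d) (hom2 A u f d') (Univ i).
Proof. intros; eapply eq_hom2; eauto using horn_triangle with stt. Qed.

(** Completing a composition triangle by a degenerate lower half makes the composite itself the
    target side of the square. *)
Definition to_lift (c : tm) : tm := Pair (Fst c) (square (Snd c) (degen (Fst c))).
Definition to_comp (s : tm) : tm := Pair (diag (Snd s)) (upper (Snd s)).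

Lemma ren_to_lift rho xi c : ren rho xi (to_lift c) = to_lift (ren rho xi c).
Proof. unfold to_lift; cbn [ren]; now rewrite ren_square, ren_degen. Qed.

Lemma ren_to_comp rho xi s : ren rho xi (to_comp s) = to_comp (ren rho xi s).
Proof. unfold to_comp; cbn [ren]; now rewrite ren_diag, ren_upper. Qed.

Lemma subst_to_lift sigma c : subst sigma (to_lift c) = to_lift (subst sigma c).
Proof. unfold to_lift; cbn [subst]; now rewrite subst_square, subst_degen. Qed.

Lemma subst_to_comp sigma s : subst sigma (to_comp s) = to_comp (subst sigma s).
Proof. unfold to_comp; cbn [subst]; now rewrite subst_diag, subst_upper. Qed.

Lemma ty_comp_fst G A a y u f c :
  has_type G c (comp_type A a y u f) -> has_type G (Fst c) (hom A a y).
Proof. apply ty_fst. Qed.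

Lemma ty_lift_fst G A a y f u s :
  has_type G s (lift_type A a y f u) -> has_type G (Fst s) (hom A a y).
Proof. apply ty_fst. Qed.

Lemma ty_horn_degen G i A a x y f u v :
  horn_data G i A a x y f u -> has_type G v (hom A a y) ->
  has_type G (degen v) (hom2 A (id_hom a) v v).
Proof. intros []; intros; eapply ty_degen; eauto. Qed.

Lemma ty_to_lift G i A a x y f u c :
  horn_data G i A a x y f u -> has_type G c (comp_type A a y u f) ->
  has_type G (to_lift c) (lift_type A a y f u).
Proof.
  intros H Hc; pose proof (ty_comp_fst _ _ _ _ _ _ _ Hc).
  eapply ty_lift_pair; eauto.
  eapply ty_square; eauto using horn_square_data, comp_snd, ty_horn_degen.
Qed.

Lemma ty_to_comp G i A a x y f u s :
  horn_data G i A a x y f u -> has_type G s (lift_type A a y f u) ->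
  has_type G (to_comp s) (comp_type A a y u f).
Proof.
  intros H Hs; pose proof (ty_lift_fst _ _ _ _ _ _ _ Hs) as Hf.
  pose proof (horn_square_data _ _ _ _ _ _ _ _ _ _ H Hf Hf) as S.
  eapply ty_comp_pair; eauto using ty_diag, ty_upper, lift_snd.
Qed.

Lemma eq_diag G i A a x y f u v d s s' :
  square_data G i A a x y f u v d -> has_type G s (square_type A a f u v) ->
  eq_tm G s s' (square_type A a f u v) -> eq_tm G (diag s) (diag s') (hom A a y).
Proof.
  intros S Hs E; eapply deq_extlam.
  - eapply ty_hom; eauto with stt.
  - eapply eq_hom_app; [eapply eq_square_app | | |]; eauto with stt.
    unfold cwk at 3; rewrite <- ren_square_type; apply eq_tm_cwk; eauto with stt.
  - eapply dpath_body_boundary, diag_body; eauto.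
Qed.

Lemma eq_upper G i A a x y f u v d s s' :
  square_data G i A a x y f u v d -> has_type G s (square_type A a f u v) ->
  eq_tm G s s' (square_type A a f u v) -> eq_tm G (upper s) (upper s') (hom2 A u f (diag s)).
Proof.
  intros S Hs E; pose proof (square_data_diag _ _ _ _ _ _ _ _ _ _ _ S Hs) as S'.
  eapply deq_extlam.
  - eapply ty_hom2, upper_triangle, S'.
  - eapply eq_hom_app; [eapply eq_square_app | | |]; eauto with stt.
    unfold cwk at 3; rewrite <- ren_square_type; apply eq_tm_cwk; eauto with stt.
  - eapply hom2_body_boundary; [eapply upper_triangle, S' | eapply upper_body; eauto].
Qed.

(** Cutting off the degenerate half again returns the composite by [diag_square] and the triangle by
    [upper_square]; eta for pairs concludes. *)
Lemma to_comp_to_lift G i A a x y f u c :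
  horn_data G i A a x y f u -> has_type G c (comp_type A a y u f) ->
  eq_tm G (to_comp (to_lift c)) c (comp_type A a y u f).
Proof.
  intros H Hc.
  pose proof (ty_comp_fst _ _ _ _ _ _ _ Hc) as Hd.
  pose proof (comp_snd _ _ _ _ _ _ _ Hc) as Hal.
  pose proof (ty_horn_degen _ _ _ _ _ _ _ _ _ H Hd) as Hbe.
  pose proof (horn_square_data _ _ _ _ _ _ _ _ _ _ H Hd Hd) as S.
  pose proof (ty_square _ _ _ _ _ _ _ _ _ _ _ _ S Hal Hbe) as Hsq.
  pose proof (deq_sym _ _ _ _ (lift_snd_beta _ _ _ _ _ _ _ _ _ _ H Hd Hsq)) as E.
  apply deq_sym; eapply deq_trans; [apply deq_sig_eta, Hc|].
  pose proof (diag_square _ _ _ _ _ _ _ _ _ _ _ _ S Hal Hbe) as Ed.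
  pose proof (ty_diag _ _ _ _ _ _ _ _ _ _ _ S Hsq) as Hdg.
  eapply eq_comp_pair; eauto.
  - eapply deq_trans; [apply deq_sym, Ed | eapply eq_diag; eauto].
  - eapply deq_trans; [eapply deq_sym, upper_square; eauto|].
    (* [eq_upper] yields an equality over the diagonal of the square, which is converted to one over
       [Fst c]. *)
    eapply deq_conv; [eapply eq_upper; eauto|].
    eapply eq_comp_type_triangle; eauto.
Qed.

Lemma eq_to_lift_pair G i A a x y f u v al :
  horn_data G i A a x y f u -> has_type G v (hom A a y) -> has_type G al (hom2 A u f v) ->
  eq_tm G (to_lift (Pair v al)) (Pair v (square al (degen v))) (lift_type A a y f u).
Proof.
  intros H Hv Hal.
  pose proof (ty_horn_degen _ _ _ _ _ _ _ _ _ H Hv) as Hbe.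
  pose proof (horn_square_data _ _ _ _ _ _ _ _ _ _ H Hv Hv) as S.
  pose proof (deq_sym _ _ _ _ (comp_fst_beta _ _ _ _ _ _ _ _ _ _ H Hv Hal)) as E1.
  pose proof (deq_sym _ _ _ _ (comp_snd_beta _ _ _ _ _ _ _ _ _ _ H Hv Hal)) as E2.
  apply deq_sym; eapply eq_lift_pair; eauto.
  eapply eq_square; eauto.
  eapply eq_degen; eauto with stt.
Qed.

Lemma eq_lift_eta G i A a x y f u s :
  horn_data G i A a x y f u -> has_type G s (lift_type A a y f u) ->
  eq_tm G (Pair (Fst s) (square (upper (Snd s)) (lower (Snd s)))) s (lift_type A a y f u).
Proof.
  intros H Hs; pose proof (ty_lift_fst _ _ _ _ _ _ _ Hs) as Hf.
  eapply deq_trans; [|apply deq_sym, deq_sig_eta, Hs].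
  eapply eq_lift_pair; eauto using deq_refl.
  eapply square_upper_lower; eauto using horn_square_data, lift_snd.
Qed.

(** * Path induction and contractibility *)

Lemma ty_transport G X P a b d p i j :
  wf G -> has_type G X (Univ i) -> has_type G a X -> has_type G b X ->
  has_type (ext_type G X) P (Univ j) -> has_type G d (inst1 P a) ->
  has_type G p (Id X a b) ->
  has_type G (J (wk 1 P) d p) (inst1 P b).
Proof.
  intros Hw HX Ha Hb HP Hd Hp.
  rewrite <- (inst2_wk1 P b p).
  eapply (ty_J _ X a); eauto.
  - apply (has_type_wk _ _ _ _ (wf_ext_type _ _ _ Hw HX) HP).
  - now rewrite inst2_wk1.
Qed.

Lemma ty_contr_fiber G X i :
  wf G -> has_type G X (Univ i) ->
  has_type (ext_type G X) (Pi (wk 1 X) (Id (wk 2 X) (Var 1) (Var 0))) (Univ (Nat.max i i)).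
Proof.
  intros Hw HX.
  assert (Hw1 : wf (ext_type G X)) by eauto with stt.
  assert (HX1 : has_type (ext_type G X) (wk 1 X) (Univ i)) by auto with stt.
  apply ty_pi; auto.
  apply ty_id; rewrite (wk_S 1).
  - auto with stt.
  - apply (has_type_wk _ _ (Var 0)); auto with stt.
  - auto with stt.
Qed.

Lemma ty_is_contr G X i :
  wf G -> has_type G X (Univ i) -> has_type G (is_contr X) (Univ (Nat.max i (Nat.max i i))).
Proof. intros; apply ty_sig; auto using ty_contr_fiber. Qed.

Lemma contr_center G X k : has_type G k (is_contr X) -> has_type G (Fst k) X.
Proof. apply ty_fst. Qed.

Lemma contr_center_path G X k y :
  has_type G k (is_contr X) -> has_type G y X -> has_type G (App (Snd k) y) (Id X (Fst k) y).
Proof.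
  intros Hk Hy.
  pose proof (ty_snd _ _ _ _ Hk) as H.
  unfold inst1 in H; cbn [subst] in H.
  apply ty_app with (a := y) in H.
  - unfold inst1 in H; cbn [subst sup] in H.
    now rewrite (wk_S 1), subst_wk1, !subst_inst_wk1 in H.
  - now rewrite subst_inst_wk1.
Qed.

Lemma is_contr_intro G X c p i :
  wf G -> has_type G X (Univ i) -> has_type G c X ->
  has_type (ext_type G X) p (Id (wk 1 X) (wk 1 c) (Var 0)) ->
  has_type G (Pair c (Lam p)) (is_contr X).
Proof.
  intros Hw HX Hc Hp.
  eapply ty_pair; eauto using ty_contr_fiber.
  unfold inst1; cbn [subst sup]; rewrite (wk_S 1), subst_wk1, subst_inst_wk1.
  eapply ty_lam; eauto.
Qed.

(** Transports the path from the centre to [y], in the family of paths ending at [y], along the path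
    from the centre to [x]. This takes the place of inversion and concatenation. *)
Definition contr_path (X k x y : tm) : tm :=
  J (wk 1 (Id (wk 1 X) (Var 0) (wk 1 y))) (App (Snd k) y) (App (Snd k) x).

Lemma ty_contr_path G X k x y i :
  wf G -> has_type G X (Univ i) -> has_type G k (is_contr X) ->
  has_type G x X -> has_type G y X ->
  has_type G (contr_path X k x y) (Id X x y).
Proof.
  intros Hw HX Hk Hx Hy.
  assert (E : forall z, inst1 (Id (wk 1 X) (Var 0) (wk 1 y)) z = Id X z y).
  { intros z; unfold inst1; cbn [subst]; now rewrite !subst_inst_wk1. }
  rewrite <- (E x); eapply (ty_transport G X _ (Fst k));
    eauto using contr_center, contr_center_path.
  - apply ty_id; eauto with stt.
  - rewrite E; now apply contr_center_path.
Qed.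

(* [F] is a function of the variable [Var 0], substituted meta-theoretically. *)
Definition ap (Y F a p : tm) : tm :=
  J (wk 1 (Id (wk 1 Y) (wk 1 (inst1 F a)) F)) (Refl (inst1 F a)) p.

(** Typing is shown stable under renaming only, so the typing of the instance [inst1 F a] appears as
    a hypothesis. *)
Lemma ty_ap G X Y F a b p i j :
  wf G -> has_type G X (Univ i) -> has_type G Y (Univ j) ->
  has_type (ext_type G X) F (wk 1 Y) -> has_type G (inst1 F a) Y ->
  has_type G a X -> has_type G b X -> has_type G p (Id X a b) ->
  has_type G (ap Y F a p) (Id Y (inst1 F a) (inst1 F b)).
Proof.
  intros Hw HX HY HF HFa Ha Hb Hp.
  assert (E : forall z, inst1 (Id (wk 1 Y) (wk 1 (inst1 F a)) F) z = Id Y (inst1 F a) (inst1 F z)).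
  { intros z; unfold inst1 at 1; cbn [subst]; now rewrite !subst_inst_wk1. }
  rewrite <- E; apply (ty_transport G X _ a b _ p i j); auto.
  - apply ty_id; eauto with stt.
  - rewrite E; eapply ty_refl; eauto.
Qed.

(** * Transfer of contractibility between composites and lifts *)

Lemma inst1_to_comp s : inst1 (to_comp (Var 0)) s = to_comp s.
Proof. apply subst_to_comp. Qed.

Lemma inst1_to_lift c : inst1 (to_lift (Var 0)) c = to_lift c.
Proof. apply subst_to_lift. Qed.

(** Contractibility of a judgmental retract: the path from the centre of the lifts to [to_lift c] is
    mapped by [to_comp], and its end [to_comp (to_lift c)] is [c] by conversion. *)
Definition comp_contr (A a y u f k : tm) : tm :=
  Pair (to_comp (Fst k))
    (Lam (ap (wk 1 (comp_type A a y u f)) (to_comp (Var 0)) (Fst (wk 1 k))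
            (App (Snd (wk 1 k)) (to_lift (Var 0))))).

Lemma ty_to_comp_var G i A a x y f u :
  horn_data G i A a x y f u ->
  has_type (ext_type G (lift_type A a y f u)) (to_comp (Var 0)) (wk 1 (comp_type A a y u f)).
Proof.
  intros H; rewrite wk1_comp_type; eapply ty_to_comp.
  - eapply horn_data_wk; eauto using ty_lift_type.
  - rewrite <- wk1_lift_type; auto with stt.
Qed.

Lemma ty_to_lift_var G i A a x y f u :
  horn_data G i A a x y f u ->
  has_type (ext_type G (comp_type A a y u f)) (to_lift (Var 0)) (wk 1 (lift_type A a y f u)).
Proof.
  intros H; rewrite wk1_lift_type; eapply ty_to_lift.
  - eapply horn_data_wk; eauto using ty_comp_type.
  - rewrite <- wk1_comp_type; auto with stt.
Qed.

Lemma wk1_is_contr X : wk 1 (is_contr X) = is_contr (wk 1 X).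
Proof.
  unfold is_contr, wk at 1; cbn [ren]; now rewrite !(wk_S 1), !ren_wk1.
Qed.

Lemma ty_comp_contr G i A a x y f u k :
  horn_data G i A a x y f u -> has_type G k (is_contr (lift_type A a y f u)) ->
  has_type G (comp_contr A a y u f k) (is_contr (comp_type A a y u f)).
Proof.
  intros H Hk.
  pose proof (ty_comp_type _ _ _ _ _ _ _ _ H) as HC.
  assert (Hc : has_type G (to_comp (Fst k)) (comp_type A a y u f))
    by (eapply ty_to_comp; eauto using contr_center).
  eapply is_contr_intro; eauto with stt.
  set (G1 := ext_type G (comp_type A a y u f)).
  pose proof (horn_data_wk _ _ _ _ _ _ _ _ _ _ HC H) as H1; fold G1 in H1.
  pose proof (has_type_wk _ (comp_type A a y u f) _ _ (hd_wf _ _ _ _ _ _ _ _ H) Hk) as Hk1.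
  rewrite wk1_is_contr, wk1_lift_type in Hk1; fold G1 in Hk1.
  pose proof (ty_var_0 G (comp_type A a y u f)) as Hv; fold G1 in Hv.
  replace (wk 1 (to_comp (Fst k))) with (to_comp (Fst (wk 1 k))) by (symmetry; apply ren_to_comp).
  rewrite !wk1_comp_type in *.
  pose proof (ty_to_lift _ _ _ _ _ _ _ _ _ H1 Hv) as Hs.
  pose proof (contr_center_path _ _ _ _ Hk1 Hs) as Hp.
  eapply ty_conv.
  - eapply (ty_ap G1); [eapply hd_wf, H1 | eapply ty_lift_type, H1 | eapply ty_comp_type, H1
      | eapply ty_to_comp_var, H1 | | eapply contr_center, Hk1 | exact Hs | exact Hp].
    rewrite inst1_to_comp; eapply ty_to_comp; eauto using contr_center.
  - rewrite !inst1_to_comp; apply deq_id.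
    + apply deq_refl; eapply ty_comp_type, H1.
    + apply deq_refl; eapply ty_to_comp; eauto using contr_center.
    + eapply to_comp_to_lift; eauto.
Qed.

(** The case of a degenerate lower half. Such a lift is [to_lift] of the pair of [v] and [al], so
    the image under [to_lift] of the contraction at this pair is the required path. *)
Lemma ty_lift_path_degen G i A a x y f u k v al :
  horn_data G i A a x y f u -> has_type G k (is_contr (comp_type A a y u f)) ->
  has_type G v (hom A a y) -> has_type G al (hom2 A u f v) ->
  has_type G (ap (lift_type A a y f u) (to_lift (Var 0)) (Fst k) (App (Snd k) (Pair v al)))
    (Id (lift_type A a y f u) (to_lift (Fst k)) (Pair v (square al (degen v)))).
Proof.
  intros H Hk Hv Hal.
  pose proof (ty_comp_pair _ _ _ _ _ _ _ _ _ _ H Hv Hal) as Hp.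
  assert (Hc : has_type G (to_lift (Fst k)) (lift_type A a y f u))
    by (eapply ty_to_lift; eauto using contr_center).
  eapply ty_conv.
  - eapply (ty_ap G); [eapply hd_wf, H | eapply ty_comp_type, H | eapply ty_lift_type, H
      | eapply ty_to_lift_var, H | | eapply contr_center, Hk | exact Hp
      | apply contr_center_path; eauto].
    now rewrite inst1_to_lift.
  - rewrite !inst1_to_lift; apply deq_id.
    + apply deq_refl; eapply ty_lift_type, H.
    + now apply deq_refl.
    + eapply eq_to_lift_pair; eauto.
Qed.

(* The family [fun w => forall al : hom2 A u f (Fst w), c = (v, square al (Snd w))] over
   the type of pairs [w] of a diagonal and a lower triangle of a square with target [v]. *)
Definition lift_motive (A a y f u v c : tm) : tm :=
  Pi (hom2 (wk 1 A) (wk 1 u) (wk 1 f) (Fst (Var 0)))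
    (Id (wk 2 (lift_type A a y f u)) (wk 2 c) (Pair (wk 2 v) (square (Var 0) (Snd (Var 1))))).

Lemma inst1_lift_motive A a y f u v c w :
  inst1 (lift_motive A a y f u v c) w =
  Pi (hom2 A u f (Fst w))
    (Id (wk 1 (lift_type A a y f u)) (wk 1 c) (Pair (wk 1 v) (square (Var 0) (Snd (wk 1 w))))).
Proof.
  unfold lift_motive, inst1; cbn [subst]; rewrite subst_hom2, subst_square.
  rewrite !(wk_S 1), !subst_wk1, !subst_inst_wk1; reflexivity.
Qed.

Lemma ty_lift_motive G i A a x y f u v c :
  horn_data G i A a x y f u -> has_type G v (hom A a y) ->
  has_type G c (lift_type A a y f u) ->
  has_type (ext_type G (comp_type A a y (id_hom a) v)) (lift_motive A a y f u v c)
    (Univ (Nat.max i (Nat.max i i))).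
Proof.
  intros H Hv Hc.
  pose proof (horn_id _ _ _ _ _ _ _ _ _ H Hv) as HT.
  pose proof (ty_comp_type _ _ _ _ _ _ _ _ HT) as HTu.
  set (T := comp_type A a y (id_hom a) v) in *.
  pose proof (horn_data_wk _ _ _ _ _ _ _ _ _ _ HTu H) as H1.
  pose proof (horn_data_wk _ _ _ _ _ _ _ _ _ _ HTu HT) as HT1.
  pose proof (ty_var_0 G T) as Hw; unfold T in Hw at 2; rewrite wk1_comp_type in Hw.
  pose proof (has_type_wk_hom G T _ _ _ _ (hd_wf _ _ _ _ _ _ _ _ H) Hv) as Hv1.
  pose proof (has_type_wk G T _ _ (hd_wf _ _ _ _ _ _ _ _ H) Hc) as Hc1.
  rewrite wk1_lift_type in Hc1.
  set (G1 := ext_type G T) in *.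
  pose proof (ty_comp_fst _ _ _ _ _ _ _ Hw) as Hd.
  pose proof (comp_snd _ _ _ _ _ _ _ Hw) as Hbe.
  pose proof (ty_hom2 _ _ _ _ _ _ _ _ _ (horn_triangle _ _ _ _ _ _ _ _ _ H1 Hd)) as HB.
  set (B := hom2 (wk 1 A) (wk 1 u) (wk 1 f) (Fst (Var 0))) in *.
  apply ty_pi; [exact HB|].
  pose proof (hd_wf _ _ _ _ _ _ _ _ H1) as Hwf1.
  pose proof (horn_data_wk _ _ _ _ _ _ _ _ _ _ HB H1) as H2.
  pose proof (has_type_wk_hom G1 B _ _ _ _ Hwf1 Hv1) as Hv2.
  pose proof (has_type_wk_hom G1 B _ _ _ _ Hwf1 Hd) as Hd2.
  pose proof (has_type_wk G1 B _ _ Hwf1 Hc1) as Hc2.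
  pose proof (has_type_wk G1 B _ _ Hwf1 Hbe) as Hbe2.
  pose proof (ty_var_0 G1 B) as Hal2; unfold B in Hal2 at 2.
  rewrite wk1_lift_type in Hc2; rewrite wk_hom2 in Hal2, Hbe2; rewrite !wk_id_hom in Hbe2.
  rewrite !(wk_S 1), !wk1_lift_type.
  apply ty_id; [eapply ty_lift_type, H2 | exact Hc2 |].
  eapply ty_lift_pair; [exact H2 | exact Hv2 |].
  eapply ty_square; [eapply horn_square_data, Hd2; eauto | exact Hal2 | exact Hbe2].
Qed.

Lemma wk1_to_lift c : wk 1 (to_lift c) = to_lift (wk 1 c).
Proof. apply ren_to_lift. Qed.

(** The transported statement is a function of the upper half. It starts over the degenerate lower
    half on [Fst s] and is moved to [lower (Snd s)]; only then does the diagonal agree with that of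
    [upper (Snd s)], to which it is applied. *)
Definition lift_path (A a y f u k l s : tm) : tm :=
  App
    (J (wk 1 (lift_motive A a y f u (Fst s) (to_lift (Fst k))))
       (Lam (ap (wk 1 (lift_type A a y f u)) (to_lift (Var 0)) (Fst (wk 1 k))
               (App (Snd (wk 1 k)) (Pair (wk 1 (Fst s)) (Var 0)))))
       (contr_path (comp_type A a y (id_hom a) (Fst s)) l
          (Pair (Fst s) (degen (Fst s))) (Pair (diag (Snd s)) (lower (Snd s)))))
    (upper (Snd s)).

Lemma ty_lift_path_start G i A a x y f u k v :
  horn_data G i A a x y f u -> has_type G k (is_contr (comp_type A a y u f)) ->
  has_type G v (hom A a y) ->
  has_type G
    (Lam (ap (wk 1 (lift_type A a y f u)) (to_lift (Var 0)) (Fst (wk 1 k))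
            (App (Snd (wk 1 k)) (Pair (wk 1 v) (Var 0)))))
    (inst1 (lift_motive A a y f u v (to_lift (Fst k))) (Pair v (degen v))).
Proof.
  intros H Hk Hv.
  pose proof (horn_id _ _ _ _ _ _ _ _ _ H Hv) as HT.
  pose proof (ty_horn_degen _ _ _ _ _ _ _ _ _ H Hv) as Hdeg.
  pose proof (ty_comp_pair _ _ _ _ _ _ _ _ _ _ HT Hv Hdeg) as Hw.
  pose proof (ty_comp_fst _ _ _ _ _ _ _ Hw) as Hd.
  pose proof (ty_hom2 _ _ _ _ _ _ _ _ _ (horn_triangle _ _ _ _ _ _ _ _ _ H Hd)) as HB.
  rewrite inst1_lift_motive; eapply ty_lam; [exact HB|].
  set (B := hom2 A u f (Fst (Pair v (degen v)))) in *.
  pose proof (hd_wf _ _ _ _ _ _ _ _ H) as Hwf.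
  pose proof (horn_data_wk _ _ _ _ _ _ _ _ _ _ HB H) as H1.
  pose proof (has_type_wk_hom G B _ _ _ _ Hwf Hv) as Hv1.
  pose proof (has_type_wk G B _ _ Hwf Hk) as Hk1.
  rewrite wk1_is_contr, wk1_comp_type in Hk1.
  pose proof (horn_id _ _ _ _ _ _ _ _ _ H1 Hv1) as HT1.
  pose proof (ty_horn_degen _ _ _ _ _ _ _ _ _ H1 Hv1) as Hdeg1.
  pose proof (ty_comp_pair _ _ _ _ _ _ _ _ _ _ HT1 Hv1 Hdeg1) as Hw1.
  pose proof (ty_comp_fst _ _ _ _ _ _ _ Hw1) as Hd1.
  pose proof (comp_fst_beta _ _ _ _ _ _ _ _ _ _ HT1 Hv1 Hdeg1) as E1.
  pose proof (comp_snd_beta _ _ _ _ _ _ _ _ _ _ HT1 Hv1 Hdeg1) as E2.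
  (* The motive types the upper half over the first projection of the pair of [v] and its degenerate
     triangle, which has to be reduced to [v]. *)
  assert (Hal : has_type (ext_type G B) (Var 0) (hom2 (wk 1 A) (wk 1 u) (wk 1 f) (wk 1 v))).
  { eapply ty_conv; [apply ty_var_0|].
    unfold B; rewrite wk_hom2.
    replace (wk 1 (Fst (Pair v (degen v)))) with (Fst (Pair (wk 1 v) (degen (wk 1 v))))
      by (unfold wk at 3; cbn [ren]; now rewrite ren_degen).
    eapply eq_comp_type_triangle; eauto. }
  rewrite wk1_lift_type, wk1_to_lift.
  eapply ty_conv; [eapply ty_lift_path_degen; eauto|].
  replace (wk 1 (Pair v (degen v))) with (Pair (wk 1 v) (degen (wk 1 v)))
    by (unfold wk at 3; cbn [ren]; now rewrite ren_degen).
  apply deq_id.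
  - apply deq_refl; eapply ty_lift_type, H1.
  - apply deq_refl; eapply ty_to_lift; eauto; eapply contr_center, Hk1.
  - eapply eq_lift_pair; [exact H1 | now apply deq_refl |].
    eapply eq_square;
      [eapply horn_square_data; [exact H1 | exact Hv1 | exact Hv1] | ..];
      eauto using deq_refl, deq_sym.
Qed.

Lemma ty_lift_path G i A a x y f u k l s :
  horn_data G i A a x y f u -> has_type G k (is_contr (comp_type A a y u f)) ->
  has_type G s (lift_type A a y f u) ->
  has_type G l (is_contr (comp_type A a y (id_hom a) (Fst s))) ->
  has_type G (lift_path A a y f u k l s) (Id (lift_type A a y f u) (to_lift (Fst k)) s).
Proof.
  intros H Hk Hs Hl.
  pose proof (ty_lift_fst _ _ _ _ _ _ _ Hs) as Hv.
  pose proof (lift_snd _ _ _ _ _ _ _ Hs) as Hq.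
  pose proof (horn_square_data _ _ _ _ _ _ _ _ _ _ H Hv Hv) as HS.
  pose proof (square_data_diag _ _ _ _ _ _ _ _ _ _ _ HS Hq) as S'.
  pose proof (horn_id _ _ _ _ _ _ _ _ _ H Hv) as HT.
  pose proof (ty_horn_degen _ _ _ _ _ _ _ _ _ H Hv) as Hdeg.
  pose proof (ty_comp_pair _ _ _ _ _ _ _ _ _ _ HT Hv Hdeg) as Hw0.
  pose proof (ty_diag _ _ _ _ _ _ _ _ _ _ _ HS Hq) as Hd.
  pose proof (ty_upper _ _ _ _ _ _ _ _ _ _ _ HS Hq) as Hup.
  pose proof (ty_lower _ _ _ _ _ _ _ _ _ _ _ HS Hq) as Hlo.
  pose proof (ty_comp_pair _ _ _ _ _ _ _ _ _ _ HT Hd Hlo) as Hw1.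
  pose proof (comp_fst_beta _ _ _ _ _ _ _ _ _ _ HT Hd Hlo) as E1.
  pose proof (comp_snd_beta _ _ _ _ _ _ _ _ _ _ HT Hd Hlo) as E2.
  pose proof (ty_comp_type _ _ _ _ _ _ _ _ HT) as HTu.
  assert (Hc : has_type G (to_lift (Fst k)) (lift_type A a y f u))
    by (eapply ty_to_lift; eauto using contr_center).
  pose proof (hd_wf _ _ _ _ _ _ _ _ H) as Hwf.
  pose proof (ty_contr_path _ _ _ _ _ _ Hwf HTu Hl Hw0 Hw1) as Hp.
  pose proof (ty_transport _ _ _ _ _ _ _ _ _ Hwf HTu Hw0 Hw1
    (ty_lift_motive _ _ _ _ _ _ _ _ _ _ H Hv Hc)
    (ty_lift_path_start _ _ _ _ _ _ _ _ _ _ H Hk Hv) Hp) as HJ.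
  rewrite inst1_lift_motive in HJ.
  (* Likewise at the far end: the transported function expects an upper half over the projection of
     a pair, not over [diag (Snd s)] itself. *)
  assert (Hup' : has_type G (upper (Snd s))
    (hom2 A u f (Fst (Pair (diag (Snd s)) (lower (Snd s)))))).
  { eapply ty_conv; [exact Hup|].
    apply deq_sym; eapply eq_comp_type_triangle; eauto using ty_comp_fst. }
  eapply ty_conv; [eapply ty_app; [exact HJ | exact Hup']|].
  unfold inst1; cbn [subst]; rewrite subst_square; cbn [subst].
  rewrite !subst_inst_wk1.
  apply deq_id.
  - apply deq_refl; eapply ty_lift_type, H.
  - now apply deq_refl.
  (* The path ends at the two halves of [s] glued together, which is [s] by [eq_lift_eta] once the
     projection from the pair is reduced. *)
  - eapply deq_trans; [|eapply eq_lift_eta; eauto].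
    apply deq_sym; eapply eq_lift_pair; [exact H | now apply deq_refl |].
    eapply eq_square; [exact S' | ..]; eauto using deq_refl, deq_sym.
Qed.

(** [l] is a term in the context extended by a lift, since one arrow of the horn whose composites it
    contracts is the target side of that lift. *)
Definition lift_contr (A a y f u k l : tm) : tm :=
  Pair (to_lift (Fst k))
    (Lam (lift_path (wk 1 A) (wk 1 a) (wk 1 y) (wk 1 f) (wk 1 u) (wk 1 k) l (Var 0))).

Lemma ty_lift_contr G i A a x y f u k l :
  horn_data G i A a x y f u -> has_type G k (is_contr (comp_type A a y u f)) ->
  has_type (ext_type G (lift_type A a y f u)) l
    (is_contr (comp_type (wk 1 A) (wk 1 a) (wk 1 y) (id_hom (wk 1 a)) (Fst (Var 0)))) ->
  has_type G (lift_contr A a y f u k l) (is_contr (lift_type A a y f u)).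
Proof.
  intros H Hk Hl.
  pose proof (ty_lift_type _ _ _ _ _ _ _ _ H) as HL.
  eapply is_contr_intro; eauto with stt.
  - eapply ty_to_lift; eauto using contr_center.
  - rewrite wk1_to_lift.
    pose proof (has_type_wk _ (lift_type A a y f u) _ _ (hd_wf _ _ _ _ _ _ _ _ H) Hk) as Hk1.
    pose proof (ty_var_0 G (lift_type A a y f u)) as Hs.
    rewrite wk1_is_contr, wk1_comp_type in Hk1.
    pose proof (horn_data_wk _ _ _ _ _ _ _ _ _ _ HL H) as H1.
    set (G1 := ext_type G _) in *.
    rewrite wk1_lift_type in *.
    eapply (ty_lift_path G1); eauto.
Qed.

(** * Segal types and covariance of [hom] *)

Lemma eq_is_contr G X X' i :
  wf G -> has_type G X (Univ i) -> eq_tm G X X' (Univ i) ->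
  eq_tm G (is_contr X) (is_contr X') (Univ (Nat.max i (Nat.max i i))).
Proof.
  intros Hw HX E.
  assert (Hw1 : wf (ext_type G X)) by eauto with stt.
  assert (HX1 : has_type (ext_type G X) (wk 1 X) (Univ i)) by auto with stt.
  assert (E1 : eq_tm (ext_type G X) (wk 1 X) (wk 1 X') (Univ i))
    by (apply (eq_tm_wk _ _ _ _ (Univ i)); auto).
  apply deq_sig; auto; apply deq_pi; auto.
  rewrite !(wk_S 1); apply deq_id.
  - apply (eq_tm_wk _ _ _ _ (Univ i)); auto.
  - apply deq_refl, (has_type_wk _ _ (Var 0)); auto with stt.
  - auto with stt.
Qed.

Lemma ren_hom_from rho xi A a :
  ren rho xi (hom_from A a) = hom_from (ren rho xi A) (ren rho xi a).
Proof. unfold hom_from; cbn [ren]; now rewrite ren_hom, !ren_wk1. Qed.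

Lemma cwk_hom_from k A a : cwk k (hom_from A a) = hom_from (cwk k A) (cwk k a).
Proof. apply ren_hom_from. Qed.

Lemma wk_hom_from m A a : wk m (hom_from A a) = hom_from (wk m A) (wk m a).
Proof. apply ren_hom_from. Qed.

Lemma eq_hom_from G i A a x :
  wf G -> has_type G A (Univ i) -> has_type G a A -> has_type G x A ->
  eq_tm G (hom A a x) (App (hom_from A a) x) (Univ i).
Proof.
  intros Hw HA Ha Hx; apply deq_sym.
  replace (hom A a x) with (inst1 (hom (wk 1 A) (wk 1 a) (Var 0)) x)
    by (unfold inst1; now rewrite subst_hom, !subst_inst_wk1).
  apply (deq_pi_beta G A (Univ i) _ _ i); auto.
  eapply ty_hom; eauto with stt.
Qed.

Lemma eq_square_dhom G i A a x y f u v d :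
  square_data G i A a x y f u v d ->
  eq_tm G (square_type A a f u v) (dhom (hom_from A a) f u v) (Univ i).
Proof.
  intros HS; apply deq_ext; [exact I | cbn; auto | apply entails_Delta1 | |].
  - rewrite cwk_hom_from; eapply eq_hom_from; eauto with stt.
  - apply deq_refl; eapply ty_endpoints;
      eauto using square_fiber_typed, square_src_typed, square_tgt_typed with stt.
Qed.

Lemma eq_lift_type_dhom G i A a x y f u :
  horn_data G i A a x y f u ->
  eq_tm G (lift_type A a y f u)
    (Sig (App (hom_from A a) y) (dhom (wk 1 (hom_from A a)) (wk 1 f) (wk 1 u) (Var 0)))
    (Univ (Nat.max i i)).
Proof.
  intros H; apply deq_sig; [eapply horn_hom, H | eapply eq_hom_from; eauto with stt |].
  rewrite wk_hom_from.
  eapply eq_square_dhom, horn_square_data;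
    [eapply horn_data_wk; eauto using horn_hom | apply ty_hom_var | apply ty_hom_var].
Qed.

(* [is_covariant A (hom_from A a)] with the applications of [hom_from A a] reduced. *)
Definition hom_covariant (A a : tm) : tm :=
  Pi A (Pi (wk 1 A)
    (Pi (hom (wk 2 A) (Var 1) (Var 0))
    (Pi (hom (wk 3 A) (wk 3 a) (Var 2))
      (is_contr (lift_type (wk 4 A) (wk 4 a) (Var 2) (Var 1) (Var 0)))))).

(** The type is specified up to an equation of syntax; in a concrete context [reflexivity] then
    computes the weakening, and in [has_type_App] the instantiation. *)
Lemma has_type_Var G n A T :
  nth_error (types G) n = Some A -> wk (S n) A = T -> has_type G (Var n) T.
Proof. intros H <-; now apply ty_var. Qed.

Lemma has_type_App G A B f a T :
  has_type G f (Pi A B) -> has_type G a A -> inst1 B a = T -> has_type G (App f a) T.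
Proof. intros Hf Ha <-; eapply ty_app; eauto. Qed.

Ltac var := eapply has_type_Var; reflexivity.
Ltac solve_wf := unfold wf; cbn; repeat constructor.
Ltac horn := split; [solve_wf | var ..].

Definition uctx (l : nat) : ctx := ext_type empty (Univ l).

Ltac ty_hom_var := apply ty_hom; [solve_wf | var ..].
Ltac ty_bind := eapply ty_pi; [first [var | ty_hom_var]|].

Lemma ty_is_segal l : exists j, has_type (uctx l) (is_segal (Var 0)) (Univ j).
Proof.
  eexists; do 5 ty_bind.
  apply ty_is_contr; [solve_wf|].
  (* The arrows [f] and [g] of [is_segal] are [Var 1] and [Var 0]; they play the roles of [u] and
     [f] in the horn. *)
  apply (ty_comp_type _ l (Var 5) (Var 4) (Var 3) (Var 2) (Var 0) (Var 1)); horn.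
Qed.

(** Beta-reduction occurs in two places, the type of [u] and the type of lifts, both under binders;
    the congruence rules carry it outwards. Both conjuncts hold at the same universe level [j]. *)
Lemma eq_hom_covariant l :
  exists j,
    has_type (uctx l) (Pi (Var 0) (hom_covariant (Var 1) (Var 0))) (Univ j) /\
    eq_tm (uctx l) (Pi (Var 0) (hom_covariant (Var 1) (Var 0)))
      (Pi (Var 0) (is_covariant (Var 1) (hom_from (Var 1) (Var 0)))) (Univ j).
Proof.
  eexists; split.
  - do 5 ty_bind.
    apply ty_is_contr; [solve_wf|].
    apply (ty_lift_type _ l (Var 5) (Var 4) (Var 3) (Var 2) (Var 1) (Var 0)); horn.
  - do 3 (apply deq_pi; [var | apply deq_refl; var |]).
    apply deq_pi; [ty_hom_var | apply deq_refl; ty_hom_var |].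
    apply deq_pi;
      [ty_hom_var | apply (eq_hom_from _ l (Var 4) (Var 3) (Var 2)); [solve_wf | var ..] |].
    apply eq_is_contr; [solve_wf | |].
    + apply (ty_lift_type _ l (Var 5) (Var 4) (Var 3) (Var 2) (Var 1) (Var 0)); horn.
    + apply (eq_lift_type_dhom _ l (Var 5) (Var 4) (Var 3) (Var 2) (Var 1) (Var 0)); horn.
Qed.

(** Types an iterated application with a variable at its head; [arg] deals with the arguments. *)
Ltac apps arg := first [var | eapply has_type_App; [apps arg | arg | reflexivity]].

Lemma segal_hom_covariant l :
  exists t, has_type (ext_type (uctx l) (is_segal (Var 0))) t
    (Pi (Var 1) (hom_covariant (Var 2) (Var 0))).
Proof.
  (* [Var 6] to [Var 0] are A, the Segal hypothesis, a, x, y, f, u; in [c] there is also a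
     lift [Var 0], and the composite of [id_hom a] with its target is considered. *)
  set (k := App (App (App (App (App (Var 5) (Var 4)) (Var 3)) (Var 2)) (Var 0)) (Var 1)).
  set (c := App (App (App (App (App (Var 6) (Var 5)) (Var 5)) (Var 3)) (id_hom (Var 5)))
    (Fst (Var 0))).
  exists (Lam (Lam (Lam (Lam (Lam
    (lift_contr (Var 6) (Var 4) (Var 2) (Var 1) (Var 0) k c)))))).
  do 3 (eapply ty_lam; [var|]).
  eapply ty_lam; [ty_hom_var|].
  eapply ty_lam; [ty_hom_var|].
  set (G := ext_type _ _).
  assert (H : horn_data G l (Var 6) (Var 4) (Var 3) (Var 2) (Var 1) (Var 0)) by horn.
  apply (ty_lift_contr G l _ _ (Var 3)); [exact H | |].
  - apps var.
  - apps ltac:(first [var | eapply ty_fst; var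
      | apply (ty_id_hom _ l (Var 7) (Var 5)); [solve_wf | var ..]]).
Qed.

Lemma hom_covariant_segal l :
  exists t, has_type (ext_type (uctx l) (Pi (Var 0) (hom_covariant (Var 1) (Var 0)))) t
    (is_segal (Var 1)).
Proof.
  (* [Var 6] to [Var 0] are A, the covariance hypothesis, x, y, z, f, g; covariance of
     [hom_A(x, -)] is applied to the lifts of [f] along [g]. *)
  set (k := App (App (App (App (App (Var 5) (Var 4)) (Var 3)) (Var 2)) (Var 0)) (Var 1)).
  exists (Lam (Lam (Lam (Lam (Lam (comp_contr (Var 6) (Var 4) (Var 2) (Var 1) (Var 0) k)))))).
  do 3 (eapply ty_lam; [var|]).
  eapply ty_lam; [ty_hom_var|].
  eapply ty_lam; [ty_hom_var|].
  set (G := ext_type _ _).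
  assert (H : horn_data G l (Var 6) (Var 4) (Var 3) (Var 2) (Var 0) (Var 1)) by horn.
  apply (ty_comp_contr G l (Var 6) (Var 4) (Var 3) (Var 2) (Var 0) (Var 1)); [exact H |].
  apps var.
Qed.

Theorem mainTheorem2 (l : nat) :
  exists t : tm,
    has_type empty t
      (Pi (Univ l)
        (iff_type
          (is_segal (Var 0))
          (Pi (Var 0) (is_covariant (Var 1) (hom_from (Var 1) (Var 0)))))).
Proof.
  destruct (segal_hom_covariant l) as [s Hs], (hom_covariant_segal l) as [t Ht].
  exists (Lam (Pair (Lam s) (Lam t))).
  eapply ty_lam; [apply ty_univ|].
  fold (uctx l).
  destruct (ty_is_segal l) as [i HP], (eq_hom_covariant l) as (j & HQ & E).
  set (P := is_segal (Var 0)) in *.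
  set (Q := Pi (Var 0) (hom_covariant (Var 1) (Var 0))) in *.
  assert (Hw : wf (uctx l)) by solve_wf.
  assert (HPQ : has_type (uctx l) (arrow P Q) (Univ (Nat.max i j))) by (apply ty_pi; auto with stt).
  assert (HQP : has_type (uctx l) (arrow Q P) (Univ (Nat.max j i))) by (apply ty_pi; auto with stt).
  (* The equivalence is established for the reduced form [Q] and then converted; the level is the
     one that [deq_sig] produces for the pair of arrow types. *)
  apply ty_conv with (A := iff_type P Q) (l := Nat.max (Nat.max i j) (Nat.max j i)).
  - eapply ty_pair; eauto with stt.
    + eapply ty_lam; eauto.
    + unfold inst1; rewrite subst_inst_wk1; eapply ty_lam; eauto.
  - apply deq_sig; [exact HPQ | |].
    + apply deq_pi; auto with stt.
      apply (eq_tm_wk _ _ _ _ (Univ j)); auto.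
    + apply (eq_tm_wk _ _ _ _ (Univ (Nat.max j i))); auto.
      apply deq_pi; auto with stt.
Qed.
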